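(* (1) $\mathcal{U}_\infty$ is star-convex from $0$: if $\Lambda\in\mathcal{U}_\infty$ then $c\Lambda\in\mathcal{U}_\infty$ for all $c\in[0,1]$. (2) The boundaries of $\mathcal{U}_\infty$ and $\mathcal{C}_\infty$ intersect only in the two real points $-e^{-1}$ and $e$; in particular $\mathcal{U}_\infty$ avoids a neighborhood of every non-real boundary point of $\mathcal{C}_\infty$. (3) Near the point $e$, the boundary of $\mathcal{U}_\infty$ is contained in the analytic curve $\Gamma=\{\hat\Lambda(\theta):\theta\in[0,\theta_{\max}]\}$ (for some $\theta_{\max}>0$) together with its complex conjugate $\overline{\Gamma}$; in particular, near $e$ the boundary of $\mathcal{U}_\infty$ is piecewise analytic but not smooth.
   Context: For $\Lambda\in\mathbb{C}$, $n\ge1$ and $s_1,\dots,s_n\ge0$ with $\sum s_i\le1$, let $E_{\Lambda,(s_1,\dots,s_n)}(Z_1,\dots,Z_n)=\Lambda e^{-s_1Z_1-\cdots-s_nZ_n}$. Let $G_\Lambda$ be the smallest class of functions $\mathbb{C}\to\mathbb{C}$ containing the identity and such that for every $k\ge1$, every $(s_1,\dots,s_k)\in\mathbb{R}_{\ge0}^k$ with $\sum s_m\le1$ and every $g_1,\dots,g_k\in G_\Lambda$, the map $Z\mapsto E_{\Lambda,(s_1,\dots,s_k)}(g_1(Z),\dots,g_k(Z))$ is in $G_\Lambda$. Let $V_\Lambda=\{g(0):g\in G_\Lambda\}$, $\mathcal{V}_\infty=\{\Lambda: V_\Lambda\text{ bounded}\}$ and $\mathcal{U}_\infty$ its interior.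 Let $\mathcal{C}_\infty=\{-ue^{-u}:|u|<1\}$. For $\theta\in(0,\pi)$ let $\gamma=\gamma(\theta)$ be the unique positive real number with $\gamma^2-\sin^2\gamma=\theta^2$, and set $\hat\Lambda(\theta)=\frac{\gamma+\theta}{\sin\gamma}e^{(\gamma-\theta)\cot\gamma}e^{i\theta}$; extend continuously by $\gamma(0)=0$, $\hat\Lambda(0)=e$. *)

(* Defs.v *)
From Stdlib Require Import Reals Lra.
From Coquelicot Require Import Coquelicot.

Open Scope R_scope.

(** * Complex exponential *)

Definition Cexp (z : C) : C := (exp (Re z) * cos (Im z), exp (Re z) * sin (Im z)).

(** * The semigroup [G_Λ] and the sets it defines *)

(* Tuples (x_1, ..., x_n) are functions on [nat], of which only the values at
   1, ..., n are used. *)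
Definition E (L : C) (n : nat) (s : nat -> R) (Z : nat -> C) : C :=
  (L * Cexp (- sum_n_m (fun i => RtoC (s i) * Z i)%C 1 n))%C.

Inductive G (L : C) : (C -> C) -> Prop :=
| G_id : G L (fun Z => Z)
| G_E (k : nat) (s : nat -> R) (g : nat -> C -> C) :
    (1 <= k)%nat ->
    (forall i, (1 <= i <= k)%nat -> 0 <= s i) ->
    sum_n_m s 1 k <= 1 ->
    (forall i, (1 <= i <= k)%nat -> G L (g i)) ->
    G L (fun Z => E L k s (fun i => g i Z)).

Definition V (L : C) (w : C) : Prop := exists g, G L g /\ w = g (RtoC 0).

Definition bounded_set (S : C -> Prop) : Prop :=
  exists M : R, forall z, S z -> Cmod z <= M.

Definition V_infty (L : C) : Prop := bounded_set (V L).

Definition interior_set (S : C -> Prop) (z : C) : Prop := locally z S.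

Definition boundary (S : C -> Prop) (z : C) : Prop :=
  (forall P : C -> Prop, locally z P -> exists w, P w /\ S w) /\
  ~ interior_set S z.

Definition U_infty : C -> Prop := interior_set V_infty.

Definition C_infty (z : C) : Prop :=
  exists u : C, Cmod u < 1 /\ z = (- u * Cexp (- u))%C.

(** * The curve [Γ] *)

Definition gamma_eq (theta g : R) : Prop := 0 < g /\ g ^ 2 - (sin g) ^ 2 = theta ^ 2.

Lemma gamma_eq_lt (a b : R) :
  0 <= a -> a < b -> a ^ 2 - (sin a) ^ 2 < b ^ 2 - (sin b) ^ 2.
Proof.
  intros Ha Hab.
  assert (Habs : forall x, 0 < x -> Rabs (sin x) < x).
  { intros x Hx. apply Rabs_def1; [now apply sin_lt_x|].
    destruct (Rle_lt_dec x PI) as [Hpi|Hpi].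
    - pose proof (sin_ge_0 x (Rlt_le _ _ Hx) Hpi). lra.
    - pose proof (SIN_bound x). pose proof PI2_1. lra. }
  assert (Hid : (sin b) ^ 2 - (sin a) ^ 2 = sin (b - a) * sin (b + a)).
  { rewrite sin_minus, sin_plus.
    pose proof (sin2_cos2 a) as H1. pose proof (sin2_cos2 b) as H2.
    unfold Rsqr in *.
    replace ((sin b * cos a - cos b * sin a) * (sin b * cos a + cos b * sin a))
      with (sin b * sin b * (cos a * cos a) - cos b * cos b * (sin a * sin a)) by ring.
    replace (cos a * cos a) with (1 - sin a * sin a) by lra.
    replace (cos b * cos b) with (1 - sin b * sin b) by lra. ring. }
  pose proof (Habs (b - a) ltac:(lra)) as H1.
  pose proof (Habs (b + a) ltac:(lra)) as H2.
  pose proof (Rle_abs (sin (b - a) * sin (b + a))) as H3.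
  rewrite Rabs_mult in H3.
  pose proof (Rmult_le_0_lt_compat _ _ _ _ (Rabs_pos _) (Rabs_pos _) H1 H2) as H4.
  nra.
Qed.

Lemma gamma_eq_unique (theta : R) :
  0 < theta < PI -> exists! g, gamma_eq theta g.
Proof.
  intros [Ht Hpi].
  set (f := fun g => g ^ 2 - (sin g) ^ 2 - theta ^ 2).
  assert (Hc : continuity f).
  { intro x. apply derivable_continuous_pt. unfold f. reg. }
  assert (H0 : f 0 < 0) by (unfold f; rewrite sin_0; nra).
  assert (H1 : 0 < f PI) by (unfold f; rewrite sin_PI; nra).
  destruct (IVT f 0 PI Hc PI_RGT_0 H0 H1) as [g [[Hg0 Hg1] Hg]].
  exists g. split.
  - split; [|unfold f in Hg; lra].
    destruct Hg0 as [Hg0|Hg0]; [exact Hg0|]. subst g. lra.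
  - intros g' [Hg' He]. unfold f in Hg.
    destruct (Rtotal_order g g') as [Hl|[Hl|Hl]]; [|exact Hl|].
    + pose proof (gamma_eq_lt g g' ltac:(lra) Hl). lra.
    + pose proof (gamma_eq_lt g' g ltac:(lra) Hl). lra.
Qed.

Definition gamma (theta : R) : R :=
  if Req_EM_T theta 0 then 0 else iota (gamma_eq theta).

Lemma gamma_spec (theta : R) : 0 < theta < PI -> gamma_eq theta (gamma theta).
Proof.
  intros Ht. unfold gamma. destruct (Req_EM_T theta 0) as [H|H]; [lra|].
  apply (iota_correct (V := R_CompleteNormedModule) (gamma_eq theta)).
  now apply gamma_eq_unique.
Qed.

Definition Lambda_hat (theta : R) : C :=
  if Req_EM_T theta 0 then RtoC (exp 1)
  else
    let g := gamma theta in
    (RtoC ((g + theta) / sin g * exp ((g - theta) * (cos g / sin g)))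
     * Cexp (Ci * RtoC theta))%C.

Definition image (f : R -> C) (D : R -> Prop) (z : C) : Prop :=
  exists t, D t /\ z = f t.

Definition Gamma (theta_max : R) : C -> Prop :=
  image Lambda_hat (fun theta => 0 <= theta <= theta_max).

Definition conj_set (S : C -> Prop) (z : C) : Prop := S (Cconj z).

(** * Regularity of planar curves *)

Definition real_analytic_at (f : R -> C) (t0 : R) : Prop :=
  exists a : nat -> C_R_NormedModule,
    locally t0 (fun t => is_pseries a (t - t0) (f t)).

(* A simple arc with a parametrization that is real analytic up to and
   including the endpoints.  Regularity (nonzero velocity) is required only
   between the endpoints: at its endpoint [e], the curve [Γ] behaves like
   y = x^(3/2), and has no analytic parametrization with nonzero velocity. *)
Definition analytic_arc (S : C -> Prop) : Prop :=
  exists (f : R -> C) (a b : R),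
    a < b /\
    (forall t, a <= t <= b -> real_analytic_at f t) /\
    (forall t t', a <= t <= b -> a <= t' <= b -> f t = f t' -> t = t') /\
    (forall t, a < t < b -> ~ is_derive (f : R -> C_R_NormedModule) t (RtoC 0)) /\
    (forall z, S z <-> image f (fun t => a <= t <= b) z).

(* Near [p], the set [A] is a simple arc through [p], cut by t_0 < ... < t_n
   into finitely many analytic arcs. *)
Definition piecewise_analytic_near (A : C -> Prop) (p : C) : Prop :=
  exists (f : R -> C) (n : nat) (t : nat -> R),
    let D := fun x => t O <= x <= t n in
    (t O < 0 < t n) /\ f 0 = p /\
    (forall x, D x -> filterlim f (within D (locally x)) (locally (f x))) /\
    (forall x y, D x -> D y -> f x = f y -> x = y) /\
    (forall i, (i < n)%nat ->
       t i < t (S i) /\ analytic_arc (image f (fun x => t i <= x <= t (S i)))) /\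
    locally p (fun z => A z <-> image f D z).

(* Near [p], the set [A] is an embedded curve of class C^1: it is parametrized
   by a C^1 map [f] with nonzero velocity and with a continuous inverse [h]. *)
Definition smooth_near (A : C -> Prop) (p : C) : Prop :=
  exists (f df : R -> C) (h : C -> R) (a : R),
    let D := fun x => - a < x < a in
    0 < a /\ f 0 = p /\
    (forall x, D x ->
       is_derive (f : R -> C_R_NormedModule) x (df x) /\
       continuous df x /\ df x <> RtoC 0) /\
    (forall x, D x ->
       h (f x) = x /\ filterlim h (within (image f D) (locally (f x))) (locally x)) /\
    locally p (fun z => A z <-> image f D z).

(* Main.v *)
Require Import Defs.
From Stdlib Require Import Reals Lra Lia Psatz Arith ZArith ClassicalChoice.
From Coquelicot Require Import Coquelicot.
Open Scope R_scope.

(* [V_infty L] holds iff some bounded convex [K] containing [0] is mapped into itself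
   by [f z = L e^(-z)].  As [c K] is contained in [K] for [0 <= c <= 1], star-convexity
   follows.

   Let [L = r e^(i t)], [0 < t < PI].  If [r > |Lambda_hat t|], then [K] contains
   the points [(b - t) (cot b - i)] for all [b] in [[t, PI)], by continuous induction
   on [b], and these are unbounded.  If [r <= |Lambda_hat t|] and [gamma t <= 1/5],
   then an explicit polygon bounded by two rays and a horizontal strip is
   invariant.  This determines the boundary near [e].

   A non-real boundary point of [C_infty] is a parameter with an indifferent
   fixed point [p], [|p| = 1].  By another continuous induction, [p] lies in [K];
   as the multiplier [- p] is not real, [p] is interior to [K].  On a tube around a
   segment [[s p, p]], the functions [log |(f^n)'|] are harmonic, bounded above, and
   [0] at [p], so by Harnack the iterates distort distances by bounded factors.
   By pigeonhole some iterate then almost fixes all points of the segment, and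
   [s] can be taken so small that this contradicts [|f| >= c > 0] on [K].

   In the parameter [x = gamma t], both [t = x^2 sqrt ((x^2 - sin^2 x) / x^4)] and
   [Lambda_hat t] are analytic at [0].  Finally [|Lambda_hat t| <= e^(1 - t/12)]
   puts the boundary near [e] in a wedge with apex [e], which no regular C^1
   curve through [e] fits into. *)

(** Unboundedness at one parameter says nothing about its neighbours, while both (2) and (3) need
    open sets of parameters outside. So [V_infty] is shown to be closed off the real axis: on a
    bounded part of the half-plane Im L >= eta > 0, all bounded sets [cgen L] obey one common bound,
    since a point far enough to the left would force a point still further to the left. On the real
    axis matters differ: every nonnegative real belongs to [V_infty], so beyond e the interior has
    to be distinguished from the set itself.

    The curve arises from a family of thresholds: for a parameter of argument t, [radius t b] is the
    modulus above which the induction passes the angle b, and [gamma t] is the angle at which this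
    threshold is largest.

    The return argument at an indifferent fixed point treats rational and irrational rotation alike.
    No linearization is involved, only bounds from above and below, uniform in n, for the
    derivatives of the n-th iterates near the segment. *)

(** * Components, modulus and neighborhoods of complex numbers *)

Lemma C_ext (z w : C) : Re z = Re w -> Im z = Im w -> z = w.
Proof. destruct z, w; simpl; intros -> ->; reflexivity. Qed.

Lemma Re_add (z w : C) : Re (z + w)%C = Re z + Re w. Proof. reflexivity. Qed.
Lemma Im_add (z w : C) : Im (z + w)%C = Im z + Im w. Proof. reflexivity. Qed.
Lemma Re_opp (z : C) : Re (- z)%C = - Re z. Proof. reflexivity. Qed.
Lemma Im_opp (z : C) : Im (- z)%C = - Im z. Proof. reflexivity. Qed.
Lemma Re_sub (z w : C) : Re (z - w)%C = Re z - Re w. Proof. reflexivity. Qed.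
Lemma Im_sub (z w : C) : Im (z - w)%C = Im z - Im w. Proof. reflexivity. Qed.
Lemma Re_mul (z w : C) : Re (z * w)%C = Re z * Re w - Im z * Im w. Proof. reflexivity. Qed.
Lemma Im_mul (z w : C) : Im (z * w)%C = Re z * Im w + Im z * Re w. Proof. reflexivity. Qed.
Lemma Re_RtoC (x : R) : Re (RtoC x) = x. Proof. reflexivity. Qed.
Lemma Im_RtoC (x : R) : Im (RtoC x) = 0. Proof. reflexivity. Qed.
Lemma Re_scal (x : R) (z : C) : Re (RtoC x * z)%C = x * Re z. Proof. unfold Re, Im; simpl; ring. Qed.
Lemma Im_scal (x : R) (z : C) : Im (RtoC x * z)%C = x * Im z. Proof. unfold Re, Im; simpl; ring. Qed.
Lemma Re_Cexp (z : C) : Re (Cexp z) = exp (Re z) * cos (Im z). Proof. reflexivity. Qed.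
Lemma Im_Cexp (z : C) : Im (Cexp z) = exp (Re z) * sin (Im z). Proof. reflexivity. Qed.
Lemma Re_pair (x y : R) : Re (x, y) = x. Proof. reflexivity. Qed.
Lemma Im_pair (x y : R) : Im (x, y) = y. Proof. reflexivity. Qed.
Lemma Re_Ci : Re Ci = 0. Proof. reflexivity. Qed.
Lemma Im_Ci : Im Ci = 1. Proof. reflexivity. Qed.
Lemma Re_conj (z : C) : Re (Cconj z) = Re z. Proof. reflexivity. Qed.
Lemma Im_conj (z : C) : Im (Cconj z) = - Im z. Proof. reflexivity. Qed.

Global Hint Rewrite Re_scal Im_scal Re_add Im_add Re_opp Im_opp Re_sub Im_sub
  Re_mul Im_mul Re_RtoC Im_RtoC Re_Cexp Im_Cexp Re_pair Im_pair Re_Ci Im_Ci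
  Re_conj Im_conj Rmult_0_l Rmult_0_r Rplus_0_l Rplus_0_r Rminus_0_r Rminus_0_l
  Rmult_1_l Rmult_1_r Ropp_0 : cplx.

Ltac cext := apply C_ext; autorewrite with cplx.

Lemma exp_le (x y : R) : x <= y -> exp x <= exp y.
Proof. intros [H| ->]; [left; now apply exp_increasing | lra]. Qed.

Lemma Cexp_0 : Cexp 0 = 1.
Proof. cext; rewrite exp_0, ?cos_0, ?sin_0; ring. Qed.

Lemma Cexp_add (z w : C) : Cexp (z + w) = (Cexp z * Cexp w)%C.
Proof. cext; rewrite exp_plus, ?cos_plus, ?sin_plus; ring. Qed.

Lemma Cmod_sqr (z : C) : Cmod z ^ 2 = Re z ^ 2 + Im z ^ 2.
Proof. apply Cmod2_alt. Qed.

Lemma Cmod_eq_sqr (z : C) (x : R) : 0 <= x -> Re z ^ 2 + Im z ^ 2 = x ^ 2 -> Cmod z = x.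
Proof.
  intros Hx H. unfold Cmod. fold (Re z). fold (Im z). rewrite H. apply sqrt_pow2, Hx.
Qed.

Lemma Cmod_le_sqr (z : C) (x : R) : 0 <= x -> Re z ^ 2 + Im z ^ 2 <= x ^ 2 -> Cmod z <= x.
Proof.
  intros Hx H. pose proof (Cmod_sqr z). pose proof (Cmod_ge_0 z).
  destruct (Rle_lt_dec (Cmod z) x); [easy|nra].
Qed.

Lemma Cmod_Cexp (z : C) : Cmod (Cexp z) = exp (Re z).
Proof.
  apply Cmod_eq_sqr; [left; apply exp_pos|]. autorewrite with cplx.
  pose proof (sin2_cos2 (Im z)) as H. unfold Rsqr in H.
  transitivity (exp (Re z) ^ 2 * (sin (Im z) * sin (Im z) + cos (Im z) * cos (Im z))); [ring|].
  rewrite H; ring.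
Qed.

Lemma im_le_Cmod (z : C) : Rabs (Im z) <= Cmod z.
Proof.
  pose proof (Cmod_sqr z). pose proof (Cmod_ge_0 z).
  apply Rabs_le; split; nra.
Qed.

Lemma Cmod_le_abs (z : C) : Cmod z <= Rabs (Re z) + Rabs (Im z).
Proof.
  apply Cmod_le_sqr; [pose proof (Rabs_pos (Re z)); pose proof (Rabs_pos (Im z)); lra|].
  rewrite <- (pow2_abs (Re z)), <- (pow2_abs (Im z)).
  pose proof (Rabs_pos (Re z)); pose proof (Rabs_pos (Im z)); nra.
Qed.

Lemma Cmod_sub_sym (z w : C) : Cmod (z - w) = Cmod (w - z).
Proof. rewrite <- Cmod_opp. f_equal. ring. Qed.

Lemma Cmod_triangle_sub (z w : C) : Cmod z <= Cmod w + Cmod (z - w).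
Proof.
  replace z with (w + (z - w))%C at 1 by ring. apply Cmod_triangle.
Qed.

Lemma Cmod_triangle3 (x y z : C) : Cmod (x - z) <= Cmod (x - y) + Cmod (y - z).
Proof.
  replace (x - z)%C with ((x - y) + (y - z))%C by ring. apply Cmod_triangle.
Qed.

Lemma Cmod_scal (x : R) (z : C) : Cmod (RtoC x * z) = Rabs x * Cmod z.
Proof. rewrite Cmod_mult, Cmod_R. reflexivity. Qed.

(** The balls behind [locally] on C are squares; the factor sqrt 2 compares them with discs. *)
Lemma locally_Cmod (z : C) (P : C -> Prop) :
  locally z P <-> exists d, 0 < d /\ forall w, Cmod (w - z) < d -> P w.
Proof.
  split.
  - intros [e He]. exists e. split; [apply cond_pos|]. intros w Hw. apply He.
    apply C_NormedModule_mixin_compat1. exact Hw.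
  - intros (d & Hd & H).
    assert (Hs : 0 < d / sqrt 2) by (apply Rdiv_lt_0_compat; [easy | apply Rlt_sqrt2_0]).
    exists (mkposreal _ Hs). intros w Hw. apply H.
    apply (C_NormedModule_mixin_compat2 z w) in Hw. simpl in Hw.
    unfold minus, plus, opp in Hw; simpl in Hw.
    replace (sqrt 2 * (d / sqrt 2)) with d in Hw
      by (field; apply Rgt_not_eq, Rlt_sqrt2_0). exact Hw.
Qed.

(** * Invariant convex sets *)

Definition emap (L z : C) : C := (L * Cexp (- z))%C.

Lemma Cmod_emap (L z : C) : Cmod (emap L z) = Cmod L * exp (- Re z).
Proof. unfold emap. rewrite Cmod_mult, Cmod_Cexp. reflexivity. Qed.

Lemma emap_scal (c : R) (L z : C) : emap (RtoC c * L) z = (RtoC c * emap L z)%C.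
Proof. unfold emap. ring. Qed.

Definition convex (K : C -> Prop) : Prop :=
  forall x y t, K x -> K y -> 0 <= t <= 1 -> K (x + RtoC t * (y - x))%C.

Definition closedC (K : C -> Prop) : Prop :=
  forall z, (forall e, 0 < e -> exists w, K w /\ Cmod (w - z) < e) -> K z.

Definition bounded_by (M : R) (K : C -> Prop) : Prop := forall z, K z -> Cmod z <= M.

(** The weights in [E] sum to at most 1, not to 1; containing 0 is what makes a convex set closed
    under such combinations. *)
Record inv_convex (L : C) (K : C -> Prop) : Prop := {
  ic_0 : K 0;
  ic_convex : convex K;
  ic_emap : forall z, K z -> K (emap L z) }.

(** The least set satisfying [inv_convex L]. Being inductive, it allows bounds and continuity in L
    to be proved by induction on the construction of a point. *)
Inductive cgen (L : C) : C -> Prop :=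
| cgen_0 : cgen L 0
| cgen_emap z : cgen L z -> cgen L (emap L z)
| cgen_mix x y t : cgen L x -> cgen L y -> 0 <= t <= 1 -> cgen L (x + RtoC t * (y - x))%C.

Lemma cgen_inv_convex (L : C) : inv_convex L (cgen L).
Proof. split; [apply cgen_0 | intros x y t; apply cgen_mix | apply cgen_emap]. Qed.

Lemma cgen_least (L : C) (K : C -> Prop) : inv_convex L K -> forall z, cgen L z -> K z.
Proof.
  intros [H0 Hc Hf] z. induction 1; auto.
Qed.

Lemma convex_scal (K : C -> Prop) (z : C) (t : R) :
  convex K -> K 0 -> K z -> 0 <= t <= 1 -> K (RtoC t * z)%C.
Proof.
  intros Hc H0 Hz Ht. replace (RtoC t * z)%C with (0 + RtoC t * (z - 0))%C by ring.
  now apply Hc.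
Qed.

Lemma convex_sum (K : C -> Prop) (n : nat) (s : nat -> R) (x : nat -> C) :
  convex K -> K 0 ->
  (forall i, (1 <= i <= n)%nat -> 0 <= s i) -> sum_n_m s 1 n <= 1 ->
  (forall i, (1 <= i <= n)%nat -> K (x i)) ->
  K (sum_n_m (fun i => RtoC (s i) * x i)%C 1 n).
Proof.
  intros Hc H0 Hs Hs1 Hx.
  (* The strengthened claim, homogeneous in the total weight. *)
  assert (Hind : forall m, (m <= n)%nat ->
    0 <= sum_n_m s 1 m /\
    exists w, K w /\ sum_n_m (fun i => RtoC (s i) * x i)%C 1 m = (RtoC (sum_n_m s 1 m) * w)%C).
  { induction m as [|m IH]; intros Hm.
    - rewrite !sum_n_m_zero by lia. split; [apply Rle_refl|]. exists 0. split; [easy|].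
      cext; unfold zero; simpl; ring.
    - destruct IH as (Hpos & w & Hw & Hsum); [lia|].
      rewrite !sum_n_Sm by lia. rewrite Hsum.
      assert (Hsm := Hs (S m) ltac:(lia)).
      change (plus (sum_n_m s 1 m) (s (S m))) with (sum_n_m s 1 m + s (S m)).
      change (plus ?a ?b) with (Cplus a b).
      set (S1 := sum_n_m s 1 m) in *. set (s1 := s (S m)) in *.
      split; [lra|].
      destruct (Req_dec (S1 + s1) 0) as [E|E].
      + exists 0. split; [easy|]. replace S1 with 0 by lra. replace s1 with 0 by lra.
        cext; simpl; ring.
      + exists (w + RtoC (s1 / (S1 + s1)) * (x (S m) - w))%C. split.
        * apply Hc; [easy | apply Hx; lia |]. split.
          -- apply Rmult_le_pos; [easy|]. left; apply Rinv_0_lt_compat; lra.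
          -- apply Rmult_le_reg_r with (S1 + s1); [lra|]. field_simplify; lra.
        * cext; field; easy. }
  destruct (Hind n (le_n n)) as (Hpos & w & Hw & ->).
  apply convex_scal; auto.
Qed.

Lemma G_in_inv_convex (L : C) (K : C -> Prop) (g : C -> C) :
  inv_convex L K -> G L g -> K (g 0).
Proof.
  intros HK Hg. induction Hg as [|k s g Hk Hs Hs1 Hg IH].
  - apply (ic_0 _ _ HK).
  - unfold E. apply (ic_emap _ _ HK).
    apply (convex_sum K k s (fun i => g i 0)); auto; apply HK.
Qed.

(** The set of values [V L] need not be convex. Its combinations of weight at most 1 form a set to
    which the minimality of [cgen L] applies, so a bound on [V L] passes to [cgen L]. *)
Definition hullV (L z : C) : Prop :=
  exists k s (g : nat -> C -> C),
    (forall i, (1 <= i <= k)%nat -> 0 <= s i) /\ sum_n_m s 1 k <= 1 /\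
    (forall i, (1 <= i <= k)%nat -> G L (g i)) /\
    z = sum_n_m (fun i => RtoC (s i) * g i 0)%C 1 k.

Lemma sum_n_m_C_scal (c : R) (f : nat -> C) (n m : nat) :
  sum_n_m (fun i => RtoC c * f i)%C n m = (RtoC c * sum_n_m f n m)%C.
Proof. apply (sum_n_m_mult_l (K := C_Ring) (RtoC c) f n m). Qed.

Lemma hullV_mix (L x y : C) (t : R) :
  hullV L x -> hullV L y -> 0 <= t <= 1 -> hullV L (x + RtoC t * (y - x))%C.
Proof.
  intros (k & s & g & Hs & Hs1 & Hg & ->) (k' & s' & g' & Hs' & Hs1' & Hg' & ->) Ht.
  set (sg := fun i => if le_dec i k then (1 - t) * s i else t * s' (i - k)%nat).
  set (gg := fun i => if le_dec i k then g i else g' (i - k)%nat).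
  exists (k + k')%nat, sg, gg.
  assert (Hsplit : forall (G : AbelianMonoid) (u : nat -> G),
    sum_n_m u 1 (k + k') = plus (sum_n_m u 1 k) (sum_n_m (fun i => u (i + k)%nat) 1 k')).
  { intros G0 u. rewrite (sum_n_m_Chasles u 1 k (k + k')) by lia. f_equal.
    clear. induction k' as [|m IH].
    - rewrite !sum_n_m_zero by lia. reflexivity.
    - rewrite sum_n_Sm by lia. rewrite Nat.add_succ_r, sum_n_Sm by lia.
      rewrite IH. f_equal. f_equal. lia. }
  assert (Hl : forall i, (1 <= i <= k)%nat -> sg i = (1 - t) * s i /\ gg i = g i).
  { intros i Hi. unfold sg, gg. destruct (le_dec i k); [easy|lia]. }
  assert (Hr : forall i, (1 <= i <= k')%nat -> sg (i + k)%nat = t * s' i /\ gg (i + k)%nat = g' i).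
  { intros i Hi. unfold sg, gg. destruct (le_dec (i + k) k); [lia|].
    now rewrite Nat.add_sub. }
  repeat split.
  - intros i Hi. unfold sg. destruct (le_dec i k).
    + apply Rmult_le_pos; [lra|apply Hs; lia].
    + apply Rmult_le_pos; [lra|apply Hs'; lia].
  - rewrite (Hsplit R_AbelianMonoid).
    rewrite (sum_n_m_ext_loc _ (fun i => mult (1 - t) (s i)) 1 k) by (intros i Hi; apply (Hl i Hi)).
    rewrite (sum_n_m_ext_loc _ (fun i => mult t (s' i)) 1 k') by (intros i Hi; apply (Hr i Hi)).
    rewrite !(sum_n_m_mult_l (K := R_Ring)).
    change (plus ?a ?b) with (Rplus a b). change (mult ?a ?b) with (Rmult a b).
    assert (t * sum_n_m s' 1 k' <= t * 1) by (apply Rmult_le_compat_l; lra).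
    assert ((1 - t) * sum_n_m s 1 k <= (1 - t) * 1) by (apply Rmult_le_compat_l; lra).
    apply Rle_trans with ((1 - t) * 1 + t * 1); [apply Rplus_le_compat; assumption | lra].
  - intros i Hi. unfold gg. destruct (le_dec i k); [apply Hg|apply Hg']; lia.
  - rewrite (Hsplit C_AbelianMonoid).
    rewrite (sum_n_m_ext_loc (fun i => RtoC (sg i) * gg i 0)%C
      (fun i => RtoC (1 - t) * (RtoC (s i) * g i 0))%C 1 k).
    2:{ intros i Hi. destruct (Hl i Hi) as [-> ->]. cext; ring. }
    rewrite (sum_n_m_ext_loc (fun i => RtoC (sg (i + k)%nat) * gg (i + k)%nat 0)%C
      (fun i => RtoC t * (RtoC (s' i) * g' i 0))%C 1 k').
    2:{ intros i Hi. destruct (Hr i Hi) as [-> ->]. cext; ring. }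
    rewrite !sum_n_m_C_scal. change (plus ?a ?b) with (Cplus a b). rewrite RtoC_minus. ring.
Qed.

Lemma hullV_inv_convex (L : C) : inv_convex L (hullV L).
Proof.
  assert (H1 : forall g, G L g -> hullV L (g 0)).
  { intros g Hg. exists 1%nat, (fun _ => 1), (fun _ => g). repeat split.
    - intros; lra.
    - rewrite sum_n_n. lra.
    - easy.
    - rewrite sum_n_n. cext; ring. }
  split.
  - apply (H1 (fun Z => Z)), G_id.
  - intros x y t. apply hullV_mix.
  - intros z (k & s & g & Hs & Hs1 & Hg & ->).
    (* The empty combination is 0, but [G_E] asks for at least one argument; the image of 0 is
       obtained from the identity with weight 1. *)
    destruct k as [|k].
    + rewrite sum_n_m_zero by lia. change (hullV L (emap L 0)).
      pose proof (G_E L 1 (fun _ => 1) (fun _ Z => Z) (le_n 1)) as HE.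
      refine (eq_ind _ (hullV L) (H1 _ (HE _ _ _)) _ _).
      * intros; lra.
      * rewrite sum_n_n; lra.
      * intros; apply G_id.
      * cbn beta. unfold E, emap. rewrite sum_n_n. f_equal. f_equal. cext; ring.
    + apply (H1 (fun Z => E L (S k) s (fun i => g i Z))). apply G_E; auto; lia.
Qed.

Definition clo (K : C -> Prop) (z : C) : Prop :=
  forall e, 0 < e -> exists w, K w /\ Cmod (w - z) < e.

Lemma clo_incl (K : C -> Prop) (z : C) : K z -> clo K z.
Proof.
  intros H e He. exists z. split; [easy|]. replace (z - z)%C with (RtoC 0) by ring.
  now rewrite Cmod_0.
Qed.

Lemma clo_closed (K : C -> Prop) : closedC (clo K).
Proof.
  intros z H e He. destruct (H (e / 2)) as (w & Hw & Hwz); [lra|].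
  destruct (Hw (e / 2)) as (v & Hv & Hvw); [lra|]. exists v. split; [easy|].
  pose proof (Cmod_triangle3 v w z). lra.
Qed.

Lemma clo_bounded (K : C -> Prop) (M : R) : bounded_by M K -> bounded_by M (clo K).
Proof.
  intros H z Hz. apply le_epsilon. intros e He. destruct (Hz e He) as (w & Hw & Hwz).
  apply H in Hw. pose proof (Cmod_triangle_sub z w). rewrite Cmod_sub_sym in Hwz. lra.
Qed.

Lemma Cmod_Cexp_sub1 (u : C) : Cmod (Cexp u - 1) <= Cmod u * exp (Cmod u).
Proof.
  (* Along [t |-> Cexp (t u)], projected on the direction of the increment. *)
  remember (Cexp u - 1)%C as d eqn:Ed.
  destruct (Req_dec (Cmod d) 0) as [E|E].
  { rewrite E. apply Rmult_le_pos; [apply Cmod_ge_0 | left; apply exp_pos]. }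
  assert (Hd : 0 < Cmod d) by (pose proof (Cmod_ge_0 d); lra).
  set (h := fun t => Re d * (exp (t * Re u) * cos (t * Im u))
                     + Im d * (exp (t * Re u) * sin (t * Im u))).
  set (dh := fun t => exp (t * Re u) * (Re d * (Re u * cos (t * Im u) - Im u * sin (t * Im u))
                     + Im d * (Re u * sin (t * Im u) + Im u * cos (t * Im u)))).
  destruct (MVT_gen h 0 1 dh) as (c & Hc & Hh).
  { intros x _. unfold h, dh. auto_derive; [easy|]. ring. }
  { intros x _. apply continuity_pt_filterlim. apply (ex_derive_continuous h).
    unfold h. auto_derive; easy. }
  rewrite Rmin_left, Rmax_right in Hc by lra.
  assert (E1 : h 1 - h 0 = Cmod d ^ 2).
  { rewrite Cmod_sqr. unfold h. rewrite !Rmult_1_l, !Rmult_0_l, exp_0, cos_0, sin_0.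
    rewrite Ed. autorewrite with cplx. ring. }
  assert (E2 : dh c <= Cmod d * (Cmod u * exp (Cmod u))).
  { assert (Hb : dh c = Re (Cconj d * (u * Cexp (RtoC c * u)))%C).
    { unfold dh. autorewrite with cplx. ring. }
    rewrite Hb. eapply Rle_trans; [apply Rle_abs|]. eapply Rle_trans; [apply re_le_Cmod|].
    rewrite !Cmod_mult, Cmod_conj, Cmod_Cexp.
    apply Rmult_le_compat_l; [apply Cmod_ge_0|]. apply Rmult_le_compat_l; [apply Cmod_ge_0|].
    apply exp_le. autorewrite with cplx.
    pose proof (Rle_trans _ _ _ (Rle_abs _) (re_le_Cmod u)). pose proof (Cmod_ge_0 u). nra. }
  rewrite Rminus_0_r, Rmult_1_r in Hh. nra.
Qed.

Lemma emap_sub (L z w : C) : (emap L z - emap L w)%C = (emap L w * (Cexp (w - z) - 1))%C.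
Proof.
  unfold emap. replace (- z)%C with (- w + (w - z))%C by ring. rewrite Cexp_add. ring.
Qed.

Lemma emap_lipschitz (L z w : C) :
  Cmod (emap L z - emap L w) <= Cmod (emap L w) * (Cmod (z - w) * exp (Cmod (z - w))).
Proof.
  rewrite emap_sub, Cmod_mult. apply Rmult_le_compat_l; [apply Cmod_ge_0|].
  rewrite (Cmod_sub_sym z w). apply Cmod_Cexp_sub1.
Qed.

Lemma emap_continuous (L z : C) (e : R) :
  0 < e -> exists d, 0 < d /\ forall w, Cmod (w - z) < d -> Cmod (emap L w - emap L z) < e.
Proof.
  intros He. set (A := Cmod (emap L z)). assert (HA : 0 <= A) by apply Cmod_ge_0.
  exists (Rmin 1 (e / (A * exp 1 + 1))).
  assert (H1 : 0 < A * exp 1 + 1) by (pose proof (exp_pos 1); nra).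
  split; [apply Rmin_pos; [lra|]; now apply Rdiv_lt_0_compat|].
  intros w Hw. eapply Rle_lt_trans; [apply emap_lipschitz|]. fold A.
  pose proof (Rmin_l 1 (e / (A * exp 1 + 1))). pose proof (Rmin_r 1 (e / (A * exp 1 + 1))).
  set (d := Cmod (w - z)) in *. assert (0 <= d) by apply Cmod_ge_0.
  assert (exp d <= exp 1) by (apply exp_le; lra). pose proof (exp_pos d).
  assert (Hd : d * (A * exp 1 + 1) < e).
  { apply Rlt_le_trans with (e / (A * exp 1 + 1) * (A * exp 1 + 1)).
    - apply Rmult_lt_compat_r; lra.
    - right; field; lra. }
  assert (A * (d * exp d) <= A * (d * exp 1)).
  { apply Rmult_le_compat_l; [easy|]. apply Rmult_le_compat_l; easy. }
  nra.
Qed.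

Lemma clo_inv_convex (L : C) (K : C -> Prop) : inv_convex L K -> inv_convex L (clo K).
Proof.
  intros [H0 Hc Hf]. split.
  - now apply clo_incl.
  - intros x y t Hx Hy Ht e He.
    destruct (Hx e He) as (x' & Hx' & Hxx), (Hy e He) as (y' & Hy' & Hyy).
    exists (x' + RtoC t * (y' - x'))%C. split; [now apply Hc|].
    replace (x' + RtoC t * (y' - x') - (x + RtoC t * (y - x)))%C
      with (RtoC (1 - t) * (x' - x) + RtoC t * (y' - y))%C by (rewrite RtoC_minus; ring).
    eapply Rle_lt_trans; [apply Cmod_triangle|]. rewrite !Cmod_scal, !Rabs_pos_eq by lra.
    destruct (Req_dec t 0); [subst; lra|].
    assert (t * Cmod (y' - y) < t * e) by (apply Rmult_lt_compat_l; lra).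
    assert ((1 - t) * Cmod (x' - x) <= (1 - t) * e) by (apply Rmult_le_compat_l; lra).
    lra.
  - intros z Hz e He. destruct (emap_continuous L z e He) as (d & Hd & Hcont).
    destruct (Hz d Hd) as (w & Hw & Hwz). exists (emap L w). split; [now apply Hf|].
    now apply Hcont.
Qed.

Lemma V_infty_of_inv (L : C) (K : C -> Prop) (M : R) :
  inv_convex L K -> bounded_by M K -> V_infty L.
Proof.
  intros HK HM. exists M. intros w (g & Hg & ->). apply HM. now apply (G_in_inv_convex L).
Qed.

Lemma V_infty_cgen (L : C) : V_infty L -> exists M, bounded_by M (cgen L).
Proof.
  intros [M HM]. exists (Rmax M 0). intros z Hz.
  apply (cgen_least L _ (hullV_inv_convex L)) in Hz.
  destruct Hz as (k & s & g & Hs & Hs1 & Hg & ->).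
  apply (convex_sum (fun z => Cmod z <= Rmax M 0) k s (fun i => g i 0)); auto.
  - intros x y t Hx Hy Ht.
    replace (x + RtoC t * (y - x))%C with (RtoC (1 - t) * x + RtoC t * y)%C
      by (rewrite RtoC_minus; ring).
    eapply Rle_trans; [apply Cmod_triangle|]. rewrite !Cmod_scal, !Rabs_pos_eq by lra. nra.
  - rewrite Cmod_0. apply Rmax_r.
  - intros i Hi. eapply Rle_trans; [|apply Rmax_l]. apply HM. exists (g i). auto.
Qed.

(** Closedness of the invariant set is needed for the limit steps of the continuation arguments. *)
Lemma V_infty_inv (L : C) :
  V_infty L -> exists K M, inv_convex L K /\ closedC K /\ bounded_by M K.
Proof.
  intros H. destruct (V_infty_cgen L H) as [M HM].
  exists (clo (cgen L)), M. split; [|split].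
  - apply clo_inv_convex, cgen_inv_convex.
  - apply clo_closed.
  - now apply clo_bounded.
Qed.

(** * Star-convexity *)

Lemma V_infty_star (L : C) (c : R) : V_infty L -> 0 <= c <= 1 -> V_infty (RtoC c * L).
Proof.
  intros H Hc. destruct (V_infty_inv L H) as (K & M & HK & _ & HM).
  apply (V_infty_of_inv _ K M); [|easy]. destruct HK as [H0 Hcv Hf]. split; auto.
  intros z Hz. rewrite emap_scal. apply convex_scal; auto.
Qed.

(** The closed unit disc is invariant: on it |L e^(-z)| <= e^(-1) e^1. *)
Lemma V_infty_small (L : C) : Cmod L <= exp (-1) -> V_infty L.
Proof.
  intros H. apply (V_infty_of_inv L (fun z => Cmod z <= 1) 1); [|easy]. split.
  - rewrite Cmod_0; lra.
  - intros x y t Hx Hy Ht.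
    replace (x + RtoC t * (y - x))%C with (RtoC (1 - t) * x + RtoC t * y)%C
      by (rewrite RtoC_minus; ring).
    eapply Rle_trans; [apply Cmod_triangle|]. rewrite !Cmod_scal, !Rabs_pos_eq by lra. nra.
  - intros z Hz. rewrite Cmod_emap.
    assert (E1 : exp (-1) * exp 1 = 1)
      by (rewrite <- exp_plus; replace (-1 + 1) with 0 by ring; apply exp_0).
    rewrite <- E1.
    apply Rmult_le_compat; auto; [apply Cmod_ge_0 | left; apply exp_pos|].
    apply exp_le. pose proof (Rle_trans _ _ _ (Rle_abs _) (re_le_Cmod (- z))) as Hr.
    rewrite Cmod_opp, Re_opp in Hr. lra.
Qed.

Lemma U_infty_small (L : C) : Cmod L < exp (-1) -> U_infty L.
Proof.
  intros H. apply locally_Cmod. exists (exp (-1) - Cmod L). split; [lra|].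
  intros w Hw. apply V_infty_small. pose proof (Cmod_triangle_sub w L). lra.
Qed.

Lemma U_infty_star (L : C) (c : R) : U_infty L -> 0 <= c <= 1 -> U_infty (RtoC c * L).
Proof.
  (* Multiplication by 0 is not open, so 0 is treated through the disc of [U_infty_small]. *)
  intros H Hc. destruct (Req_dec c 0) as [->|Hc0].
  { apply U_infty_small. rewrite Cmod_scal, Rabs_R0, Rmult_0_l. apply exp_pos. }
  apply locally_Cmod in H. destruct H as (d & Hd & H). apply locally_Cmod.
  exists (c * d). split; [apply Rmult_lt_0_compat; lra|]. intros w Hw.
  assert (Hc' : RtoC c <> 0) by (intros E; apply RtoC_inj in E; lra).
  replace w with (RtoC c * (w / RtoC c))%C by (field; easy).
  apply V_infty_star; [|easy]. apply H.
  replace (w / RtoC c - L)%C with (RtoC (/ c) * (w - RtoC c * L))%C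
    by (rewrite RtoC_inv by easy; field; easy).
  rewrite Cmod_scal, Rabs_pos_eq by (left; apply Rinv_0_lt_compat; lra).
  apply Rmult_lt_reg_l with c; [lra|]. rewrite <- Rmult_assoc, Rinv_r, Rmult_1_l by easy. easy.
Qed.

(** * Real-variable tools *)

Lemma derive_nonneg_le (f df : R -> R) (a b : R) :
  a <= b -> (forall x, a <= x <= b -> is_derive f x (df x)) ->
  (forall x, a <= x <= b -> 0 <= df x) -> f a <= f b.
Proof.
  intros Hab Hd Hp. destruct (MVT_gen f a b df) as (c & Hc & Hf).
  - intros x Hx. rewrite Rmin_left, Rmax_right in Hx by easy. apply Hd. lra.
  - intros x Hx. rewrite Rmin_left, Rmax_right in Hx by easy.
    apply continuity_pt_filterlim, (ex_derive_continuous f). exists (df x). now apply Hd.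
  - rewrite Rmin_left, Rmax_right in Hc by easy. specialize (Hp c Hc). nra.
Qed.

(** Connectedness of an interval, in the form used by every continuation below: the supremum of the
    initial segments on which S holds satisfies S by the closedness hypothesis, and the openness
    hypothesis would push beyond it if it were less than b. *)
Lemma real_induction (S : R -> Prop) (a b : R) :
  a <= b -> S a ->
  (forall x, a <= x <= b ->
     (forall e, 0 < e -> exists y, a <= y <= b /\ S y /\ Rabs (y - x) < e) -> S x) ->
  (forall x, a <= x < b -> S x -> exists d, 0 < d /\ forall y, x <= y <= x + d -> y <= b -> S y) ->
  S b.
Proof.
  intros Hab Ha Hcl Hop.
  set (T := fun x => a <= x <= b /\ forall y, a <= y <= x -> S y).
  destruct (completeness T) as [m [Hub Hlub]].
  - exists b. intros x [Hx _]. lra.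
  - exists a. split; [lra|]. intros y Hy. now replace y with a by lra.
  - assert (Hm : a <= m <= b).
    { split; [|apply Hlub; intros x [Hx _]; lra].
      apply Hub. split; [lra|]. intros y Hy. now replace y with a by lra. }
    assert (Hbelow : forall e, 0 < e -> exists x, T x /\ m - e < x).
    { intros e He. destruct (Classical_Prop.classic (exists x, T x /\ m - e < x)) as [H|H]; [easy|].
      assert (m <= m - e); [|lra]. apply Hlub. intros x Hx.
      destruct (Rle_lt_dec x (m - e)); [easy|]. exfalso. apply H. eauto. }
    assert (HS : forall y, a <= y < m -> S y).
    { intros y Hy. destruct (Hbelow (m - y)) as (x & [Hx Hx'] & Hl); [lra|]. apply Hx'. lra. }
    assert (HSm : S m).
    { apply Hcl; [easy|]. intros e He. destruct (Hbelow e He) as (x & Hx & Hl).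
      assert (x <= m) by now apply Hub. destruct Hx as [Hx Hx'].
      exists x. split; [lra|]. split; [apply Hx'; lra|]. apply Rabs_def1; lra. }
    destruct (Rle_lt_dec b m) as [Hbm|Hbm]; [now replace b with m by lra|].
    destruct (Hop m ltac:(lra) HSm) as (d & Hd & Hd').
    assert (Hmin : m < Rmin b (m + d)) by (apply Rmin_glb_lt; lra).
    pose proof (Rmin_l b (m + d)). pose proof (Rmin_r b (m + d)).
    assert (Rmin b (m + d) <= m); [|lra]. apply Hub. split; [lra|].
    intros y Hy. destruct (Rlt_le_dec y m); [apply HS; lra | apply Hd'; lra].
Qed.

Lemma continuity_pt_eps (f : R -> R) (x e : R) :
  continuity_pt f x -> 0 < e -> exists d, 0 < d /\ forall y, Rabs (y - x) < d -> Rabs (f y - f x) < e.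
Proof.
  intros Hf He. pose proof (proj1 (continuity_pt_locally f x) Hf) as Hl. destruct (Hl (mkposreal e He)) as [d Hd].
  exists d. split; [apply cond_pos|]. exact Hd.
Qed.

Lemma curve_eps (u v : R -> R) (x e : R) :
  continuity_pt u x -> continuity_pt v x -> 0 < e ->
  exists d, 0 < d /\ forall y, Rabs (y - x) < d -> Cmod ((u y, v y) - (u x, v x))%C < e.
Proof.
  intros Hu Hv He.
  destruct (continuity_pt_eps u x (e / 2) Hu) as (d1 & Hd1 & H1); [lra|].
  destruct (continuity_pt_eps v x (e / 2) Hv) as (d2 & Hd2 & H2); [lra|].
  exists (Rmin d1 d2). split; [now apply Rmin_pos|]. intros y Hy.
  eapply Rle_lt_trans; [apply Cmod_le_abs|]. autorewrite with cplx.
  pose proof (Rmin_l d1 d2). pose proof (Rmin_r d1 d2).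
  specialize (H1 y ltac:(lra)). specialize (H2 y ltac:(lra)). lra.
Qed.

Lemma cont_pos (f : R -> R) (x : R) :
  continuity_pt f x -> 0 < f x -> exists d, 0 < d /\ forall y, Rabs (y - x) <= d -> 0 < f y.
Proof.
  intros Hf Hx. destruct (continuity_pt_eps f x (f x) Hf Hx) as (d & Hd & H).
  exists (d / 2). split; [lra|]. intros y Hy. specialize (H y ltac:(lra)).
  apply Rabs_def2 in H. lra.
Qed.

Lemma ex_derive_continuity_pt (f : R -> R) (x : R) : ex_derive f x -> continuity_pt f x.
Proof. intros H. apply continuity_pt_filterlim. now apply (ex_derive_continuous f). Qed.

Ltac cont_auto := apply ex_derive_continuity_pt; auto_derive.

Definition cot (x : R) : R := cos x / sin x.

Lemma x_cos_le_sin (b : R) : 0 <= b <= PI -> b * cos b <= sin b.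
Proof.
  intros Hb. assert (H : sin 0 - 0 * cos 0 <= sin b - b * cos b); [|rewrite sin_0 in H; lra].
  apply (derive_nonneg_le (fun x => sin x - x * cos x) (fun x => x * sin x)).
  - lra.
  - intros x Hx. auto_derive; [easy|]. ring.
  - intros x Hx. apply Rmult_le_pos; [lra|]. apply sin_ge_0; lra.
Qed.

Lemma cot_le_inv (b : R) : 0 < b < PI -> cot b <= / b.
Proof.
  intros Hb. unfold cot. pose proof (sin_gt_0 b ltac:(lra) ltac:(lra)).
  pose proof (x_cos_le_sin b ltac:(lra)).
  apply Rmult_le_reg_r with (sin b * b); [nra|]. field_simplify; nra.
Qed.

(** This is 2 x <= log ((1 + x) / (1 - x)), free of the singularity at 1. It will be applied to x =
    t / b. *)
Lemma exp_mobius (x : R) : 0 <= x <= 1 -> (1 - x) * exp (2 * x) <= 1 + x.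
Proof.
  intros Hx.
  assert (H : (1 + 0) * exp (- 0) - (1 - 0) * exp 0 <= (1 + x) * exp (- x) - (1 - x) * exp x).
  { apply (derive_nonneg_le (fun x => (1 + x) * exp (- x) - (1 - x) * exp x)
             (fun x => x * (exp x - exp (- x)))).
    - lra.
    - intros y Hy. auto_derive; [easy|]. ring.
    - intros y Hy. apply Rmult_le_pos; [lra|].
      assert (exp (- y) <= exp y) by (apply exp_le; lra). lra. }
  rewrite Ropp_0, exp_0 in H.
  replace (2 * x) with (x + x) by ring. rewrite exp_plus.
  assert (E : exp (- x) * exp x = 1) by (rewrite <- exp_plus, Rplus_opp_l; apply exp_0).
  pose proof (exp_pos x). 
  replace (1 + x) with ((1 + x) * exp (- x) * exp x) by (rewrite Rmult_assoc, E; ring).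
  rewrite <- Rmult_assoc. apply Rmult_le_compat_r; lra.
Qed.

(** * Unboundedness outside the curve *)

Definition polar (r t : R) : C := (r * cos t, r * sin t).

Lemma Re_polar (r t : R) : Re (polar r t) = r * cos t. Proof. reflexivity. Qed.
Lemma Im_polar (r t : R) : Im (polar r t) = r * sin t. Proof. reflexivity. Qed.

Global Hint Rewrite Re_polar Im_polar : cplx.

Lemma Cmod_polar_eq (r t : R) : 0 <= r -> Cmod (polar r t) = r.
Proof.
  intros Hr. apply Cmod_eq_sqr; [easy|]. autorewrite with cplx.
  pose proof (sin2_cos2 t) as H. unfold Rsqr in H.
  transitivity (r ^ 2 * (sin t * sin t + cos t * cos t)); [ring|]. rewrite H; ring.
Qed.

Lemma polar_Cexp (r t : R) : polar r t = (RtoC r * Cexp (Ci * RtoC t))%C.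
Proof. cext. rewrite exp_0; ring. rewrite exp_0; ring. Qed.

Lemma scal_polar (c r t : R) : (RtoC c * polar r t)%C = polar (c * r) t.
Proof. cext; ring. Qed.

Lemma emap_polar (r t : R) (z : C) : emap (polar r t) z = polar (r * exp (- Re z)) (t - Im z).
Proof.
  unfold emap. cext; unfold Rminus; rewrite ?cos_plus, ?sin_plus, cos_neg, sin_neg; ring.
Qed.

(** For a parameter of argument t and modulus r, the image of [lower_point t b] lies on the ray of
    argument b; the inequality [radius t b] < r means that the imaginary part of this image exceeds
    b + t. *)
Definition radius (t b : R) : R := (b + t) / sin b * exp ((b - t) * cot b).

(** The left side is the threshold for the way back, from the ray of argument b to that of argument
    -b. That it is the smaller one amounts to (b - t) e^(2 t cot b) <= b + t, which follows from cot
    b <= 1 / b and [exp_mobius]. *)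
Lemma radius_dual_le (t b : R) :
  0 < t -> t <= b < PI -> (b - t) / sin b * exp ((b + t) * cot b) <= radius t b.
Proof.
  intros Ht Hb. unfold radius. pose proof (sin_gt_0 b ltac:(lra) ltac:(lra)) as Hs.
  assert (H : (b - t) * exp (2 * t * cot b) <= b + t).
  { pose proof (exp_mobius (t / b)) as He.
    assert (Htb : 0 <= t / b <= 1).
    { split; [apply Rmult_le_pos; [lra|]; left; apply Rinv_0_lt_compat; lra|].
      apply Rmult_le_reg_r with b; [lra|]. field_simplify; lra. }
    specialize (He Htb).
    apply Rle_trans with (b * ((1 - t / b) * exp (2 * (t / b)))).
    - replace (b * ((1 - t / b) * exp (2 * (t / b)))) with ((b - t) * exp (2 * (t / b)))
        by (field; lra).
      apply Rmult_le_compat_l; [lra|]. apply exp_le.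
      pose proof (cot_le_inv b ltac:(lra)). unfold Rdiv. nra.
    - replace (b + t) with (b * (1 + t / b)) by (field; lra).
      apply Rmult_le_compat_l; lra. }
  replace ((b + t) * cot b) with (2 * t * cot b + (b - t) * cot b) by ring.
  rewrite exp_plus. unfold Rdiv.
  replace ((b - t) * / sin b * (exp (2 * t * cot b) * exp ((b - t) * cot b)))
    with ((b - t) * exp (2 * t * cot b) * (/ sin b * exp ((b - t) * cot b))) by ring.
  rewrite (Rmult_assoc (b + t)).
  apply Rmult_le_compat_r; [|easy].
  apply Rmult_le_pos; [left; now apply Rinv_0_lt_compat | left; apply exp_pos].
Qed.

(* The point on the ray of argument [- b] with imaginary part [t - b]: its
   image has argument [b]. *)
Definition lower_point (t b : R) : C := polar ((b - t) / sin b) (- b).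

(** Two applications of the map lead from the ray of argument -b to the ray of argument b and on to
    that of argument -c. The inequalities are strict at b, so for c slightly above b both images
    overshoot the required points, and scaling towards 0 brings them back. *)
Lemma lower_point_step (t r b : R) (K : C -> Prop) :
  inv_convex (polar r t) K -> 0 < t -> t <= b < PI -> radius t b < r ->
  K (lower_point t b) ->
  exists d, 0 < d /\ forall c, b <= c <= b + d -> K (lower_point t c).
Proof.
  intros HK Ht Hb Hr HKb.
  pose proof (sin_gt_0 b ltac:(lra) ltac:(lra)) as Hs.
  pose proof (radius_dual_le t b Ht Hb) as Hr'.
  set (R1 := r * exp (- ((b - t) * cot b))).
  assert (HR1 : (b + t) / sin b < R1).
  { unfold R1. apply Rmult_lt_reg_r with (exp ((b - t) * cot b)); [apply exp_pos|].
    rewrite Rmult_assoc, <- exp_plus, Rplus_opp_l, exp_0, Rmult_1_r. exact Hr. }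
  destruct (cont_pos (fun c => R1 - (c + t) / sin b) b) as (d1 & Hd1 & H1).
  { cont_auto. lra. }
  { lra. }
  destruct (cont_pos (fun c => r * exp (- ((c + t) * cot b)) - (c - t) / sin c) b) as (d2 & Hd2 & H2).
  { cont_auto. lra. }
  { assert ((b - t) / sin b < r * exp (- ((b + t) * cot b))); [|lra].
    apply Rmult_lt_reg_r with (exp ((b + t) * cot b)); [apply exp_pos|].
    rewrite (Rmult_assoc r), <- exp_plus, Rplus_opp_l, exp_0, Rmult_1_r. lra. }
  assert (Hd3 : 0 < (PI - b) / 2) by lra.
  exists (Rmin (Rmin d1 d2) ((PI - b) / 2)). split; [repeat apply Rmin_pos; easy|].
  intros c Hc. pose proof (Rmin_l (Rmin d1 d2) ((PI - b) / 2)).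
  pose proof (Rmin_r (Rmin d1 d2) ((PI - b) / 2)).
  pose proof (Rmin_l d1 d2). pose proof (Rmin_r d1 d2).
  assert (Habs : Rabs (c - b) = c - b) by (apply Rabs_pos_eq; lra).
  specialize (H1 c ltac:(lra)). specialize (H2 c ltac:(lra)). cbv beta in H1, H2.
  pose proof (sin_gt_0 c ltac:(lra) ltac:(lra)) as Hsc.
  (* The point of the ray of argument b with imaginary part c + t: its image has argument -c. *)
  assert (Hup : K (polar ((c + t) / sin b) b)).
  { assert (Hf : K (polar R1 b)).
    { apply (ic_emap _ _ HK) in HKb. unfold lower_point in HKb. rewrite emap_polar in HKb.
      autorewrite with cplx in HKb. rewrite cos_neg, sin_neg in HKb.
      replace (t - (b - t) / sin b * - sin b) with b in HKb by (field; lra).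
      replace (- ((b - t) / sin b * cos b)) with (- ((b - t) * cot b)) in HKb
        by (unfold cot; field; lra).
      exact HKb. }
    assert (HR : 0 < R1).
    { eapply Rlt_trans; [|exact HR1]. apply Rdiv_lt_0_compat; lra. }
    replace (polar ((c + t) / sin b) b) with (RtoC ((c + t) / sin b / R1) * polar R1 b)%C
      by (rewrite scal_polar; f_equal; field; lra).
    apply convex_scal; try apply HK; [easy|]. split.
    - apply Rmult_le_pos; [|left; now apply Rinv_0_lt_compat].
      apply Rmult_le_pos; [lra|left; now apply Rinv_0_lt_compat].
    - apply Rmult_le_reg_r with R1; [easy|]. unfold Rdiv at 1.
      rewrite Rmult_assoc, Rinv_l, Rmult_1_r, Rmult_1_l by lra. lra. }
  apply (ic_emap _ _ HK) in Hup. rewrite emap_polar in Hup. autorewrite with cplx in Hup.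
  replace (t - (c + t) / sin b * sin b) with (- c) in Hup by (field; lra).
  replace (- ((c + t) / sin b * cos b)) with (- ((c + t) * cot b)) in Hup
    by (unfold cot; field; lra).
  set (R2 := r * exp (- ((c + t) * cot b))) in *.
  assert (Hnn : 0 <= (c - t) / sin c) by (apply Rmult_le_pos; [lra|left; now apply Rinv_0_lt_compat]).
  unfold lower_point.
  replace (polar ((c - t) / sin c) (- c)) with (RtoC ((c - t) / sin c / R2) * polar R2 (- c))%C
    by (rewrite scal_polar; f_equal; field; lra).
  apply convex_scal; try apply HK; [easy|]. split.
  - apply Rmult_le_pos; [easy|left; apply Rinv_0_lt_compat; lra].
  - apply Rmult_le_reg_r with R2; [lra|]. unfold Rdiv at 1.
    rewrite Rmult_assoc, Rinv_l, Rmult_1_r, Rmult_1_l by lra. lra.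
Qed.

(** The modulus (b - t) / sin b of [lower_point t b] tends to infinity as b tends to PI. *)
Lemma not_V_infty_of_radius (t r : R) :
  0 < t < PI -> (forall b, t <= b < PI -> radius t b < r) -> ~ V_infty (polar r t).
Proof.
  intros Ht Hr HV. destruct (V_infty_inv _ HV) as (K & M & HK & Hcl & HM).
  assert (HM0 : 0 <= M).
  { pose proof (HM _ (ic_0 _ _ HK)) as H. now rewrite Cmod_0 in H. }
  (* At b1 = PI - e one has sin b1 <= e, so the bound M on [K] would give b1 - t <= M e < (PI - t) /
     2 <= b1 - t. *)
  set (e := (PI - t) / (2 * (M + 1))).
  assert (He : 0 < e) by (apply Rdiv_lt_0_compat; lra).
  assert (He2 : e <= (PI - t) / 2).
  { unfold e. apply Rmult_le_compat_l; [lra|]. apply Rinv_le_contravar; lra. }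
  assert (HeM : e * (M + 1) = (PI - t) / 2) by (unfold e; field; lra).
  set (b1 := PI - e).
  assert (HKb : K (lower_point t b1)).
  { apply (real_induction (fun b => K (lower_point t b)) t b1).
    - unfold b1; lra.
    - unfold lower_point. replace (polar _ _) with (RtoC 0); [apply HK|].
      pose proof (sin_gt_0 t ltac:(lra) ltac:(lra)). cext; field; lra.
    - intros x Hx Hlim. apply Hcl. intros d Hd.
      pose proof (sin_gt_0 x ltac:(lra) ltac:(unfold b1 in Hx; lra)).
      destruct (curve_eps (fun b => (b - t) / sin b * cos (- b))
        (fun b => (b - t) / sin b * sin (- b)) x d) as (d' & Hd' & Hc); [| |easy|].
      + cont_auto. lra.
      + cont_auto. lra.
      + destruct (Hlim d' Hd') as (y & _ & Hy & Hyx). exists (lower_point t y).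
        split; [easy|]. now apply Hc.
    - intros x Hx HKx.
      destruct (lower_point_step t r x K) as (d & Hd & Hstep); try easy; unfold b1 in *; try lra.
      + apply Hr; lra.
      + exists d. split; [easy|]. intros y Hy _. now apply Hstep. }
  apply HM in HKb.
  assert (Hsin : 0 < sin b1 <= e).
  { unfold b1. replace (sin (PI - e)) with (sin e) by (rewrite sin_PI_x; easy). split.
    - apply sin_gt_0; unfold b1 in *; lra.
    - left; now apply sin_lt_x. }
  unfold lower_point in HKb. rewrite Cmod_polar_eq in HKb.
  2:{ apply Rmult_le_pos; [unfold b1; lra|left; now apply Rinv_0_lt_compat]. }
  assert (Hge : b1 - t <= M * sin b1).
  { apply Rmult_le_compat_r with (r := sin b1) in HKb; [|lra].
    replace ((b1 - t) / sin b1 * sin b1) with (b1 - t) in HKb by (field; lra). easy. }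
  assert (M * sin b1 <= M * e) by (apply Rmult_le_compat_l; lra).
  assert (b1 - t >= (PI - t) / 2) by (unfold b1; lra). nra.
Qed.

Lemma gamma_bounds (t : R) : 0 < t < PI -> t < gamma t < PI.
Proof.
  intros Ht. destruct (gamma_spec t Ht) as [Hg He].
  assert (Hlt : gamma t < PI).
  { destruct (Rlt_le_dec (gamma t) PI) as [H|H]; [easy|].
    destruct H as [H|H].
    - pose proof (gamma_eq_lt PI (gamma t) ltac:(lra) H) as H1. rewrite sin_PI in H1. nra.
    - rewrite <- H, sin_PI in He. nra. }
  split; [|easy]. pose proof (sin_gt_0 _ Hg Hlt). nra.
Qed.

(** Here the equation for [gamma] appears: it is the critical point equation of [radius t], and by
    the monotonicity of b^2 - sin^2 b the critical point is the maximum on [t, PI). *)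
Lemma radius_derive (t b : R) : 0 < b < PI ->
  is_derive (radius t) b
    (exp ((b - t) * cot b) / sin b ^ 3 * (t ^ 2 - (b ^ 2 - sin b ^ 2))).
Proof.
  intros Hb. pose proof (sin_gt_0 b ltac:(lra) ltac:(lra)).
  unfold radius, cot. auto_derive; [lra|].
  change (b + - t) with (b - t).
  assert (E1 : t ^ 2 - (b ^ 2 - sin b ^ 2) = (t ^ 2 - b ^ 2) * (cos b ^ 2 + sin b ^ 2) + sin b ^ 2).
  { pose proof (sin2_cos2 b) as E1. unfold Rsqr in E1.
    replace (cos b ^ 2 + sin b ^ 2) with 1 by lra. ring. }
  rewrite E1. unfold Rdiv. field. lra.
Qed.

Lemma radius_le_gamma (t b : R) : 0 < t < PI -> t <= b < PI -> radius t b <= radius t (gamma t).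
Proof.
  intros Ht Hb. pose proof (gamma_bounds t Ht) as Hg. destruct (gamma_spec t Ht) as [Hg0 He].
  assert (Hpos : forall x, 0 < x < PI -> 0 < exp ((x - t) * cot x) / sin x ^ 3).
  { intros x Hx. apply Rdiv_lt_0_compat; [apply exp_pos|]. apply pow_lt, sin_gt_0; lra. }
  destruct (Rle_lt_dec b (gamma t)) as [Hbg|Hbg].
  - apply (derive_nonneg_le _ _ b (gamma t) Hbg (fun x Hx => radius_derive t x ltac:(lra))).
    intros x Hx. apply Rmult_le_pos; [left; apply Hpos; lra|].
    destruct (proj2 Hx) as [H|H]; [|subst; lra].
    pose proof (gamma_eq_lt x (gamma t) ltac:(lra) H). lra.
  - apply Ropp_le_cancel.
    apply (derive_nonneg_le (fun x => - radius t x)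
      (fun b => - (exp ((b - t) * cot b) / sin b ^ 3 * (t ^ 2 - (b ^ 2 - sin b ^ 2))))
      (gamma t) b); [lra| |].
    + intros x Hx. apply (is_derive_opp (radius t)), radius_derive. lra.
    + intros x Hx. rewrite Ropp_mult_distr_r. apply Rmult_le_pos; [left; apply Hpos; lra|].
      destruct (proj1 Hx) as [H|H]; [|subst; lra].
      pose proof (gamma_eq_lt (gamma t) x ltac:(lra) H). lra.
Qed.

Lemma not_V_infty_outside (t r : R) :
  0 < t < PI -> radius t (gamma t) < r -> ~ V_infty (polar r t).
Proof.
  intros Ht Hr. apply not_V_infty_of_radius; [easy|]. intros b Hb.
  eapply Rle_lt_trans; [|exact Hr]. now apply radius_le_gamma.
Qed.

Lemma Lambda_hat_polar (t : R) : 0 < t -> Lambda_hat t = polar (radius t (gamma t)) t.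
Proof.
  intros Ht. unfold Lambda_hat. destruct (Req_EM_T t 0); [lra|]. now rewrite polar_Cexp.
Qed.

(** * Taylor bounds for sine and cosine *)

Lemma cos_ge_2 (x : R) : 0 <= x -> 1 - x ^ 2 / 2 <= cos x.
Proof.
  intros Hx. assert (H : cos 0 + 0 ^ 2 / 2 <= cos x + x ^ 2 / 2); [|rewrite cos_0 in H; lra].
  apply (derive_nonneg_le (fun x => cos x + x ^ 2 / 2) (fun x => x - sin x)); [easy| |].
  - intros y Hy. auto_derive; [easy|]. field.
  - intros y Hy. destruct (proj1 Hy) as [H|H]; [pose proof (sin_lt_x y H); lra|].
    subst; rewrite sin_0; lra.
Qed.

Lemma sin_ge_3 (x : R) : 0 <= x -> x - x ^ 3 / 6 <= sin x.
Proof.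
  intros Hx. assert (H : sin 0 - 0 + 0 ^ 3 / 6 <= sin x - x + x ^ 3 / 6); [|rewrite sin_0 in H; lra].
  apply (derive_nonneg_le (fun x => sin x - x + x ^ 3 / 6) (fun x => cos x - 1 + x ^ 2 / 2)); [easy| |].
  - intros y Hy. auto_derive; [easy|]. field.
  - intros y Hy. pose proof (cos_ge_2 y (proj1 Hy)). lra.
Qed.

Lemma cos_le_4 (x : R) : 0 <= x -> cos x <= 1 - x ^ 2 / 2 + x ^ 4 / 24.
Proof.
  intros Hx. assert (H : 1 - 0 ^ 2 / 2 + 0 ^ 4 / 24 - cos 0 <= 1 - x ^ 2 / 2 + x ^ 4 / 24 - cos x);
    [|rewrite cos_0 in H; lra].
  apply (derive_nonneg_le (fun x => 1 - x ^ 2 / 2 + x ^ 4 / 24 - cos x)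
    (fun x => sin x - x + x ^ 3 / 6)); [easy| |].
  - intros y Hy. auto_derive; [easy|]. field.
  - intros y Hy. pose proof (sin_ge_3 y (proj1 Hy)). lra.
Qed.

Lemma sin_le_5 (x : R) : 0 <= x -> sin x <= x - x ^ 3 / 6 + x ^ 5 / 120.
Proof.
  intros Hx. assert (H : 0 - 0 ^ 3 / 6 + 0 ^ 5 / 120 - sin 0 <= x - x ^ 3 / 6 + x ^ 5 / 120 - sin x);
    [|rewrite sin_0 in H; lra].
  apply (derive_nonneg_le (fun x => x - x ^ 3 / 6 + x ^ 5 / 120 - sin x)
    (fun x => 1 - x ^ 2 / 2 + x ^ 4 / 24 - cos x)); [easy| |].
  - intros y Hy. auto_derive; [easy|]. field.
  - intros y Hy. pose proof (cos_le_4 y (proj1 Hy)). lra.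
Qed.

(** To leading order g^2 - sin^2 g is g^4 / 3, so t is close to g^2 / sqrt 3, that is 0.577 g^2; the
    constants 1/2 and 6/10 bracket this value. *)
Lemma angle_bounds (g : R) (t : R) :
  0 < g <= 1 / 5 -> 0 <= t -> g ^ 2 - sin g ^ 2 = t ^ 2 -> g ^ 2 / 2 <= t <= 6 / 10 * g ^ 2.
Proof.
  intros Hg Ht He. pose proof (sin_ge_3 g ltac:(lra)) as H1. pose proof (sin_le_5 g ltac:(lra)) as H2.
  assert (Hs : 0 <= g - g ^ 3 / 6) by nra.
  assert (H3 : (g - g ^ 3 / 6) ^ 2 <= sin g ^ 2) by (apply pow_incr; lra).
  assert (H4 : sin g ^ 2 <= (g - g ^ 3 / 6 + g ^ 5 / 120) ^ 2) by (apply pow_incr; lra).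
  assert (Hg2 : 0 < g ^ 2 <= 1 / 25) by nra.
  set (q := g ^ 2) in *.
  replace (g - g ^ 3 / 6) with (g * (1 - q / 6)) in H3 by (unfold q; field).
  replace (g - g ^ 3 / 6 + g ^ 5 / 120) with (g * (1 - q / 6 + q ^ 2 / 120)) in H4 by (unfold q; field).
  rewrite Rpow_mult_distr in H3, H4. fold q in H3, H4.
  split.
  - assert (H : (q / 2) ^ 2 <= t ^ 2).
    { rewrite <- He. assert (0 <= q * (q * (1/3 - 1/4 - q * (1 / 36 + 1 / 60) + q ^ 2 / 360 - q ^ 3 / 14400))); [|lra].
      repeat apply Rmult_le_pos; try lra. nra. }
    destruct (Rle_lt_dec (q / 2) t); [easy|nra].
  - assert (H : t ^ 2 <= (6 / 10 * q) ^ 2).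
    { rewrite <- He. nra. }
    destruct (Rle_lt_dec t (6 / 10 * q)); [easy|nra].
Qed.

(** * Boundedness inside the curve *)

Lemma sin_exp_derive (x w : R) : is_derive (fun w => sin w * exp (- (w * x))) w
   (exp (- (w * x)) * (cos w - x * sin w)).
Proof. auto_derive; [easy|]. ring. Qed.

(** The derivative in w of e^(-w cot a) sin w is e^(-w cot a) sin (a - w) / sin a, so the function
    increases up to w = a and decreases from there to PI. *)
Lemma sin_exp_incr (a x y : R) : 0 < a < PI -> 0 <= x <= y -> y <= a ->
  sin x * exp (- (x * cot a)) <= sin y * exp (- (y * cot a)).
Proof.
  intros Ha Hxy Hya. pose proof (sin_gt_0 a ltac:(lra) ltac:(lra)).
  apply (derive_nonneg_le _ _ x y (proj2 Hxy) (fun w _ => sin_exp_derive (cot a) w)).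
  intros w Hw. apply Rmult_le_pos; [left; apply exp_pos|].
  replace (cos w - cot a * sin w) with (sin (a - w) / sin a)
    by (unfold cot; rewrite sin_minus; field; lra).
  apply Rmult_le_pos; [apply sin_ge_0; lra | left; now apply Rinv_0_lt_compat].
Qed.

Lemma sin_exp_max (a w : R) : 0 < a < PI -> 0 <= w <= PI ->
  sin w * exp (- (w * cot a)) <= sin a * exp (- (a * cot a)).
Proof.
  intros Ha Hw. destruct (Rle_lt_dec w a) as [H|H]; [apply sin_exp_incr; lra|].
  pose proof (sin_gt_0 a ltac:(lra) ltac:(lra)).
  apply Ropp_le_cancel.
  apply (derive_nonneg_le (fun w => - (sin w * exp (- (w * cot a))))
    (fun w => - (exp (- (w * cot a)) * (cos w - cot a * sin w))) a w); [lra| |].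
  - intros x _. apply (is_derive_opp (fun w => sin w * exp (- (w * cot a)))), sin_exp_derive.
  - intros x Hx. rewrite Ropp_mult_distr_r. apply Rmult_le_pos; [left; apply exp_pos|].
    replace (- (cos x - cot a * sin x)) with (sin (x - a) / sin a)
      by (unfold cot; rewrite sin_minus; field; lra).
    apply Rmult_le_pos; [apply sin_ge_0; lra | left; now apply Rinv_0_lt_compat].
Qed.

(* The invariant set is cut out by two lines through [0] and two horizontal
   lines: the lines bound the argument, and the strip bounds the imaginary
   part, which the map exchanges. *)
Lemma V_infty_polygon (t r a b : R) :
  0 < t -> t <= b <= a -> a <= PI / 2 -> 0 < r ->
  r * exp (- ((b - t) * cot b)) * sin b <= b + t ->
  r * exp (- ((b + t) * cot a)) * sin b <= a - t ->
  V_infty (polar r t).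
Proof.
  intros Ht Hb Ha Hr Hup Hlow. pose proof PI_RGT_0.
  assert (Hsa : 0 < sin a) by (apply sin_gt_0; lra).
  assert (Hsb : 0 < sin b) by (apply sin_gt_0; lra).
  assert (Hca : 0 <= cot a).
  { apply Rmult_le_pos; [apply cos_ge_0; lra | left; now apply Rinv_0_lt_compat]. }
  assert (Hcb : 0 <= cot b).
  { apply Rmult_le_pos; [apply cos_ge_0; lra | left; now apply Rinv_0_lt_compat]. }
  set (K := fun z : C => (t - a <= Im z <= b + t) /\ Im z * cot a <= Re z /\
                         - Im z * cot b <= Re z /\ Re z <= r).
  apply (V_infty_of_inv _ K (r + (a + b + t))).
  - split.
    + unfold K; simpl. repeat split; lra.
    + intros x y s (Hx1 & Hx2 & Hx3 & Hx4) (Hy1 & Hy2 & Hy3 & Hy4) Hs. unfold K.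
      autorewrite with cplx. repeat split; nra.
    + intros z (H1 & H2 & H3 & H4). rewrite emap_polar.
      set (w := t - Im z). set (x := Re z) in *. set (y := Im z) in *.
      assert (Hw : - b <= w <= a) by (unfold w; lra).
      assert (Hx : 0 <= x).
      { destruct (Rle_lt_dec 0 y); [assert (0 <= y * cot a) by (apply Rmult_le_pos; lra); lra|].
        assert (0 <= - y * cot b) by (apply Rmult_le_pos; lra). lra. }
      assert (HR : 0 < r * exp (- x) <= r).
      { split; [apply Rmult_lt_0_compat; [easy|apply exp_pos]|].
        rewrite <- (Rmult_1_r r) at 2. apply Rmult_le_compat_l; [lra|].
        rewrite <- exp_0. apply exp_le; lra. }
      set (R1 := r * exp (- x)) in *. unfold K. autorewrite with cplx.
      assert (Hcw : R1 * cos w <= r).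
      { pose proof (COS_bound w). nra. }
      assert (Ha1 : R1 * sin w * cot a <= R1 * cos w).
      { rewrite Rmult_assoc. apply Rmult_le_compat_l; [lra|].
        apply Rmult_le_reg_r with (sin a); [easy|].
        replace (sin w * cot a * sin a) with (sin w * cos a) by (unfold cot; field; lra).
        assert (0 <= sin (a - w)) by (apply sin_ge_0; lra). rewrite sin_minus in *. lra. }
      assert (Hb1 : - (R1 * sin w) * cot b <= R1 * cos w).
      { replace (- (R1 * sin w) * cot b) with (R1 * (- sin w * cot b)) by ring.
        apply Rmult_le_compat_l; [lra|].
        apply Rmult_le_reg_r with (sin b); [easy|].
        replace (- sin w * cot b * sin b) with (- sin w * cos b) by (unfold cot; field; lra).
        assert (0 <= sin (b + w)) by (apply sin_ge_0; lra). rewrite sin_plus in *. lra. }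
      split; [split|repeat split; easy].
      (* For w < 0 the line Im z cot a <= Re z bounds the image by r e^(-t cot a) times sin (-w)
         e^(w cot a), which for -b <= w is largest at w = -b. For w > 0 the other line is used in
         the same way, with the maximum at w = b. *)
      * destruct (Rle_lt_dec 0 w) as [Hw0|Hw0].
        { assert (0 <= R1 * sin w) by (apply Rmult_le_pos; [lra|apply sin_ge_0; lra]). lra. }
        assert (Hmax : sin (- w) * exp (- (- w * cot a)) <= sin b * exp (- (b * cot a))).
        { apply sin_exp_incr; lra. }
        assert (Hexp : exp (- x) <= exp (- (t * cot a)) * exp (- (- w * cot a))).
        { rewrite <- exp_plus. apply exp_le. unfold w. lra. }
        assert (Hs : 0 <= sin (- w)) by (apply sin_ge_0; lra).
        assert (Hall : R1 * sin (- w) <= r * exp (- ((b + t) * cot a)) * sin b).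
        { unfold R1. replace (- ((b + t) * cot a)) with (- (t * cot a) + - (b * cot a)) by ring.
          rewrite exp_plus, !(Rmult_assoc r). apply Rmult_le_compat_l; [lra|].
          apply Rle_trans with (exp (- (t * cot a)) * exp (- (- w * cot a)) * sin (- w)).
          - now apply Rmult_le_compat_r.
          - rewrite !Rmult_assoc. apply Rmult_le_compat_l; [left; apply exp_pos|]. lra. }
        rewrite sin_neg in Hall. lra.
      * destruct (Rle_lt_dec w 0) as [Hw0|Hw0].
        { assert (0 <= R1 * sin (- w)) by (apply Rmult_le_pos; [lra|apply sin_ge_0; lra]).
          rewrite sin_neg in *. lra. }
        assert (Hmax : sin w * exp (- (w * cot b)) <= sin b * exp (- (b * cot b))).
        { apply sin_exp_max; lra. }
        assert (Hexp : exp (- x) <= exp (t * cot b) * exp (- (w * cot b))).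
        { rewrite <- exp_plus. apply exp_le. unfold w. lra. }
        assert (Hs : 0 <= sin w) by (apply sin_ge_0; lra).
        assert (Hall : R1 * sin w <= r * exp (- ((b - t) * cot b)) * sin b).
        { unfold R1. replace (- ((b - t) * cot b)) with (t * cot b + - (b * cot b)) by ring.
          rewrite exp_plus, !(Rmult_assoc r). apply Rmult_le_compat_l; [lra|].
          apply Rle_trans with (exp (t * cot b) * exp (- (w * cot b)) * sin w).
          - now apply Rmult_le_compat_r.
          - rewrite !Rmult_assoc. apply Rmult_le_compat_l; [left; apply exp_pos|]. lra. }
        lra.
  - intros z (H1 & H2 & H3 & H4). eapply Rle_trans; [apply Cmod_le_abs|].
    assert (0 <= Re z).
    { destruct (Rle_lt_dec 0 (Im z)); [assert (0 <= Im z * cot a) by (apply Rmult_le_pos; lra); lra|].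
      assert (0 <= - Im z * cot b) by (apply Rmult_le_pos; lra). lra. }
    apply Rplus_le_compat; [rewrite Rabs_pos_eq; lra|]. apply Rabs_le; lra.
Qed.

Lemma V_infty_inside (t r : R) :
  0 < t < PI -> gamma t <= 1 / 5 -> 0 < r <= radius t (gamma t) -> V_infty (polar r t).
Proof.
  intros Ht Hg5 Hr. pose proof (gamma_bounds t Ht) as Hg. destruct (gamma_spec t Ht) as [Hg0 He].
  set (g := gamma t) in *.
  pose proof (angle_bounds g t ltac:(lra) ltac:(lra) He) as Hb.
  pose proof PI2_3_2 as Hpi.
  assert (Hsg : 0 < sin g) by (apply sin_gt_0; lra).
  assert (Hrad : r * exp (- ((g - t) * cot g)) * sin g <= g + t).
  { unfold radius in Hr. destruct Hr as [_ Hr].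
    apply Rmult_le_compat_r with (r := exp (- ((g - t) * cot g)) * sin g) in Hr.
    2:{ apply Rmult_le_pos; [left; apply exp_pos | lra]. }
    replace ((g + t) / sin g * exp ((g - t) * cot g) * (exp (- ((g - t) * cot g)) * sin g))
      with ((g + t) * exp ((g - t) * cot g + - ((g - t) * cot g))) in Hr
      by (rewrite exp_plus; field; lra).
    rewrite Rplus_opp_r, exp_0 in Hr. lra. }
  assert (Hg2 : g ^ 2 <= 1 / 25) by nra.
  (* With a = g + 2 t the right sides a - t and b + t of the two conditions coincide, and the second
     condition follows from the first and (g - t) cot g <= (g + t) cot (g + 2 t). *)
  apply (V_infty_polygon t r (g + 2 * t) g); try lra.
  replace (g + 2 * t - t) with (g + t) by ring.
  eapply Rle_trans; [|exact Hrad]. apply Rmult_le_compat_r; [lra|].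
  apply Rmult_le_compat_l; [lra|]. apply exp_le, Ropp_le_contravar.
  assert (Hsa : 0 < sin (g + 2 * t)) by (apply sin_gt_0; nra).
  apply Rmult_le_reg_r with (sin g * sin (g + 2 * t)); [now apply Rmult_lt_0_compat|].
  replace ((g - t) * cot g * (sin g * sin (g + 2 * t)))
    with ((g - t) * (cos g * sin (g + 2 * t))) by (unfold cot; field; lra).
  replace ((g + t) * cot (g + 2 * t) * (sin g * sin (g + 2 * t)))
    with ((g + t) * (cos (g + 2 * t) * sin g)) by (unfold cot; field; lra).
  (* The difference is [t sin (2 g + 2 t) - g sin (2 t)]. *)
  assert (E1 : sin (2 * t) = sin (g + 2 * t) * cos g - cos (g + 2 * t) * sin g).
  { rewrite <- sin_minus. f_equal. ring. }
  assert (E2 : sin (2 * g + 2 * t) = sin (g + 2 * t) * cos g + cos (g + 2 * t) * sin g).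
  { rewrite <- sin_plus. f_equal. ring. }
  assert (H1 : sin (2 * t) < 2 * t) by (apply sin_lt_x; lra).
  assert (H2 : 2 * g <= sin (2 * g + 2 * t)).
  { pose proof (sin_ge_3 (2 * g + 2 * t) ltac:(lra)) as H3.
    assert (Hgt : (g + t) ^ 3 <= (112 / 100 * g) ^ 3) by (apply pow_incr; nra).
    assert (g ^ 3 <= g ^ 2 / 5) by nra. nra. }
  assert (H3 : g * sin (2 * t) <= t * sin (2 * g + 2 * t)).
  { apply Rle_trans with (g * (2 * t)); [apply Rmult_le_compat_l; lra|]. nra. }
  nra.
Qed.

Lemma V_infty_real_pos (x : R) : 0 <= x -> V_infty (RtoC x).
Proof.
  intros Hx. apply (V_infty_of_inv _ (fun z => 0 <= Re z <= x /\ Im z = 0) x).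
  - split.
    + simpl. lra.
    + intros a b s [Ha Ha'] [Hb Hb'] Hs. autorewrite with cplx. rewrite Ha', Hb'. split; nra.
    + intros z [Hz Hz']. unfold emap. autorewrite with cplx. rewrite Hz', Ropp_0, cos_0, sin_0.
      pose proof (exp_pos (- Re z)).
      assert (exp (- Re z) <= 1) by (rewrite <- exp_0; apply exp_le; lra). split; nra.
  - intros z [Hz Hz']. apply Cmod_le_sqr; [lra|]. rewrite Hz'. nra.
Qed.

Lemma conj_emap (L z : C) : emap (Cconj L) (Cconj z) = Cconj (emap L z).
Proof. unfold emap. cext; rewrite cos_neg, ?sin_neg; ring. Qed.

Lemma V_infty_conj (L : C) : V_infty L -> V_infty (Cconj L).
Proof.
  intros H. destruct (V_infty_inv L H) as (K & M & [H0 Hc Hf] & _ & HM).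
  apply (V_infty_of_inv _ (fun z => K (Cconj z)) M).
  - split.
    + replace (Cconj 0) with (RtoC 0) by (cext; ring). easy.
    + intros x y t Hx Hy Ht.
      replace (Cconj (x + RtoC t * (y - x))) with (Cconj x + RtoC t * (Cconj y - Cconj x))%C
        by (cext; ring). now apply Hc.
    + intros z Hz. rewrite <- conj_emap, Cconj_conj. now apply Hf.
  - intros z Hz. rewrite <- Cmod_conj. now apply HM.
Qed.

(** * Uniform bounds off the real axis *)

Lemma polar_upper (L : C) : 0 < Im L -> exists t, 0 < t < PI /\ L = polar (Cmod L) t.
Proof.
  intros HI. pose proof (Cmod_sqr L) as Hsq.
  assert (Hm : 0 < Cmod L) by (pose proof (im_le_Cmod L); pose proof (Rle_abs (Im L)); lra).
  set (c := Re L / Cmod L). assert (Hc : Re L = Cmod L * c) by (unfold c; field; lra).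
  assert (Hc1 : c * c < 1) by nra.
  assert (Hc2 : -1 < c < 1) by nra.
  exists (acos c). split.
  - destruct (acos_bound c) as [H1 H2]. split.
    + destruct H1 as [H1|H1]; [easy|]. pose proof (cos_acos c ltac:(lra)) as H.
      rewrite <- H1, cos_0 in H. lra.
    + destruct H2 as [H2|H2]; [easy|]. pose proof (cos_acos c ltac:(lra)) as H.
      rewrite H2, cos_PI in H. lra.
  - cext; rewrite ?cos_acos, ?sin_acos by lra; [easy|].
    assert (Hs : 0 <= 1 - Rsqr c) by (unfold Rsqr; lra).
    pose proof (sqrt_pos (1 - Rsqr c)). pose proof (sqrt_sqrt _ Hs) as Hss. unfold Rsqr in *.
    set (s := sqrt (1 - c * c)) in *.
    assert (H2 : Im L ^ 2 = (Cmod L * s) ^ 2) by nra.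
    assert (0 <= Cmod L * s) by nra. nra.
Qed.

Lemma cos_period_Z (x : R) (k : Z) : cos (x + 2 * IZR k * PI) = cos x.
Proof.
  destruct k as [|p|p].
  - f_equal. ring.
  - rewrite <- (positive_nat_Z p), <- INR_IZR_INZ. apply cos_period.
  - rewrite <- (cos_period (x + 2 * IZR (Z.neg p) * PI) (Pos.to_nat p)).
    f_equal. rewrite INR_IZR_INZ, positive_nat_Z.
    replace (IZR (Z.neg p)) with (- IZR (Z.pos p)) by now rewrite <- opp_IZR. ring.
Qed.

Lemma cos_minus1_between (t a : R) : exists y, a <= y <= a + 2 * PI /\ cos (t - y) = -1.
Proof.
  pose proof PI_RGT_0. set (q := (a - t - PI) / (2 * PI)).
  destruct (archimed q) as [H1 H2].
  exists (t + PI + 2 * PI * IZR (up q)).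
  assert (Hq : a = t + PI + 2 * PI * q) by (unfold q; field; lra).
  split.
  - rewrite Hq at 1 2. nra.
  - rewrite <- cos_neg, <- cos_PI, <- (cos_period_Z PI (up q)). f_equal. ring.
Qed.

(** A segment whose imaginary parts span 2 PI contains a point that is mapped to the negative real
    axis; real parts at most X make the modulus of its image at least r e^(-X). *)
Lemma full_turn (t r X : R) (K : C -> Prop) (x0 x1 : C) :
  inv_convex (polar r t) K -> 0 <= r -> K x0 -> K x1 ->
  2 * PI <= Rabs (Im x1 - Im x0) -> Re x0 <= X -> Re x1 <= X ->
  exists w, K w /\ Re w <= - (r * exp (- X)).
Proof.
  intros HK Hr. revert x0 x1.
  assert (Hwlog : forall x0 x1, K x0 -> K x1 -> 2 * PI <= Im x1 - Im x0 ->
    Re x0 <= X -> Re x1 <= X -> exists w, K w /\ Re w <= - (r * exp (- X))).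
  { intros x0 x1 H0 H1 HI HX0 HX1. pose proof PI_RGT_0.
    destruct (cos_minus1_between t (Im x0)) as (y & Hy & Hcos).
    set (s := (y - Im x0) / (Im x1 - Im x0)).
    assert (Hys : y = Im x0 + s * (Im x1 - Im x0)) by (unfold s; field; lra).
    assert (Hs : 0 <= s <= 1).
    { split; [apply Rmult_le_pos; [lra | left; apply Rinv_0_lt_compat; lra]|].
      apply Rmult_le_reg_r with (Im x1 - Im x0); [lra|]. lra. }
    set (z := (x0 + RtoC s * (x1 - x0))%C).
    assert (Hz : K z) by now apply HK.
    exists (emap (polar r t) z). split; [now apply HK|].
    rewrite emap_polar. autorewrite with cplx.
    replace (Im z) with y by (unfold z; autorewrite with cplx; lra). rewrite Hcos.
    assert (Re z <= X).
    { unfold z. autorewrite with cplx.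
      replace (Re x0 + s * (Re x1 - Re x0)) with ((1 - s) * Re x0 + s * Re x1) by ring. nra. }
    assert (exp (- X) <= exp (- Re z)) by (apply exp_le; lra). nra. }
  intros x0 x1 H0 H1 HI HX0 HX1. unfold Rabs in HI. destruct (Rcase_abs (Im x1 - Im x0)).
  - apply (Hwlog x1 x0); auto. lra.
  - apply (Hwlog x0 x1); auto.
Qed.

Lemma exp_dominates (k A B : R) : 0 < k -> 0 < A ->
  exists a0, forall x, a0 <= x -> 0 <= x /\ B + x <= A * exp (k * x).
Proof.
  intros Hk HA. set (c := 4 * (1 + Rabs B) / (A * k ^ 2)).
  assert (Hk2 : 0 < A * k ^ 2) by (apply Rmult_lt_0_compat; [easy|now apply pow_lt]).
  exists (Rmax 1 c). intros x Hx. pose proof (Rmax_l 1 c). pose proof (Rmax_r 1 c).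
  split; [lra|].
  assert (Hc : 1 + Rabs B <= A * k ^ 2 * x / 4).
  { apply Rle_trans with (A * k ^ 2 * c / 4).
    - right. unfold c. field. split; lra.
    - nra. }
  replace (k * x) with (k * x / 2 + k * x / 2) by field. rewrite exp_plus.
  assert (Hkx : 0 < k * x / 2) by nra.
  pose proof (exp_ineq1 (k * x / 2) ltac:(lra)) as He.
  assert (Hsq : (k * x / 2) * (k * x / 2) <= exp (k * x / 2) * exp (k * x / 2)) by nra.
  pose proof (Rle_abs B). pose proof (Rabs_pos B).
  apply Rle_trans with (A * ((k * x / 2) * (k * x / 2))); [|apply Rmult_le_compat_l; lra].
  replace (A * (k * x / 2 * (k * x / 2))) with (A * k ^ 2 * x / 4 * x) by field. nra.
Qed.

(* A point far to the left, its images of two nearby directions, and one more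
   convex combination produce a full turn far to the left, hence a point still
   further to the left. *)
Lemma inv_convex_re_bound (R0 eta : R) : 0 < R0 -> 0 < eta ->
  exists a0, forall L K M, Cmod L <= R0 -> eta <= Im L -> inv_convex L K -> bounded_by M K ->
    forall z, K z -> - a0 <= Re z.
Proof.
  intros HR Heta. pose proof PI_RGT_0 as Hpi.
  set (s0 := Rmin (1 / 2) (/ R0)).
  assert (Hs0 : 0 < s0) by (apply Rmin_pos; [lra|now apply Rinv_0_lt_compat]).
  pose proof (Rmin_l (1 / 2) (/ R0)) as Hs1. pose proof (Rmin_r (1 / 2) (/ R0)) as Hs2.
  fold s0 in Hs1, Hs2.
  set (c' := eta * s0 / 4). assert (Hc' : 0 < c') by (unfold c'; nra).
  destruct (exp_dominates (1 / 2) eta 1) as [a1 Ha1]; [lra|easy|].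
  destruct (exp_dominates (1 / 2) (eta * exp (-1)) 0) as [a2 Ha2]; [lra|pose proof (exp_pos (-1)); nra|].
  destruct (exp_dominates (1 / 2) (c' * (eta * exp (-1))) (8 * PI)) as [a3 Ha3];
    [lra|apply Rmult_lt_0_compat; [easy|]; apply Rmult_lt_0_compat; [easy|apply exp_pos]|].
  destruct (exp_dominates 1 (eta * exp (- (8 * PI / c'))) 1) as [a4 Ha4];
    [lra|apply Rmult_lt_0_compat; [easy|apply exp_pos]|].
  set (a0 := Rmax (Rmax a1 a2) (Rmax a3 a4)). exists a0.
  assert (Ha0 : a1 <= a0 /\ a2 <= a0 /\ a3 <= a0 /\ a4 <= a0).
  { unfold a0. pose proof (Rmax_l (Rmax a1 a2) (Rmax a3 a4)).
    pose proof (Rmax_r (Rmax a1 a2) (Rmax a3 a4)). pose proof (Rmax_l a1 a2).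
    pose proof (Rmax_r a1 a2). pose proof (Rmax_l a3 a4). pose proof (Rmax_r a3 a4). lra. }
  clearbody a0. intros L K M HLR HLe HK HM z Hz.
  destruct (Rle_lt_dec (- a0) (Re z)) as [H|Hlt]; [easy|exfalso].
  destruct (polar_upper L) as (t & Ht & HL); [lra|]. set (r := Cmod L) in *.
  assert (Hr : eta <= r) by (pose proof (im_le_Cmod L); pose proof (Rle_abs (Im L)); unfold r; lra).
  (* S is the supremum of -Re on [K], and w0 is taken within 1 of it. A full turn at real parts at
     most X, with r e^(-X) >= a + 1, then produces a point beyond the supremum. *)
  destruct (completeness (fun x => exists w, K w /\ x = - Re w)) as [S [Hub Hlub]].
  { exists M. intros x (w & Hw & ->). apply HM in Hw. pose proof (re_le_Cmod w).
    pose proof (Rle_abs (- Re w)) as H0. rewrite Rabs_Ropp in H0. lra. }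
  { exists (- Re z). now exists z. }
  assert (HS : forall w, K w -> - Re w <= S) by (intros w Hw; apply Hub; now exists w).
  assert (Hw0 : exists w0, K w0 /\ a0 < - Re w0 /\ S < - Re w0 + 1).
  { destruct (Classical_Prop.classic (exists w0, K w0 /\ a0 < - Re w0 /\ S < - Re w0 + 1)) as [H|H];
      [easy|exfalso].
    assert (S <= Rmax a0 (S - 1)).
    { apply Hlub. intros x (w & Hw & ->).
      destruct (Rle_lt_dec (- Re w) (Rmax a0 (S - 1))) as [Hx|Hx]; [easy|exfalso].
      apply H. exists w. pose proof (Rmax_l a0 (S - 1)). pose proof (Rmax_r a0 (S - 1)).
      repeat split; [easy|lra|lra]. }
    pose proof (HS z Hz). unfold Rmax in *. destruct (Rle_dec a0 (S - 1)); lra. }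
  destruct Hw0 as (w0 & Hw0 & Ha & HSa). set (a := - Re w0) in *. set (b := Im w0).
  destruct (Ha1 a ltac:(lra)) as [Hapos H1]. destruct (Ha2 a ltac:(lra)) as [_ H2].
  destruct (Ha3 a ltac:(lra)) as [_ H3]. destruct (Ha4 a ltac:(lra)) as [_ H4].
  assert (HK0 := HK). destruct HK0 as [K0 Kc Kf].
  rewrite HL in HK.
  assert (Hend : forall X, X <= - a / 2 \/ X <= - a + 8 * PI / c' ->
            forall w, K w -> - (r * exp (- X)) < Re w).
  { intros X HX w Hw. pose proof (HS w Hw).
    assert (a + 1 <= r * exp (- X)); [|lra].
    apply Rle_trans with (eta * exp (- X)).
    2:{ apply Rmult_le_compat_r; [left; apply exp_pos|easy]. }
    destruct HX as [HX|HX].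
    - assert (exp (1 / 2 * a) <= exp (- X)) by (apply exp_le; lra). nra.
    - assert (E : exp (- (8 * PI / c')) * exp (1 * a) <= exp (- X))
        by (rewrite <- exp_plus; apply exp_le; lra). nra. }
  (* If |Im w0| >= 4 PI, the segment from w0 to w0 / 2 already makes a full turn. *)
  destruct (Rle_lt_dec (4 * PI) (Rabs b)) as [Hb|Hb].
  { assert (Hh : K (RtoC (1 / 2) * w0)%C) by (apply convex_scal; auto; lra).
    destruct (full_turn t r (- a / 2) K w0 (RtoC (1 / 2) * w0)) as (w & Hw & HRe); auto; try lra.
    - autorewrite with cplx. fold b. replace (1 / 2 * b - b) with (- (b / 2)) by field.
      rewrite Rabs_Ropp. unfold Rdiv. rewrite Rabs_mult, (Rabs_pos_eq (/ 2)) by lra. lra.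
    - unfold a in *. lra.
    - autorewrite with cplx. unfold a. lra.
    - pose proof (Hend (- a / 2) (or_introl (Rle_refl _)) w Hw). lra. }
  assert (HKL : K L).
  { replace L with (emap L 0); [now apply Kf|]. unfold emap.
    replace (- 0)%C with (RtoC 0) by ring. rewrite Cexp_0. ring. }
  assert (HsL : s0 * r <= 1).
  { apply Rle_trans with (/ R0 * R0); [|right; field; lra].
    apply Rmult_le_compat; [lra | apply Cmod_ge_0 | easy | exact HLR]. }
  (* The points x1 = w0 / 2 and x2 = x1 + s0 L, the latter being the midpoint of w0 and 2 s0 L, have
     images whose arguments differ by s0 Im L in (0, 1]. So at least one image w1 stays away from
     the real axis: |Im w1| >= c' |w1|. *)
  assert (Hw1 : exists w1, K w1 /\ eta * exp (-1) * exp (1 / 2 * a) <= Cmod w1 /\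
                 c' * Cmod w1 <= Rabs (Im w1)).
  { set (x1 := (RtoC (1 / 2) * w0)%C). set (x2 := (x1 + RtoC s0 * L)%C).
    assert (Hx1 : K x1) by (apply convex_scal; auto; lra).
    assert (Hx2 : K x2).
    { replace x2 with (RtoC (1 / 2) * w0 + RtoC (1 / 2) * (RtoC (2 * s0) * L - RtoC (1/2) * w0)
         + RtoC (1 / 4) * w0)%C.
      2:{ unfold x2, x1. cext; field. }
      replace (RtoC (1 / 2) * w0 + RtoC (1 / 2) * (RtoC (2 * s0) * L - RtoC (1/2) * w0)
         + RtoC (1 / 4) * w0)%C with (w0 + RtoC (1 / 2) * (RtoC (2 * s0) * L - w0))%C
        by (cext; field).
      apply Kc; [easy| |lra]. apply convex_scal; auto. lra. }
    assert (E1 : emap L x1 = polar (r * exp (- Re x1)) (t - Im x1)) by (rewrite HL at 1; apply emap_polar).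
    assert (E2 : emap L x2 = polar (r * exp (- Re x2)) (t - Im x2)) by (rewrite HL at 1; apply emap_polar).
    assert (Hm1 : forall X, - Re X >= a / 2 - 1 -> eta * exp (-1) * exp (1 / 2 * a) <= r * exp (- Re X)).
    { intros X HX. rewrite Rmult_assoc, <- exp_plus.
      apply Rmult_le_compat; [lra|left; apply exp_pos|easy|]. apply exp_le. lra. }
    assert (HR1 : - Re x1 >= a / 2 - 1) by (unfold x1; autorewrite with cplx; unfold a; lra).
    assert (HR2 : - Re x2 >= a / 2 - 1).
    { unfold x2, x1. autorewrite with cplx. unfold a.
      pose proof (re_le_Cmod L) as Hq. pose proof (Rle_abs (Re L)). fold r in Hq. nra. }
    set (c := s0 * Im L).
    assert (Hc : 4 * c' <= c <= 1).
    { unfold c, c'. pose proof (im_le_Cmod L) as Hq. pose proof (Rle_abs (Im L)). fold r in Hq. split; nra. }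
    assert (Hsin : 2 * c' <= sin c).
    { pose proof (sin_ge_3 c ltac:(lra)). assert (c ^ 3 <= c) by nra. lra. }
    assert (Hsum : sin c <= Rabs (sin (t - Im x1)) + Rabs (sin (t - Im x2))).
    { replace c with ((t - Im x1) - (t - Im x2)) at 1 by (unfold c, x2; autorewrite with cplx; ring).
      rewrite sin_minus. eapply Rle_trans; [apply Rle_abs|]. unfold Rminus at 1.
      eapply Rle_trans; [apply Rabs_triang|]. rewrite Rabs_Ropp, !Rabs_mult.
      assert (Hcb : forall u, Rabs (cos u) <= 1) by (intros; apply Rabs_le, COS_bound).
      pose proof (Hcb (t - Im x1)). pose proof (Hcb (t - Im x2)).
      pose proof (Rabs_pos (sin (t - Im x1))). pose proof (Rabs_pos (sin (t - Im x2))). nra. }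
    assert (Hfin : forall X, K X -> - Re X >= a / 2 - 1 ->
       emap L X = polar (r * exp (- Re X)) (t - Im X) -> c' <= Rabs (sin (t - Im X)) ->
       exists w1, K w1 /\ eta * exp (-1) * exp (1 / 2 * a) <= Cmod w1 /\ c' * Cmod w1 <= Rabs (Im w1)).
    { intros X HX HRX EX HsX. assert (Hp : 0 <= r * exp (- Re X)).
      { apply Rmult_le_pos; [lra|left; apply exp_pos]. }
      exists (emap L X). split; [now apply Kf|]. rewrite EX, Cmod_polar_eq by easy.
      split; [now apply Hm1|]. autorewrite with cplx.
      rewrite Rabs_mult, (Rabs_pos_eq (r * exp (- Re X))) by easy. nra. }
    destruct (Rle_lt_dec c' (Rabs (sin (t - Im x1)))) as [Hx|Hx].
    - apply (Hfin x1); auto.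
    - apply (Hfin x2); auto. lra. }
  destruct Hw1 as (w1 & Hw1 & Hm & Him).
  set (m := Cmod w1) in *.
  assert (Hma : a <= m) by lra.
  assert (Hm8 : 8 * PI <= c' * m).
  { apply Rle_trans with (c' * (eta * exp (-1)) * exp (1 / 2 * a)); [lra|].
    rewrite Rmult_assoc. apply Rmult_le_compat_l; lra. }
  set (D := Rabs (Im w1 - b)).
  assert (HD : c' * m / 2 <= D).
  { unfold D. pose proof (Rabs_triang_inv (Im w1) b). lra. }
  (* The fraction of the segment from w0 to w1 along which the imaginary part moves by exactly 2 PI.
     As D >= c' |w1| / 2, the real part moves by at most 8 PI / c' meanwhile. *)
  set (T := 2 * PI / D).
  assert (HT : 0 <= T <= 1).
  { unfold T. split; [apply Rmult_le_pos; [lra|left; apply Rinv_0_lt_compat; lra]|].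
    apply Rmult_le_reg_r with D; [lra|]. field_simplify; lra. }
  set (x1 := (w0 + RtoC T * (w1 - w0))%C).
  assert (Hx1 : K x1) by now apply Kc.
  assert (HTm : T * m <= 4 * PI / c').
  { apply Rle_trans with (T * (2 * D / c')).
    - apply Rmult_le_compat_l; [lra|]. apply Rmult_le_reg_r with c'; [easy|]. field_simplify; lra.
    - right. unfold T. field. split; lra. }
  destruct (full_turn t r (- a + 8 * PI / c') K w0 x1) as (w & Hw & HRe); auto; try lra.
  - unfold x1. autorewrite with cplx. fold b.
    replace (b + T * (Im w1 - b) - b) with (T * (Im w1 - b)) by ring.
    rewrite Rabs_mult, (Rabs_pos_eq T) by lra. fold D. right. unfold T. field. lra.
  - assert (0 < 8 * PI / c') by (apply Rdiv_lt_0_compat; lra). unfold a. lra.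
  - unfold x1. autorewrite with cplx. replace (Re w0) with (- a) by (unfold a; ring).
    pose proof (re_le_Cmod w1) as Hq. pose proof (Rle_abs (Re w1)). fold m in Hq.
    assert (T * (Re w1 - - a) <= T * (2 * m)) by (apply Rmult_le_compat_l; lra).
    unfold Rdiv in *. nra.
  - pose proof (Hend (- a + 8 * PI / c') (or_intror (Rle_refl _)) w Hw). lra.
Qed.

(** Since |L e^(-z)| = |L| e^(-Re z), a lower bound on real parts bounds every image, and convex
    combinations keep the bound. *)
Lemma cgen_bounded_uniform (R0 eta : R) : 0 < R0 -> 0 < eta ->
  exists M, forall L, Cmod L <= R0 -> eta <= Im L -> V_infty L -> bounded_by M (cgen L).
Proof.
  intros HR Heta. destruct (inv_convex_re_bound R0 eta HR Heta) as [a0 Ha0].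
  exists (R0 * exp a0). intros L HL1 HL2 HV.
  destruct (V_infty_cgen L HV) as [M HM].
  pose proof (Ha0 L (cgen L) M HL1 HL2 (cgen_inv_convex L) HM) as HRe.
  assert (H0 : 0 <= R0 * exp a0) by (apply Rmult_le_pos; [lra|left; apply exp_pos]).
  intros z Hz. induction Hz as [|z Hz IH|x y t Hx IHx Hy IHy Ht].
  - now rewrite Cmod_0.
  - rewrite Cmod_emap. apply Rmult_le_compat; [apply Cmod_ge_0|left; apply exp_pos|easy|].
    apply exp_le. specialize (HRe z Hz). lra.
  - replace (x + RtoC t * (y - x))%C with (RtoC (1 - t) * x + RtoC t * y)%C
      by (rewrite RtoC_minus; ring).
    eapply Rle_trans; [apply Cmod_triangle|]. rewrite !Cmod_scal, !Rabs_pos_eq by lra. nra.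
Qed.

(** Lower semicontinuity of [cgen] in the parameter: a point is produced by finitely many
    operations, each of them continuous in L. *)
Lemma cgen_continuous (L0 z : C) : cgen L0 z -> forall e, 0 < e ->
  exists d, 0 < d /\ forall L, Cmod (L - L0) < d -> exists w, cgen L w /\ Cmod (w - z) < e.
Proof.
  induction 1 as [|z Hz IH|x y t Hx IHx Hy IHy Ht]; intros e He.
  - exists 1. split; [lra|]. intros L _. exists 0. split; [apply cgen_0|].
    replace (0 - 0)%C with (RtoC 0) by ring. now rewrite Cmod_0.
  - destruct (emap_continuous L0 z (e / 2)) as (d1 & Hd1 & H1); [lra|].
    destruct (IH (Rmin 1 d1)) as (d2 & Hd2 & H2); [apply Rmin_pos; lra|].
    set (B := exp (1 - Re z)). assert (HB : 0 < B) by apply exp_pos.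
    exists (Rmin d2 (e / 2 / B)). split; [apply Rmin_pos; [easy|]; apply Rdiv_lt_0_compat; lra|].
    intros L HL. pose proof (Rmin_l d2 (e / 2 / B)). pose proof (Rmin_r d2 (e / 2 / B)).
    destruct (H2 L) as (w & Hw & Hwz); [lra|]. exists (emap L w). split; [now constructor|].
    pose proof (Rmin_l 1 d1). pose proof (Rmin_r 1 d1).
    eapply Rle_lt_trans; [apply (Cmod_triangle3 _ (emap L0 w))|].
    specialize (H1 w ltac:(lra)).
    replace (emap L w - emap L0 w)%C with ((L - L0) * Cexp (- w))%C by (unfold emap; ring).
    rewrite Cmod_mult, Cmod_Cexp.
    assert (exp (Re (- w)) <= B).
    { apply exp_le. rewrite Re_opp. pose proof (re_le_Cmod (w - z)) as Hre.
      rewrite Re_sub in Hre. pose proof (Rle_abs (- (Re w - Re z))) as Ha.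
      rewrite Rabs_Ropp in Ha. lra. }
    assert (Cmod (L - L0) * exp (Re (- w)) <= e / 2 / B * B).
    { apply Rmult_le_compat; [apply Cmod_ge_0|left; apply exp_pos|lra|easy]. }
    replace (e / 2 / B * B) with (e / 2) in * by (field; lra). lra.
  - destruct (IHx e He) as (d1 & Hd1 & H1). destruct (IHy e He) as (d2 & Hd2 & H2).
    exists (Rmin d1 d2). split; [now apply Rmin_pos|]. intros L HL.
    pose proof (Rmin_l d1 d2). pose proof (Rmin_r d1 d2).
    destruct (H1 L) as (x' & Hx' & Hxx); [lra|]. destruct (H2 L) as (y' & Hy' & Hyy); [lra|].
    exists (x' + RtoC t * (y' - x'))%C. split; [now constructor|].
    replace (x' + RtoC t * (y' - x') - (x + RtoC t * (y - x)))%C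
      with (RtoC (1 - t) * (x' - x) + RtoC t * (y' - y))%C by (rewrite RtoC_minus; ring).
    eapply Rle_lt_trans; [apply Cmod_triangle|]. rewrite !Cmod_scal, !Rabs_pos_eq by lra.
    destruct (Req_dec t 0); [subst; lra|].
    assert (t * Cmod (y' - y) < t * e) by (apply Rmult_lt_compat_l; lra).
    assert ((1 - t) * Cmod (x' - x) <= (1 - t) * e) by (apply Rmult_le_compat_l; lra).
    lra.
Qed.

(** If parameters in [V_infty] accumulated at L0, their common bound would pass to [cgen L0] by
    lower semicontinuity. *)
Lemma not_V_infty_open (L0 : C) : 0 < Im L0 -> ~ V_infty L0 ->
  exists d, 0 < d /\ forall L, Cmod (L - L0) < d -> ~ V_infty L.
Proof.
  intros HI HV.
  destruct (Classical_Prop.classic (exists d, 0 < d /\ forall L, Cmod (L - L0) < d -> ~ V_infty L))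
    as [H|H]; [easy|exfalso]. apply HV.
  assert (Hd : forall d, 0 < d -> exists L, Cmod (L - L0) < d /\ V_infty L).
  { intros d Hd. destruct (Classical_Prop.classic (exists L, Cmod (L - L0) < d /\ V_infty L)) as [E|E];
      [easy|exfalso]. apply H. exists d. split; [easy|]. intros L HL HVL. apply E. eauto. }
  destruct (cgen_bounded_uniform (Cmod L0 + Im L0) (Im L0 / 2)) as [M HM]; [|lra|].
  { pose proof (Cmod_ge_0 L0). lra. }
  apply (V_infty_of_inv L0 (cgen L0) M); [apply cgen_inv_convex|].
  intros z Hz. apply le_epsilon. intros e He.
  destruct (cgen_continuous L0 z Hz e He) as (d & Hd0 & Hc).
  destruct (Hd (Rmin d (Im L0 / 2))) as (L & HL & HVL); [apply Rmin_pos; lra|].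
  pose proof (Rmin_l d (Im L0 / 2)). pose proof (Rmin_r d (Im L0 / 2)).
  destruct (Hc L) as (w & Hw & Hwz); [lra|].
  assert (Cmod w <= M).
  { apply (HM L); auto.
    - pose proof (Cmod_triangle_sub L L0). lra.
    - pose proof (im_le_Cmod (L - L0)) as Hi. rewrite Im_sub in Hi.
      pose proof (Rle_abs (- (Im L - Im L0))) as Ha. rewrite Rabs_Ropp in Ha. lra. }
  pose proof (Cmod_triangle_sub z w). rewrite Cmod_sub_sym in Hwz. lra.
Qed.

(** * The indifferent fixed point belongs to every invariant set *)

Lemma sin_sub_lt (x y : R) : x < y -> x + sin x < y + sin y.
Proof.
  intros H. assert (Hs : Rabs (sin x - sin y) < y - x).
  { rewrite form4, !Rabs_mult, (Rabs_pos_eq 2) by lra.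
    assert (Rabs (cos ((x + y) / 2)) <= 1) by (apply Rabs_le, COS_bound).
    assert (Rabs (sin ((x - y) / 2)) < (y - x) / 2).
    { replace ((x - y) / 2) with (- ((y - x) / 2)) by field. rewrite sin_neg, Rabs_Ropp.
      destruct (Rle_lt_dec ((y - x) / 2) PI) as [Hp|Hp].
      - rewrite Rabs_pos_eq by (apply sin_ge_0; lra). apply sin_lt_x; lra.
      - assert (Rabs (sin ((y - x) / 2)) <= 1) by (apply Rabs_le, SIN_bound). pose proof PI2_1. lra. }
    pose proof (Rabs_pos (cos ((x + y) / 2))). pose proof (Rabs_pos (sin ((x - y) / 2))). nra. }
  apply Rabs_def2 in Hs. lra.
Qed.

(** For p = e^(i phi), the parameter p e^p with fixed point p has modulus e^(cos phi) and this
    argument. *)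
Definition bdry_angle (phi : R) : R := phi + sin phi.

Lemma bdry_angle_bounds (phi : R) : 0 < phi < PI -> phi < bdry_angle phi < PI.
Proof.
  intros H. unfold bdry_angle. pose proof (sin_gt_0 phi ltac:(lra) ltac:(lra)).
  pose proof (sin_sub_lt phi PI ltac:(lra)) as H1. rewrite sin_PI in H1. lra.
Qed.

(* The fixed point [p] of [emap (c L)] for the multiples [c L] of the boundary
   parameter [L] of argument [bdry_angle phi]: [u] is the imaginary part of [p]. *)
Definition fixpt (phi u : R) : C :=
  polar (u / sin (bdry_angle phi - u)) (bdry_angle phi - u).

Definition fixpt_radius (phi u : R) : R :=
  u / sin (bdry_angle phi - u) * exp (u * cot (bdry_angle phi - u)).

Lemma fixpt_fixed (phi u : R) : sin (bdry_angle phi - u) <> 0 ->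
  emap (polar (fixpt_radius phi u) (bdry_angle phi)) (fixpt phi u) = fixpt phi u.
Proof.
  intros Hs. rewrite emap_polar. unfold fixpt at 1 2. autorewrite with cplx.
  unfold fixpt, fixpt_radius, cot. set (s := sin (bdry_angle phi - u)) in *.
  set (c := cos (bdry_angle phi - u)). f_equal.
  - rewrite Rmult_assoc, <- exp_plus.
    replace (u * (c / s) + - (u / s * c)) with 0 by (field; easy). rewrite exp_0; ring.
  - field; easy.
Qed.

(** The radius increases with u and equals e^(cos phi) at u = sin phi: with q = u / sin (t - u) and
    c = cos (t - u), the sign of the derivative is that of 1 + 2 q c + q^2 = (1 - q)^2 + 2 q (1 +
    c). Hence all the parameters involved are multiples of the boundary parameter by factors in
    [0, 1]. *)
Lemma fixpt_radius_le (phi u : R) : 0 < phi < PI -> 0 <= u <= sin phi ->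
  fixpt_radius phi u <= exp (cos phi).
Proof.
  intros Hphi Hu. pose proof (bdry_angle_bounds phi Hphi) as Ht.
  set (t := bdry_angle phi) in *.
  assert (Hsp : 0 < sin phi) by (apply sin_gt_0; lra).
  replace (exp (cos phi)) with (fixpt_radius phi (sin phi)).
  2:{ unfold fixpt_radius, cot. unfold bdry_angle.
      replace (phi + sin phi - sin phi) with phi by ring.
      replace (sin phi * (cos phi / sin phi)) with (cos phi) by (field; lra). field. lra. }
  apply (derive_nonneg_le (fixpt_radius phi) (fun u =>
    exp (u * cot (t - u)) / sin (t - u) *
      (1 + 2 * (u / sin (t - u)) * cos (t - u) + (u / sin (t - u)) ^ 2))); [lra| |].
  - intros x Hx. assert (Hs : 0 < sin (t - x)) by (apply sin_gt_0; unfold t, bdry_angle in *; lra).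
    unfold fixpt_radius, cot. fold t. auto_derive; [change (t + - x) with (t - x); lra|].
    change (t + - x) with (t - x).
    assert (E1 : sin (t - x) ^ 2 + cos (t - x) ^ 2 = 1)
      by (pose proof (sin2_cos2 (t - x)) as E; unfold Rsqr in E; lra).
    set (s := sin (t - x)) in *. set (c := cos (t - x)) in *.
    change (cos (t - x) / sin (t - x)) with (c / s).
    replace (1 + 2 * (x / s) * c + (x / s) ^ 2)
      with (1 + 2 * (x / s) * c + (x / s) ^ 2 * (s ^ 2 + c ^ 2)) by (rewrite E1; ring).
    unfold Rdiv. field. lra.
  - intros x Hx. assert (Hs : 0 < sin (t - x)) by (apply sin_gt_0; unfold t, bdry_angle in *; lra).
    apply Rmult_le_pos; [left; apply Rdiv_lt_0_compat; [apply exp_pos|easy]|].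
    assert (Hq : 0 <= x / sin (t - x)) by (apply Rmult_le_pos; [lra|left; now apply Rinv_0_lt_compat]).
    pose proof (COS_bound (t - x)) as [Hc _].
    set (q := x / sin (t - x)) in *. set (c := cos (t - x)) in *.
    assert (0 <= q * (1 + c)) by (apply Rmult_le_pos; lra). pose proof (pow2_ge_0 (1 - q)). lra.
Qed.

(** By [emap_lipschitz], the map contracts distances to p by the factor k within distance |z - p| of
    p, so the orbit of z converges to p. *)
Lemma attracting_fixed_point (L p z : C) (K : C -> Prop) (k : R) :
  closedC K -> (forall w, K w -> K (emap L w)) -> emap L p = p ->
  Cmod p * exp (Cmod (z - p)) <= k -> k < 1 -> K z -> K p.
Proof.
  intros Hcl HK Hp Hk Hk1 Hz. set (e := Cmod (z - p)) in *.
  assert (He : 0 <= e) by apply Cmod_ge_0.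
  assert (Hk0 : 0 <= k).
  { eapply Rle_trans; [|exact Hk]. apply Rmult_le_pos; [apply Cmod_ge_0|left; apply exp_pos]. }
  assert (Hit : forall n, exists w, K w /\ Cmod (w - p) <= k ^ n * e).
  { induction n as [|n (w & Hw & Hwp)].
    - exists z. split; [easy|]. unfold e. simpl. lra.
    - exists (emap L w). split; [now apply HK|]. rewrite <- Hp at 1.
      eapply Rle_trans; [apply emap_lipschitz|]. rewrite Hp.
      assert (Hkn : 0 <= k ^ n <= 1).
      { split; [now apply pow_le|]. rewrite <- (pow1 n). apply pow_incr; lra. }
      assert (Hwe : Cmod (w - p) <= e) by nra.
      assert (Hex : exp (Cmod (w - p)) <= exp e) by (now apply exp_le).
      pose proof (Cmod_ge_0 p). pose proof (Cmod_ge_0 (w - p)).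
      apply Rle_trans with (Cmod p * exp e * Cmod (w - p)).
      + replace (Cmod p * exp e * Cmod (w - p)) with (Cmod p * (Cmod (w - p) * exp e)) by ring.
        apply Rmult_le_compat_l; [easy|]. now apply Rmult_le_compat_l.
      + simpl. rewrite (Rmult_assoc k). apply Rmult_le_compat; try easy.
        apply Rmult_le_pos; [easy|left; apply exp_pos]. }
  apply Hcl. intros d Hd.
  destruct (pow_lt_1_zero k ltac:(rewrite Rabs_pos_eq; lra) (d / (e + 1))) as [N HN].
  { apply Rdiv_lt_0_compat; lra. }
  destruct (Hit N) as (w & Hw & Hwp). exists w. split; [easy|].
  specialize (HN N (le_n N)). rewrite Rabs_pos_eq in HN by now apply pow_le.
  eapply Rle_lt_trans; [exact Hwp|].
  apply Rle_lt_trans with (k ^ N * (e + 1)); [apply Rmult_le_compat_l; [now apply pow_le|lra]|].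
  apply Rmult_lt_reg_r with (/ (e + 1)); [apply Rinv_0_lt_compat; lra|].
  rewrite Rmult_assoc, Rinv_r, Rmult_1_r by lra. exact HN.
Qed.

(** Continuation in u: as [K] is also invariant for the multiples c L with c in [0, 1], and the
    fixed points before the last one are attracting, the fixed point for y is the limit of the orbit
    that starts at the fixed point for a slightly smaller x. *)
Lemma fixpt_in (phi : R) (K : C -> Prop) : 0 < phi < PI ->
  inv_convex (polar (exp (cos phi)) (bdry_angle phi)) K -> closedC K -> K (polar 1 phi).
Proof.
  intros Hphi HK Hcl. pose proof (bdry_angle_bounds phi Hphi) as Ht.
  set (t := bdry_angle phi) in *.
  assert (Hsp : 0 < sin phi) by (apply sin_gt_0; lra).
  assert (Hsin : forall u, 0 <= u <= sin phi -> 0 < sin (t - u)).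
  { intros u Hu. apply sin_gt_0; unfold t, bdry_angle in *; lra. }
  replace (polar 1 phi) with (fixpt phi (sin phi)).
  2:{ unfold fixpt. unfold bdry_angle.
      replace (phi + sin phi - sin phi) with phi by ring. f_equal. field. lra. }
  assert (Hcont : forall x, 0 <= x <= sin phi -> forall e, 0 < e ->
    exists d, 0 < d /\ forall y, Rabs (y - x) < d -> Cmod (fixpt phi y - fixpt phi x) < e).
  { intros x Hx e He. pose proof (Hsin x Hx).
    apply (curve_eps (fun y => y / sin (t - y) * cos (t - y))
                     (fun y => y / sin (t - y) * sin (t - y)) x e); [| |easy]; cont_auto;
      change (t + - x) with (t - x); lra. }
  apply (real_induction (fun u => K (fixpt phi u)) 0 (sin phi)); [lra| | |].
  - unfold fixpt. replace (polar _ _) with (RtoC 0); [apply HK|]. unfold Rdiv. cext; ring.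
  - intros x Hx Hlim. apply Hcl. intros e He. destruct (Hcont x Hx e He) as (d & Hd & Hc).
    destruct (Hlim d Hd) as (y & _ & Hy & Hyx). exists (fixpt phi y). auto.
  - intros x Hx HKx. pose proof (Hsin x ltac:(lra)) as Hs.
    set (rho := x / sin (t - x)).
    assert (Hrho : 0 <= rho < 1).
    { split; [apply Rmult_le_pos; [lra|left; now apply Rinv_0_lt_compat]|].
      apply Rmult_lt_reg_r with (sin (t - x)); [easy|]. unfold rho.
      replace (x / sin (t - x) * sin (t - x)) with x by (field; lra).
      pose proof (sin_sub_lt phi (t - x)) as Hlt. unfold t, bdry_angle in *. lra. }
    destruct (cont_pos (fun e => 1 - (rho + e) * exp e) 0) as (e & He & Hke).
    { cont_auto. easy. }
    { rewrite exp_0. lra. }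
    specialize (Hke e ltac:(rewrite Rabs_pos_eq; lra)). cbv beta in Hke.
    destruct (Hcont x ltac:(lra) e He) as (d & Hd & Hc).
    exists (Rmin (d / 2) ((sin phi - x) / 2)). split; [apply Rmin_pos; lra|].
    intros y Hy _. pose proof (Rmin_l (d / 2) ((sin phi - x) / 2)).
    pose proof (Rmin_r (d / 2) ((sin phi - x) / 2)).
    assert (Hyx : Rabs (y - x) < d) by (rewrite Rabs_pos_eq; lra).
    specialize (Hc y Hyx). pose proof (Hsin y ltac:(lra)) as Hsy.
    set (c := fixpt_radius phi y / exp (cos phi)).
    assert (Hc01 : 0 <= c <= 1).
    { pose proof (exp_pos (cos phi)). unfold c. split.
      - apply Rmult_le_pos; [|left; now apply Rinv_0_lt_compat].
        unfold fixpt_radius. apply Rmult_le_pos; [|left; apply exp_pos].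
        apply Rmult_le_pos; [lra|left; now apply Rinv_0_lt_compat].
      - apply Rmult_le_reg_r with (exp (cos phi)); [easy|].
        pose proof (fixpt_radius_le phi y Hphi ltac:(lra)).
        replace (fixpt_radius phi y / exp (cos phi) * exp (cos phi)) with (fixpt_radius phi y)
          by (field; lra). lra. }
    apply (attracting_fixed_point (polar (fixpt_radius phi y) t) _ (fixpt phi x) K ((rho + e) * exp e)).
    + easy.
    + intros w Hw.
      replace (polar (fixpt_radius phi y) t) with (RtoC c * polar (exp (cos phi)) t)%C.
      2:{ rewrite scal_polar. f_equal. unfold c. field. apply Rgt_not_eq, exp_pos. }
      rewrite emap_scal. destruct HK as [K0 Kc Kf]. apply convex_scal; auto.
    + apply fixpt_fixed. fold t. lra.
    + assert (Hm : Cmod (fixpt phi x) = rho) by (unfold fixpt; now apply Cmod_polar_eq).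
      pose proof (Cmod_triangle_sub (fixpt phi y) (fixpt phi x)).
      rewrite (Cmod_sub_sym (fixpt phi x)).
      apply Rmult_le_compat; [apply Cmod_ge_0|left; apply exp_pos|lra|apply exp_le; lra].
    + lra.
    + easy.
Qed.

(** * Rotation makes the fixed point interior *)

Lemma Cmod_Cexp_sub2 (u : C) : Cmod (Cexp u - 1 - u) <= Cmod u ^ 2 * exp (Cmod u).
Proof.
  remember (Cexp u - 1 - u)%C as d eqn:Ed.
  destruct (Req_dec (Cmod d) 0) as [E|E].
  { rewrite E. apply Rmult_le_pos; [apply pow2_ge_0 | left; apply exp_pos]. }
  assert (Hd : 0 < Cmod d) by (pose proof (Cmod_ge_0 d); lra).
  set (h := fun t => Re d * (exp (t * Re u) * cos (t * Im u) - t * Re u)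
                     + Im d * (exp (t * Re u) * sin (t * Im u) - t * Im u)).
  set (dh := fun t => Re d * (exp (t * Re u) * (Re u * cos (t * Im u) - Im u * sin (t * Im u)) - Re u)
                     + Im d * (exp (t * Re u) * (Re u * sin (t * Im u) + Im u * cos (t * Im u)) - Im u)).
  destruct (MVT_gen h 0 1 dh) as (c & Hc & Hh).
  { intros x _. unfold h, dh. auto_derive; [easy|]. ring. }
  { intros x _. apply ex_derive_continuity_pt. unfold h. auto_derive; easy. }
  rewrite Rmin_left, Rmax_right in Hc by lra.
  assert (E1 : h 1 - h 0 = Cmod d ^ 2).
  { rewrite Cmod_sqr. unfold h. rewrite !Rmult_1_l, !Rmult_0_l, exp_0, cos_0, sin_0.
    rewrite Ed. autorewrite with cplx. ring. }
  assert (E2 : dh c <= Cmod d * (Cmod u ^ 2 * exp (Cmod u))).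
  { assert (Hb : dh c = Re (Cconj d * (u * (Cexp (RtoC c * u) - 1)))%C).
    { unfold dh. autorewrite with cplx. ring. }
    rewrite Hb. eapply Rle_trans; [apply Rle_abs|]. eapply Rle_trans; [apply re_le_Cmod|].
    rewrite !Cmod_mult, Cmod_conj.
    apply Rmult_le_compat_l; [apply Cmod_ge_0|].
    replace (Cmod u ^ 2 * exp (Cmod u)) with (Cmod u * (Cmod u * exp (Cmod u))) by ring.
    apply Rmult_le_compat_l; [apply Cmod_ge_0|].
    eapply Rle_trans; [apply Cmod_Cexp_sub1|]. rewrite Cmod_scal, Rabs_pos_eq by lra.
    pose proof (Cmod_ge_0 u).
    apply Rmult_le_compat; [nra|left; apply exp_pos|nra|]. apply exp_le; nra. }
  rewrite Rminus_0_r, Rmult_1_r in Hh. nra.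
Qed.

Definition cross (a b : C) : R := Re a * Im b - Im a * Re b.

Lemma cross_le (a b : C) : Rabs (cross a b) <= Cmod a * Cmod b.
Proof.
  unfold cross. replace (Re a * Im b - Im a * Re b) with (Im (Cconj a * b)%C)
    by (autorewrite with cplx; ring).
  rewrite <- (Cmod_conj a), <- Cmod_mult. apply im_le_Cmod.
Qed.

Lemma convex3 (K : C -> Prop) (a b c : C) (x y z : R) : convex K -> K a -> K b -> K c ->
  0 <= x -> 0 <= y -> 0 < z -> x + y + z = 1 -> K (RtoC x * a + RtoC y * b + RtoC z * c)%C.
Proof.
  intros Hc Ha Hb Hcc Hx Hy Hz Hs.
  set (s := y / (y + z)).
  assert (Hs1 : 0 <= s <= 1).
  { unfold s. split; [apply Rmult_le_pos; [easy|left; apply Rinv_0_lt_compat; lra]|].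
    apply Rmult_le_reg_r with (y + z); [lra|]. field_simplify; lra. }
  assert (Hbc : K (c + RtoC s * (b - c))%C) by now apply Hc.
  replace (RtoC x * a + RtoC y * b + RtoC z * c)%C
    with ((c + RtoC s * (b - c)) + RtoC x * (a - (c + RtoC s * (b - c))))%C.
  - apply Hc; [easy|easy|lra].
  - replace x with (1 - y - z) by lra. unfold s. cext; field; lra.
Qed.

Lemma triangle_interior (K : C -> Prop) (p a b c : C) : convex K ->
  K (p + a)%C -> K (p + b)%C -> K (p + c)%C ->
  0 < cross a b -> 0 < cross b c -> 0 < cross c a ->
  exists e, 0 < e /\ forall z, Cmod (z - p) < e -> K z.
Proof.
  intros HK Ha Hb Hc Hab Hbc Hca.
  set (m := Rmin (cross a b) (Rmin (cross b c) (cross c a))).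
  assert (Hm : 0 < m) by (repeat apply Rmin_pos; easy).
  set (S := Cmod a + Cmod b + Cmod c + 1).
  assert (HS : 0 < S).
  { unfold S. pose proof (Cmod_ge_0 a). pose proof (Cmod_ge_0 b). pose proof (Cmod_ge_0 c). lra. }
  exists (m / S). split; [now apply Rdiv_lt_0_compat|]. intros z Hz. set (x := (z - p)%C) in *.
  assert (HxS : Cmod x * S < m).
  { apply Rmult_lt_reg_r with (/ S); [now apply Rinv_0_lt_compat|].
    rewrite Rmult_assoc, Rinv_r, Rmult_1_r by lra. exact Hz. }
  assert (Hgen : forall u v, m <= cross u v -> Cmod u + Cmod v <= S -> 0 < cross (u - x) (v - x)).
  { intros u v Huv Hn.
    replace (cross (u - x) (v - x)) with (cross u v - cross x v - cross u x)
      by (unfold cross; autorewrite with cplx; ring).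
    pose proof (cross_le x v). pose proof (cross_le u x).
    pose proof (Rle_abs (cross x v)). pose proof (Rle_abs (cross u x)).
    pose proof (Cmod_ge_0 x). nra. }
  assert (Hm1 : m <= cross a b) by apply Rmin_l.
  assert (Hm2 : m <= cross b c) by (eapply Rle_trans; [apply Rmin_r|apply Rmin_l]).
  assert (Hm3 : m <= cross c a) by (eapply Rle_trans; [apply Rmin_r|apply Rmin_r]).
  pose proof (Cmod_ge_0 a). pose proof (Cmod_ge_0 b). pose proof (Cmod_ge_0 c).
  pose proof (Hgen a b Hm1 ltac:(unfold S; lra)) as HC.
  pose proof (Hgen b c Hm2 ltac:(unfold S; lra)) as HA.
  pose proof (Hgen c a Hm3 ltac:(unfold S; lra)) as HB.
  (* Barycentric coordinates are ratios of areas. *)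
  set (A := cross (b - x) (c - x)) in *. set (B := cross (c - x) (a - x)) in *.
  set (D := cross (a - x) (b - x)) in *. set (T := A + B + D).
  assert (HT : 0 < T) by (unfold T; lra).
  replace z with (RtoC (A / T) * (p + a) + RtoC (B / T) * (p + b) + RtoC (D / T) * (p + c))%C.
  - apply convex3; auto.
    + apply Rmult_le_pos; [lra|left; now apply Rinv_0_lt_compat].
    + apply Rmult_le_pos; [lra|left; now apply Rinv_0_lt_compat].
    + now apply Rdiv_lt_0_compat.
    + unfold T. field. unfold T in HT. lra.
  - replace z with (p + x)%C by (unfold x; ring).
    assert (HD : D = T - A - B) by (unfold T; ring).
    assert (E1 : A * Re a + B * Re b + D * Re c = T * Re x).
    { unfold T, A, B, D, cross. autorewrite with cplx. ring. }
    assert (E2 : A * Im a + B * Im b + D * Im c = T * Im x).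
    { unfold T, A, B, D, cross. autorewrite with cplx. ring. }
    cext; unfold Rdiv.
    + apply Rmult_eq_reg_l with T; [|lra].
      transitivity ((A + B + D) * Re p + (A * Re a + B * Re b + D * Re c)); [field; lra|].
      rewrite E1, HD. ring.
    + apply Rmult_eq_reg_l with T; [|lra].
      transitivity ((A + B + D) * Im p + (A * Im a + B * Im b + D * Im c)); [field; lra|].
      rewrite E2, HD. ring.
Qed.

(* Directions of the tangent cone of [K] at [p], with a quadratic error. *)
Definition tangent_dir (K : C -> Prop) (p a : C) : Prop :=
  exists c t0, 0 < t0 /\ 0 <= c /\ forall t, 0 <= t <= t0 ->
    exists w, K (p + w)%C /\ Cmod (w - RtoC t * a) <= c * t ^ 2.

(** The derivative of [emap L] at its fixed point p is -p. *)
Lemma tangent_dir_emap (L p a : C) (K : C -> Prop) :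
  inv_convex L K -> emap L p = p -> tangent_dir K p a -> tangent_dir K p (- p * a).
Proof.
  intros HK Hp (c & t0 & Ht0 & Hc & H).
  set (m := Cmod a + c). assert (Hm : 0 <= m) by (unfold m; pose proof (Cmod_ge_0 a); lra).
  exists (Cmod p * (c + m ^ 2 * exp m)), (Rmin t0 1). split; [apply Rmin_pos; lra|].
  pose proof (exp_pos m). pose proof (Cmod_ge_0 p).
  assert (Hm2 : 0 <= m ^ 2 * exp m) by (apply Rmult_le_pos; [apply pow2_ge_0|lra]).
  split; [apply Rmult_le_pos; lra|].
  intros t Ht. pose proof (Rmin_l t0 1). pose proof (Rmin_r t0 1).
  destruct (H t ltac:(lra)) as (w & Hw & Hwt).
  exists (emap L (p + w) - p)%C. split.
  { replace (p + (emap L (p + w) - p))%C with (emap L (p + w)) by ring. now apply HK. }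
  assert (Hwm : Cmod w <= m * t).
  { pose proof (Cmod_triangle_sub w (RtoC t * a)) as Htr.
    rewrite Cmod_scal, Rabs_pos_eq in Htr by lra. unfold m.
    assert (c * t ^ 2 <= c * t) by (apply Rmult_le_compat_l; nra). lra. }
  replace (emap L (p + w) - p - RtoC t * (- p * a))%C
    with (p * ((Cexp (- w) - 1 - (- w)) - (w - RtoC t * a)))%C.
  2:{ unfold emap. replace (- (p + w))%C with (- p + - w)%C by ring. rewrite Cexp_add, Cmult_assoc.
      fold (emap L p). rewrite Hp. ring. }
  rewrite Cmod_mult, Rmult_assoc. apply Rmult_le_compat_l; [easy|].
  unfold Cminus at 1. eapply Rle_trans; [apply Cmod_triangle|]. rewrite Cmod_opp.
  pose proof (Cmod_Cexp_sub2 (- w)) as He. rewrite Cmod_opp in He.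
  assert (Hexp : exp (Cmod w) <= exp m) by (apply exp_le; nra).
  assert (Cmod w ^ 2 * exp (Cmod w) <= (m * t) ^ 2 * exp m).
  { apply Rmult_le_compat; [apply pow2_ge_0|left; apply exp_pos| |easy].
    apply pow_incr. split; [apply Cmod_ge_0|easy]. }
  rewrite Rpow_mult_distr in *. nra.
Qed.

Lemma tangent_dir_mix (K : C -> Prop) (p a b : C) (s : R) : convex K -> 0 <= s <= 1 ->
  tangent_dir K p a -> tangent_dir K p b -> tangent_dir K p (a + RtoC s * (b - a)).
Proof.
  intros HK Hs (c & t0 & Ht0 & Hc & H) (c' & t0' & Ht0' & Hc' & H').
  exists (c + c'), (Rmin t0 t0'). split; [now apply Rmin_pos|]. split; [lra|].
  intros t Ht. pose proof (Rmin_l t0 t0'). pose proof (Rmin_r t0 t0').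
  destruct (H t ltac:(lra)) as (w & Hw & Hwt). destruct (H' t ltac:(lra)) as (w' & Hw' & Hwt').
  exists (w + RtoC s * (w' - w))%C. split.
  { replace (p + (w + RtoC s * (w' - w)))%C with ((p + w) + RtoC s * ((p + w') - (p + w)))%C by ring.
    now apply HK. }
  replace (w + RtoC s * (w' - w) - RtoC t * (a + RtoC s * (b - a)))%C
    with (RtoC (1 - s) * (w - RtoC t * a) + RtoC s * (w' - RtoC t * b))%C
    by (rewrite RtoC_minus; ring).
  eapply Rle_trans; [apply Cmod_triangle|]. rewrite !Cmod_scal, !Rabs_pos_eq by lra.
  pose proof (Cmod_ge_0 (w - RtoC t * a)). pose proof (Cmod_ge_0 (w' - RtoC t * b)). nra.
Qed.

Lemma tangent_dirs_interior (K : C -> Prop) (p a b c : C) : convex K ->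
  tangent_dir K p a -> tangent_dir K p b -> tangent_dir K p c ->
  0 < cross a b -> 0 < cross b c -> 0 < cross c a ->
  exists e, 0 < e /\ forall z, Cmod (z - p) < e -> K z.
Proof.
  intros HK (ka & ta & Hta & Hka & Ha) (kb & tb & Htb & Hkb & Hb) (kc & tc & Htc & Hkc & Hc)
    Hab Hbc Hca.
  set (m := Rmin (cross a b) (Rmin (cross b c) (cross c a))).
  assert (Hm : 0 < m) by (repeat apply Rmin_pos; easy).
  assert (Hm1 : m <= cross a b) by apply Rmin_l.
  assert (Hm2 : m <= cross b c) by (eapply Rle_trans; [apply Rmin_r|apply Rmin_l]).
  assert (Hm3 : m <= cross c a) by (eapply Rle_trans; [apply Rmin_r|apply Rmin_r]).
  set (k := ka + kb + kc). set (S := Cmod a + Cmod b + Cmod c).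
  assert (HS : 0 <= S).
  { unfold S. pose proof (Cmod_ge_0 a). pose proof (Cmod_ge_0 b). pose proof (Cmod_ge_0 c). lra. }
  assert (Hk : 0 <= k) by (unfold k; lra).
  set (Q := 2 * k * S + k ^ 2 + 1). assert (HQ : 0 < Q) by (unfold Q; nra).
  set (t := Rmin (Rmin 1 (m / (2 * Q))) (Rmin ta (Rmin tb tc))).
  assert (Ht : 0 < t) by (repeat apply Rmin_pos; try easy; [lra|apply Rdiv_lt_0_compat; lra]).
  assert (Ht1 : t <= 1 /\ t <= m / (2 * Q) /\ t <= ta /\ t <= tb /\ t <= tc).
  { unfold t. pose proof (Rmin_l (Rmin 1 (m / (2 * Q))) (Rmin ta (Rmin tb tc))).
    pose proof (Rmin_r (Rmin 1 (m / (2 * Q))) (Rmin ta (Rmin tb tc))).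
    pose proof (Rmin_l 1 (m / (2 * Q))). pose proof (Rmin_r 1 (m / (2 * Q))).
    pose proof (Rmin_l ta (Rmin tb tc)). pose proof (Rmin_r ta (Rmin tb tc)).
    pose proof (Rmin_l tb tc). pose proof (Rmin_r tb tc). repeat split; lra. }
  assert (HtQ : t * Q < m).
  { apply Rle_lt_trans with (m / (2 * Q) * Q); [apply Rmult_le_compat_r; lra|].
    replace (m / (2 * Q) * Q) with (m / 2) by (field; lra). lra. }
  destruct (Ha t ltac:(lra)) as (wa & Hwa & Ea). destruct (Hb t ltac:(lra)) as (wb & Hwb & Eb).
  destruct (Hc t ltac:(lra)) as (wc & Hwc & Ec).
  assert (Hgen : forall u v wu wv, m <= cross u v -> Cmod u <= S -> Cmod v <= S ->
     Cmod (wu - RtoC t * u) <= k * t ^ 2 -> Cmod (wv - RtoC t * v) <= k * t ^ 2 -> 0 < cross wu wv).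
  { intros u v wu wv Huv Hu Hv Eu Ev.
    set (eu := (wu - RtoC t * u)%C) in *. set (ev := (wv - RtoC t * v)%C) in *.
    replace (cross wu wv) with (t ^ 2 * cross u v + t * cross u ev + t * cross eu v + cross eu ev)
      by (unfold cross, eu, ev; autorewrite with cplx; ring).
    pose proof (cross_le u ev) as H1. pose proof (cross_le eu v) as H2. pose proof (cross_le eu ev) as H3.
    pose proof (Cmod_ge_0 u). pose proof (Cmod_ge_0 v). pose proof (Cmod_ge_0 eu). pose proof (Cmod_ge_0 ev).
    assert (H1' : Cmod u * Cmod ev <= S * (k * t ^ 2)) by (apply Rmult_le_compat; easy).
    assert (H2' : Cmod eu * Cmod v <= k * t ^ 2 * S) by (apply Rmult_le_compat; easy).
    assert (H3' : Cmod eu * Cmod ev <= k * t ^ 2 * (k * t ^ 2)) by (apply Rmult_le_compat; easy).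
    apply Rabs_le_between in H1, H2, H3.
    assert (G1 : - (t * (S * (k * t ^ 2))) <= t * cross u ev) by nra.
    assert (G2 : - (t * (k * t ^ 2 * S)) <= t * cross eu v) by nra.
    assert (G3 : - (k * t ^ 2 * (k * t ^ 2)) <= cross eu ev) by nra.
    assert (G0 : t ^ 2 * m <= t ^ 2 * cross u v) by (apply Rmult_le_compat_l; [apply pow2_ge_0|easy]).
    assert (Hfin : 0 < t ^ 2 * (m - t * (2 * k * S) - t * (k ^ 2 * t))).
    { apply Rmult_lt_0_compat; [now apply pow_lt|]. unfold Q in HtQ.
      assert (k ^ 2 * t <= k ^ 2) by (assert (0 <= k ^ 2) by apply pow2_ge_0; nra). nra. }
    nra. }
  assert (Hle : forall q w u, 0 <= q <= k -> Cmod (w - RtoC t * u) <= q * t ^ 2 ->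
                 Cmod (w - RtoC t * u) <= k * t ^ 2).
  { intros q w u Hq Hw. eapply Rle_trans; [exact Hw|]. apply Rmult_le_compat_r; [apply pow2_ge_0|easy]. }
  apply (Hle ka) in Ea; [|unfold k; lra]. apply (Hle kb) in Eb; [|unfold k; lra].
  apply (Hle kc) in Ec; [|unfold k; lra].
  pose proof (Cmod_ge_0 a). pose proof (Cmod_ge_0 b). pose proof (Cmod_ge_0 c).
  apply (triangle_interior K p wa wb wc); auto.
  - apply (Hgen a b); auto; unfold S; lra.
  - apply (Hgen b c); auto; unfold S; lra.
  - apply (Hgen c a); auto; unfold S; lra.
Qed.

(** Either d itself lies in [PI / 2, PI), or d is smaller than the length of this interval and its
    multiples cannot jump over it. *)
Lemma multiple_obtuse (d : R) : 0 < d < PI -> exists m : nat, PI / 2 <= INR m * d < PI.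
Proof.
  intros Hd. pose proof PI_RGT_0.
  assert (Hind : forall n, (exists m : nat, PI / 2 <= INR m * d < PI) \/ INR n * d < PI / 2).
  { induction n as [|n [IH|IH]]; [right; simpl; lra|now left|].
    rewrite S_INR. destruct (Rlt_le_dec ((INR n + 1) * d) (PI / 2)) as [H1|H1]; [now right|left].
    destruct (Rlt_le_dec d (PI / 2)).
    - exists (S n). rewrite S_INR. lra.
    - exists 1%nat. simpl. lra. }
  destruct (INR_archimed d (PI / 2)) as [n Hn]; [easy|].
  destruct (Hind n) as [Hm|Hm]; [easy|lra].
Qed.

(** The segment from p to 0 gives a first direction of [K] at p; the multiplier -p turns it by -d at
    each application. Three directions obtained in this way surround p. *)
Lemma fixpt_interior (phi : R) (L : C) (K : C -> Prop) : 0 < phi < PI ->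
  inv_convex L K -> emap L (polar 1 phi) = polar 1 phi -> K (polar 1 phi) ->
  exists e, 0 < e /\ forall z, Cmod (z - polar 1 phi) < e -> K z.
Proof.
  intros Hphi HK Hp HKp. set (p := polar 1 phi) in *. set (d := PI - phi).
  assert (Hneg : forall x, (- p * polar 1 x)%C = polar 1 (x - d)).
  { intros x. unfold p, d. replace (x - (PI - phi)) with (x + phi - PI) by ring.
    cext; rewrite ?cos_minus, ?sin_minus, ?cos_plus, ?sin_plus, cos_PI, sin_PI; ring. }
  assert (Hdir : forall n, tangent_dir K p (polar 1 (phi + PI - INR n * d))).
  { induction n as [|n IH].
    - exists 0, 1. split; [lra|]. split; [lra|]. intros t Ht. exists (RtoC t * - p)%C. split.
      + replace (p + RtoC t * - p)%C with (p + RtoC t * (0 - p))%C by ring. apply HK; auto. apply HK.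
      + replace (RtoC t * - p - RtoC t * polar 1 (phi + PI - INR 0 * d))%C with (RtoC 0).
        { rewrite Cmod_0. lra. }
        unfold p. replace (phi + PI - INR 0 * d) with (phi + PI) by (simpl; ring).
        cext; rewrite ?cos_plus, ?sin_plus, cos_PI, sin_PI; ring.
    - rewrite S_INR. replace (phi + PI - (INR n + 1) * d) with (phi + PI - INR n * d - d) by ring.
      rewrite <- Hneg. now apply (tangent_dir_emap L). }
  destruct (multiple_obtuse d) as [m Hm]; [unfold d; lra|].
  set (a := INR m * d) in *. set (x := phi + PI).
  assert (D0 : tangent_dir K p (polar 1 x)).
  { pose proof (Hdir 0%nat) as H. now replace (phi + PI - INR 0 * d) with x in H by (unfold x; simpl; ring). }
  assert (D1 : tangent_dir K p (polar 1 (x - a))) by apply (Hdir m).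
  assert (D2 : tangent_dir K p (polar 1 (x - 2 * a))).
  { pose proof (Hdir (2 * m)%nat) as H. rewrite mult_INR in H.
    now replace (phi + PI - INR 2 * INR m * d) with (x - 2 * a) in H by (unfold x, a; simpl; ring). }
  assert (D3 : tangent_dir K p (polar 1 (x - 3 * a))).
  { pose proof (Hdir (3 * m)%nat) as H. rewrite mult_INR in H.
    now replace (phi + PI - INR 3 * INR m * d) with (x - 3 * a) in H by (unfold x, a; simpl; ring). }
  (* At a = PI / 2 the direction x - 2 a is opposite to x. A weight 1/5 on x - 3 a makes the three
     directions positively oriented for every a in [PI / 2, PI). *)
  pose proof (tangent_dir_mix K p _ _ (1 / 5) (ic_convex _ _ HK) ltac:(lra) D2 D3) as D23.
  assert (Hcr : forall u v, cross (polar 1 u) (polar 1 v) = sin (v - u)).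
  { intros u v. unfold cross. autorewrite with cplx. rewrite sin_minus. ring. }
  assert (Hcl : forall u v w s, cross u (v + RtoC s * (w - v)) = (1 - s) * cross u v + s * cross u w).
  { intros. unfold cross. autorewrite with cplx. ring. }
  assert (Hcrl : forall u v w s, cross (v + RtoC s * (w - v)) u = (1 - s) * cross v u + s * cross w u).
  { intros. unfold cross. autorewrite with cplx. ring. }
  assert (Hsa : 0 < sin a) by (apply sin_gt_0; lra).
  assert (Hca : cos a <= 0) by (apply cos_le_0; lra).
  assert (S2 : sin (2 * a) = 2 * sin a * cos a) by apply sin_2a.
  pose proof (sin2_cos2 a) as E. unfold Rsqr in E.
  assert (S3 : sin (3 * a) = sin a * (4 * cos a * cos a - 1)).
  { replace (3 * a) with (2 * a + a) by ring. rewrite sin_plus, S2, cos_2a. nra. }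
  assert (Hc1 : -1 <= cos a) by apply COS_bound.
  apply (tangent_dirs_interior K p (polar 1 x) _ (polar 1 (x - a)) (ic_convex _ _ HK) D0 D23 D1).
  - rewrite Hcl, !Hcr. replace (x - 2 * a - x) with (- (2 * a)) by ring.
    replace (x - 3 * a - x) with (- (3 * a)) by ring. rewrite !sin_neg, S2, S3.
    assert (0 < sin a * (1 / 5 - 8 / 5 * cos a - 4 / 5 * cos a * cos a)).
    { apply Rmult_lt_0_compat; [easy|]. nra. }
    nra.
  - rewrite Hcrl, !Hcr. replace (x - a - (x - 2 * a)) with a by ring.
    replace (x - a - (x - 3 * a)) with (2 * a) by ring. rewrite S2. nra.
  - rewrite Hcr. now replace (x - (x - a)) with a by ring.
Qed.

(** * Complex derivatives and positive real parts *)

(** The functions in question, iterates of [emap] and logarithms of their derivatives, are entire,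
    so no domain is carried along. *)
Definition Cdiff (f df : C -> C) : Prop := forall (z : C) (e : R), 0 < e ->
  exists d, 0 < d /\ forall h, Cmod h < d -> Cmod (f (z + h) - f z - df z * h)%C <= e * Cmod h.

Definition Ccont (f : C -> C) : Prop := forall (z : C) (e : R), 0 < e ->
  exists d, 0 < d /\ forall w, Cmod (w - z) < d -> Cmod (f w - f z) < e.

Lemma Cdiff_cont (f df : C -> C) : Cdiff f df -> Ccont f.
Proof.
  intros H z e He. destruct (H z 1 Rlt_0_1) as (d & Hd & Hf).
  set (m := Cmod (df z) + 1). assert (Hm : 0 < m) by (unfold m; pose proof (Cmod_ge_0 (df z)); lra).
  exists (Rmin d (e / m)). split; [apply Rmin_pos; [easy|now apply Rdiv_lt_0_compat]|].
  intros w Hw. pose proof (Rmin_l d (e / m)). pose proof (Rmin_r d (e / m)).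
  specialize (Hf (w - z)%C ltac:(lra)). replace (z + (w - z))%C with w in Hf by ring.
  pose proof (Cmod_triangle_sub (f w - f z) (df z * (w - z))) as Ht. rewrite Cmod_mult in Ht.
  assert (Cmod (w - z) * m < e); [|unfold m in *; lra].
  apply Rlt_le_trans with (e / m * m); [apply Rmult_lt_compat_r; lra|]. right. field. lra.
Qed.

Definition curve_deriv (c : R -> C) (s : R) (v : C) : Prop :=
  is_derive (fun x => Re (c x)) s (Re v) /\ is_derive (fun x => Im (c x)) s (Im v).

Lemma is_derive_eps (f : R -> R) (x l : R) : is_derive f x l <->
  forall e, 0 < e -> exists d, 0 < d /\ forall h, Rabs h < d ->
    Rabs (f (x + h) - f x - l * h) <= e * Rabs h.
Proof.
  rewrite is_derive_Reals. split.
  - intros H e He. destruct (H e He) as [d Hd]. exists d. split; [apply cond_pos|].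
    intros h Hh. destruct (Req_dec h 0) as [->|Hh0].
    + rewrite Rplus_0_r, Rabs_R0. replace (f x - f x - l * 0) with 0 by ring. rewrite Rabs_R0. lra.
    + specialize (Hd h Hh0 Hh).
      replace (f (x + h) - f x - l * h) with (((f (x + h) - f x) / h - l) * h) by (field; easy).
      rewrite Rabs_mult. apply Rmult_le_compat_r; [apply Rabs_pos|lra].
  - intros H e He. destruct (H (e / 2)) as (d & Hd & Hh); [lra|].
    exists (mkposreal d Hd). intros h Hh0 Hhd. specialize (Hh h Hhd).
    assert (Hp : 0 < Rabs h) by now apply Rabs_pos_lt.
    apply Rmult_lt_reg_r with (Rabs h); [easy|]. rewrite <- Rabs_mult.
    replace (((f (x + h) - f x) / h - l) * h) with (f (x + h) - f x - l * h) by (field; easy). nra.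
Qed.

Lemma curve_deriv_eps (c : R -> C) (s : R) (v : C) : curve_deriv c s v <->
  forall e, 0 < e -> exists d, 0 < d /\ forall h, Rabs h < d ->
    Cmod (c (s + h) - c s - v * RtoC h) <= e * Rabs h.
Proof.
  unfold curve_deriv. rewrite !is_derive_eps. split.
  - intros [H1 H2] e He. destruct (H1 (e / 2)) as (d1 & Hd1 & E1); [lra|].
    destruct (H2 (e / 2)) as (d2 & Hd2 & E2); [lra|].
    exists (Rmin d1 d2). split; [now apply Rmin_pos|]. intros h Hh.
    pose proof (Rmin_l d1 d2). pose proof (Rmin_r d1 d2).
    specialize (E1 h ltac:(lra)). specialize (E2 h ltac:(lra)).
    eapply Rle_trans; [apply Cmod_le_abs|]. autorewrite with cplx. lra.
  - intros H. split; intros e He; destruct (H e He) as (d & Hd & E); exists d; (split; [easy|]);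
      intros h Hh; (eapply Rle_trans; [|exact (E h Hh)]).
    + eapply Rle_trans; [|apply re_le_Cmod]. autorewrite with cplx. lra.
    + eapply Rle_trans; [|apply im_le_Cmod]. autorewrite with cplx. lra.
Qed.

Lemma curve_deriv_comp (f df : C -> C) (c : R -> C) (s : R) (v : C) :
  Cdiff f df -> curve_deriv c s v -> curve_deriv (fun x => f (c x)) s (df (c s) * v).
Proof.
  intros Hf Hc. rewrite curve_deriv_eps in Hc |- *. intros e He.
  set (m := Cmod v + 1). assert (Hm : 1 <= m) by (unfold m; pose proof (Cmod_ge_0 v); lra).
  set (b := Cmod (df (c s)) + 1). assert (Hb : 1 <= b) by (unfold b; pose proof (Cmod_ge_0 (df (c s))); lra).
  destruct (Hf (c s) (e / 2 / m)) as (d1 & Hd1 & H1).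
  { apply Rdiv_lt_0_compat; lra. }
  destruct (Hc (Rmin 1 (e / 2 / b))) as (d2 & Hd2 & H2).
  { apply Rmin_pos; [lra|]. apply Rdiv_lt_0_compat; lra. }
  exists (Rmin d2 (d1 / m)). split; [apply Rmin_pos; [easy|]; apply Rdiv_lt_0_compat; lra|].
  intros h Hh. pose proof (Rmin_l d2 (d1 / m)). pose proof (Rmin_r d2 (d1 / m)).
  specialize (H2 h ltac:(lra)). pose proof (Rmin_l 1 (e / 2 / b)). pose proof (Rmin_r 1 (e / 2 / b)).
  pose proof (Rabs_pos h) as Hh0.
  set (k := (c (s + h)%R - c s)%C) in *.
  assert (Hk : Cmod k <= m * Rabs h).
  { pose proof (Cmod_triangle_sub k (v * RtoC h)) as Ht. rewrite Cmod_mult, Cmod_R in Ht.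
    unfold m. nra. }
  assert (Hkd : Cmod k < d1).
  { eapply Rle_lt_trans; [exact Hk|]. apply Rlt_le_trans with (m * (d1 / m)).
    - apply Rmult_lt_compat_l; lra.
    - right. field. lra. }
  specialize (H1 k Hkd). replace (c s + k)%C with (c (s + h)) in H1 by (unfold k; ring).
  replace (f (c (s + h)%R) - f (c s) - df (c s) * v * RtoC h)%C
    with ((f (c (s + h)%R) - f (c s) - df (c s) * k) + df (c s) * (k - v * RtoC h))%C by ring.
  eapply Rle_trans; [apply Cmod_triangle|]. rewrite Cmod_mult.
  assert (A1 : e / 2 / m * Cmod k <= e / 2 * Rabs h).
  { apply Rle_trans with (e / 2 / m * (m * Rabs h)).
    - apply Rmult_le_compat_l; [left; apply Rdiv_lt_0_compat; lra|easy].
    - right. field. lra. }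
  assert (A2 : Cmod (df (c s)) * Cmod (k - v * RtoC h) <= b * (e / 2 / b * Rabs h)).
  { apply Rmult_le_compat; [apply Cmod_ge_0|apply Cmod_ge_0|unfold b; lra|].
    eapply Rle_trans; [exact H2|]. apply Rmult_le_compat_r; lra. }
  replace (b * (e / 2 / b * Rabs h)) with (e / 2 * Rabs h) in A2 by (field; lra). lra.
Qed.

Lemma curve_deriv_mul (c1 c2 : R -> C) (s : R) (v1 v2 : C) :
  curve_deriv c1 s v1 -> curve_deriv c2 s v2 ->
  curve_deriv (fun x => c1 x * c2 x)%C s (v1 * c2 s + c1 s * v2).
Proof.
  intros [H1 H2] [H3 H4].
  assert (Hm : forall (f g : R -> R) (a b : R), is_derive f s a -> is_derive g s b ->
    is_derive (fun x => f x * g x) s (a * g s + f s * b)).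
  { intros f g a b Hf Hg. apply (is_derive_mult f g s a b Hf Hg). intros; apply Rmult_comm. }
  split.
  - eapply is_derive_ext; [intros t; symmetry; apply Re_mul|]. rewrite Re_add, !Re_mul.
    replace (Re v1 * Re (c2 s) - Im v1 * Im (c2 s) + (Re (c1 s) * Re v2 - Im (c1 s) * Im v2))
      with (minus (Re v1 * Re (c2 s) + Re (c1 s) * Re v2) (Im v1 * Im (c2 s) + Im (c1 s) * Im v2))
      by (unfold minus, plus, opp; simpl; ring).
    apply (is_derive_minus (V := R_NormedModule)); now apply Hm.
  - eapply is_derive_ext; [intros t; symmetry; apply Im_mul|]. rewrite Im_add, !Im_mul.
    replace (Re v1 * Im (c2 s) + Im v1 * Re (c2 s) + (Re (c1 s) * Im v2 + Im (c1 s) * Re v2))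
      with (plus (Re v1 * Im (c2 s) + Re (c1 s) * Im v2) (Im v1 * Re (c2 s) + Im (c1 s) * Re v2))
      by (unfold plus; simpl; ring).
    apply (is_derive_plus (V := R_NormedModule)); now apply Hm.
Qed.

Lemma curve_deriv_const (a : C) (s : R) : curve_deriv (fun _ => a) s 0.
Proof. split; apply (is_derive_const (V := R_NormedModule)). Qed.

Definition cis (t : R) : C := (cos t, sin t).

Lemma cis_deriv (k t : R) : curve_deriv (fun t => cis (k * t)) t (RtoC k * Ci * cis (k * t)).
Proof.
  split; unfold cis; autorewrite with cplx; simpl; auto_derive; try easy; ring.
Qed.

Lemma Cmod_cis (t : R) : Cmod (cis t) = 1.
Proof. replace (cis t) with (polar 1 t) by (cext; unfold cis; simpl; ring). apply Cmod_polar_eq; lra. Qed.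

Lemma cis_add (x y : R) : cis (x + y) = (cis x * cis y)%C.
Proof. unfold cis. cext; rewrite ?cos_plus, ?sin_plus; ring. Qed.

(** The joint continuity that differentiation under the integral sign requires. *)
Lemma Ccont_2d (f : C -> C) (z a : C) (k x y : R) : Ccont f ->
  continuity_2d_pt (fun u v => Re (a * (f (z + RtoC u * cis v) * cis (k * v)))%C) x y.
Proof.
  intros Hf.
  assert (Hloc : forall e : posreal, locally_2d
    (fun u v => Cmod (f (z + RtoC u * cis v)%C - f (z + RtoC x * cis y)%C) < e) x y).
  { intros e. destruct (Hf (z + RtoC x * cis y)%C e (cond_pos e)) as (d & Hd & H).
    destruct (curve_eps cos sin y (d / (2 * (Rabs x + 1)))) as (d' & Hd' & Hc).
    { apply continuity_cos. } { apply continuity_sin. }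
    { pose proof (Rabs_pos x). apply Rdiv_lt_0_compat; lra. }
    assert (Hm : 0 < Rmin (d / 2) d') by (apply Rmin_pos; lra).
    exists (mkposreal _ Hm). simpl. intros u v Hu Hv.
    pose proof (Rmin_l (d / 2) d'). pose proof (Rmin_r (d / 2) d').
    apply H. replace (z + RtoC u * cis v - (z + RtoC x * cis y))%C
      with (RtoC (u - x) * cis v + RtoC x * (cis v - cis y))%C by (rewrite RtoC_minus; ring).
    eapply Rle_lt_trans; [apply Cmod_triangle|]. rewrite !Cmod_scal, Cmod_cis.
    specialize (Hc v ltac:(lra)). fold (cis v) (cis y) in Hc. pose proof (Rabs_pos x).
    assert (Rabs x * Cmod (cis v - cis y) <= (Rabs x + 1) * (d / (2 * (Rabs x + 1)))).
    { apply Rmult_le_compat; try lra. apply Cmod_ge_0. }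
    replace ((Rabs x + 1) * (d / (2 * (Rabs x + 1)))) with (d / 2) in * by (field; lra). lra. }
  assert (HRe : continuity_2d_pt (fun u v => Re (f (z + RtoC u * cis v)%C)) x y).
  { intros e. apply (locally_2d_impl _ _ _ _ (locally_2d_forall _ x y (fun u v (H : Cmod (f (z + RtoC u * cis v)%C - f (z + RtoC x * cis y)%C) < e) =>
      Rle_lt_trans _ _ _ (re_le_Cmod _) H)) (Hloc e)). }
  assert (HIm : continuity_2d_pt (fun u v => Im (f (z + RtoC u * cis v)%C)) x y).
  { intros e. apply (locally_2d_impl _ _ _ _ (locally_2d_forall _ x y (fun u v (H : Cmod (f (z + RtoC u * cis v)%C - f (z + RtoC x * cis y)%C) < e) =>
      Rle_lt_trans _ _ _ (im_le_Cmod _) H)) (Hloc e)). }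
  assert (Hcos : continuity_2d_pt (fun _ v => cos (k * v)) x y).
  { apply (continuity_1d_2d_pt_comp (fun v => cos (k * v)) (fun _ v => v)).
    - cont_auto. easy.
    - apply continuity_2d_pt_id2. }
  assert (Hsin : continuity_2d_pt (fun _ v => sin (k * v)) x y).
  { apply (continuity_1d_2d_pt_comp (fun v => sin (k * v)) (fun _ v => v)).
    - cont_auto. easy.
    - apply continuity_2d_pt_id2. }
  apply continuity_2d_pt_ext with (fun u v =>
    Re a * (Re (f (z + RtoC u * cis v)%C) * cos (k * v) - Im (f (z + RtoC u * cis v)%C) * sin (k * v))
    - Im a * (Re (f (z + RtoC u * cis v)%C) * sin (k * v) + Im (f (z + RtoC u * cis v)%C) * cos (k * v))).
  { intros u v. rewrite (Re_mul a), Re_mul, Im_mul. reflexivity. }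
  repeat first [apply continuity_2d_pt_minus | apply continuity_2d_pt_plus | apply continuity_2d_pt_mult
    | apply continuity_2d_pt_const | assumption].
Qed.

Lemma sin_cos_half (x : R) : sin x = cos (PI / 2 - x).
Proof. now rewrite cos_shift. Qed.

Lemma sin_period_Z (x : R) (k : Z) : sin (x + 2 * IZR k * PI) = sin x.
Proof.
  rewrite !sin_cos_half. replace (PI / 2 - (x + 2 * IZR k * PI)) with (PI / 2 - x + 2 * IZR (- k) * PI)
    by (rewrite opp_IZR; ring). apply cos_period_Z.
Qed.

(* Fourier coefficients of [f] on circles: index [- k], radius [s]. *)
Definition fourier (f : C -> C) (z a : C) (k s : R) : R :=
  RInt (fun t => Re (a * (f (z + RtoC s * cis t) * cis (k * t)))%C) 0 (2 * PI).

(** The derivative of the circle in its radius is cis t, which shifts the index from k to k + 1. *)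
Lemma radial_deriv (f df : C -> C) (z a : C) (k s t : R) : Cdiff f df ->
  is_derive (fun s => Re (a * (f (z + RtoC s * cis t) * cis (k * t)))%C) s
    (Re (a * (df (z + RtoC s * cis t) * cis ((k + 1) * t)))%C).
Proof.
  intros Hf.
  assert (Hl : curve_deriv (fun s => z + RtoC s * cis t)%C s (cis t)).
  { unfold cis. split; autorewrite with cplx.
    - apply is_derive_ext with (fun s => Re z + s * cos t); [intros u; now autorewrite with cplx|].
      auto_derive; [easy|ring].
    - apply is_derive_ext with (fun s => Im z + s * sin t); [intros u; now autorewrite with cplx|].
      auto_derive; [easy|ring]. }
  pose proof (curve_deriv_comp f df _ s _ Hf Hl) as Hc.
  pose proof (curve_deriv_mul _ _ s _ _ Hc (curve_deriv_const (cis (k * t)) s)) as Hm.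
  pose proof (curve_deriv_mul _ _ s _ _ (curve_deriv_const a s) Hm) as [H _].
  replace ((k + 1) * t) with (t + k * t) by ring. rewrite cis_add.
  match type of H with is_derive _ _ ?v => match goal with |- is_derive _ _ ?w => replace w with v; [exact H|] end end.
  f_equal. ring.
Qed.

Lemma angular_deriv (f df : C -> C) (z a : C) (k s t : R) : Cdiff f df ->
  curve_deriv (fun t => a * (f (z + RtoC s * cis t) * cis (k * t)))%C t
    (Ci * (RtoC s * (a * (df (z + RtoC s * cis t) * cis ((k + 1) * t)))
           + RtoC k * (a * (f (z + RtoC s * cis t) * cis (k * t)))))%C.
Proof.
  intros Hf.
  assert (Hl : curve_deriv (fun t => z + RtoC s * cis t)%C t (RtoC s * (Ci * cis t))%C).
  { unfold cis. split; autorewrite with cplx.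
    - apply is_derive_ext with (fun t => Re z + s * cos t); [intros u; now autorewrite with cplx|].
      auto_derive; [easy|ring].
    - apply is_derive_ext with (fun t => Im z + s * sin t); [intros u; now autorewrite with cplx|].
      auto_derive; [easy|ring]. }
  pose proof (curve_deriv_comp f df _ t _ Hf Hl) as Hc.
  pose proof (curve_deriv_mul _ _ t _ _ Hc (cis_deriv k t)) as Hm.
  pose proof (curve_deriv_mul _ _ t _ _ (curve_deriv_const a t) Hm) as H.
  replace ((k + 1) * t) with (t + k * t) by ring. rewrite cis_add.
  match type of H with curve_deriv _ _ ?v => match goal with |- curve_deriv _ _ ?w => replace w with v; [exact H|] end end.
  ring.
Qed.

Lemma fourier_ex (f df : C -> C) (z a : C) (k s : R) : Cdiff f df ->
  ex_RInt (fun t => Re (a * (f (z + RtoC s * cis t) * cis (k * t)))%C) 0 (2 * PI).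
Proof.
  intros Hf. apply (ex_RInt_continuous (V := R_CompleteNormedModule)). intros t _.
  apply (ex_derive_continuous (V := R_NormedModule)).
  eexists. exact (proj1 (angular_deriv f df z a k s t Hf)).
Qed.

Lemma fourier_deriv (f df ddf : C -> C) (z a : C) (k s : R) : Cdiff f df -> Cdiff df ddf ->
  is_derive (fourier f z a k) s (fourier df z a (k + 1) s).
Proof.
  intros Hf Hdf.
  assert (HD : forall t u, Derive (fun w => Re (a * (f (z + RtoC w * cis t) * cis (k * t)))%C) u =
     Re (a * (df (z + RtoC u * cis t) * cis ((k + 1) * t)))%C).
  { intros t u. apply is_derive_unique, radial_deriv, Hf. }
  unfold fourier at 2.
  rewrite (RInt_ext _ (fun t => Derive (fun u => Re (a * (f (z + RtoC u * cis t) * cis (k * t)))%C) s))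
    by (intros t _; symmetry; apply HD).
  apply is_derive_RInt_param.
  - apply filter_forall. intros x t _. eexists. apply radial_deriv, Hf.
  - intros t _. apply continuity_2d_pt_ext with
      (fun u v => Re (a * (df (z + RtoC u * cis v) * cis ((k + 1) * v)))%C).
    + intros u v. symmetry. apply HD.
    + apply Ccont_2d. now apply (Cdiff_cont df ddf).
  - apply filter_forall. intros x. now apply (fourier_ex f df).
Qed.

(** The left side is the integral of the angular derivative of a function that is periodic because k
    is an integer. *)
Lemma fourier_parts (f df ddf : C -> C) (z a : C) (k : Z) (s : R) : Cdiff f df -> Cdiff df ddf ->
  s * fourier df z a (IZR k + 1) s + IZR k * fourier f z a (IZR k) s = 0.
Proof.
  intros Hf Hdf. unfold fourier.
  set (h := fun t => Re (a * (df (z + RtoC s * cis t) * cis ((IZR k + 1) * t)))%C).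
  set (g := fun t => Re (a * (f (z + RtoC s * cis t) * cis (IZR k * t)))%C).
  assert (Hh : ex_RInt h 0 (2 * PI)) by now apply (fourier_ex df ddf).
  assert (Hg : ex_RInt g 0 (2 * PI)) by now apply (fourier_ex f df).
  set (F := fun t => Im (a * (f (z + RtoC s * cis t) * cis (IZR k * t)))%C).
  assert (HF : forall t, is_derive F t (s * h t + IZR k * g t)).
  { intros t. destruct (angular_deriv f df z a (IZR k) s t Hf) as [_ H].
    replace (s * h t + IZR k * g t) with
      (Im (Ci * (RtoC s * (a * (df (z + RtoC s * cis t) * cis ((IZR k + 1) * t)))
           + RtoC (IZR k) * (a * (f (z + RtoC s * cis t) * cis (IZR k * t)))))%C); [exact H|].
    unfold h, g. autorewrite with cplx. ring. }
  assert (HI : is_RInt (fun t => s * h t + IZR k * g t) 0 (2 * PI) (minus (F (2 * PI)) (F 0))).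
  { apply (is_RInt_derive (V := R_CompleteNormedModule)); intros t _; [apply HF|].
    apply (continuous_plus (V := R_NormedModule)); apply (continuous_scal_r (K := R_AbsRing) (V := R_NormedModule));
      apply (ex_derive_continuous (V := R_NormedModule)).
    - eexists. exact (proj1 (angular_deriv df ddf z a (IZR k + 1) s t Hdf)).
    - eexists. exact (proj1 (angular_deriv f df z a (IZR k) s t Hf)). }
  assert (HF0 : F (2 * PI) = F 0).
  { unfold F. replace (cis (IZR k * (2 * PI))) with (cis (IZR k * 0)).
    - replace (cis (2 * PI)) with (cis 0) by (unfold cis; now rewrite cos_2PI, sin_2PI, cos_0, sin_0).
      reflexivity.
    - unfold cis. rewrite Rmult_0_r. f_equal.
      + rewrite <- (cos_period_Z 0 k). f_equal. ring.
      + rewrite <- (sin_period_Z 0 k). f_equal. ring. }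
  rewrite HF0 in HI. apply (is_RInt_unique (V := R_CompleteNormedModule)) in HI.
  assert (Hlin : RInt (fun t => s * h t + IZR k * g t) 0 (2 * PI) =
                 s * RInt h 0 (2 * PI) + IZR k * RInt g 0 (2 * PI)).
  { apply (is_RInt_unique (V := R_CompleteNormedModule)). apply (is_RInt_plus (V := R_NormedModule));
      apply (is_RInt_scal (V := R_NormedModule)); apply (RInt_correct (V := R_CompleteNormedModule)); easy. }
  rewrite Hlin in HI. unfold minus, plus, opp in HI; simpl in HI. lra.
Qed.

Lemma const_of_derive_0 (f : R -> R) (a b : R) : (forall x, is_derive f x 0) -> f a = f b.
Proof.
  intros H. destruct (MVT_gen f a b (fun _ => 0)) as (c & _ & Hc).
  - intros x _. apply H.
  - intros x _. apply ex_derive_continuity_pt. exists 0. apply H.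
  - lra.
Qed.

Lemma fourier_center (f : C -> C) (z a : C) (k : Z) : k <> 0%Z -> fourier f z a (IZR k) 0 = 0.
Proof.
  intros Hk.
  assert (Hc : forall b, Cdiff (fun _ => b) (fun _ => 0)).
  { intros b w e He. exists 1. split; [lra|]. intros h _.
    replace (b - b - 0 * h)%C with (RtoC 0) by ring. rewrite Cmod_0.
    apply Rmult_le_pos; [lra|apply Cmod_ge_0]. }
  pose proof (fourier_parts (fun _ => f z) _ _ z a k 0 (Hc (f z)) (Hc 0)) as H.
  replace (fourier f z a (IZR k) 0) with (fourier (fun _ => f z) z a (IZR k) 0).
  - apply IZR_neq in Hk. apply Rmult_eq_reg_l with (IZR k); [lra|easy].
  - unfold fourier. apply RInt_ext. intros t _.
    now replace (z + RtoC 0 * cis t)%C with z by ring.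
Qed.

(** The mean value property. The derivative in s is the coefficient of f' with index 1, which
    vanishes by [fourier_parts] with k = 0 for s <> 0 and by [fourier_center] at 0. *)
Lemma fourier_0 (f df ddf : C -> C) (z a : C) (s : R) : Cdiff f df -> Cdiff df ddf ->
  fourier f z a 0 s = 2 * PI * Re (a * f z).
Proof.
  intros Hf Hdf.
  replace (2 * PI * Re (a * f z)) with (fourier f z a 0 0).
  - apply const_of_derive_0. intros x. replace 0 with (fourier df z a (0 + 1) x) at 2.
    { now apply (fourier_deriv f df ddf). }
    destruct (Req_dec x 0) as [->|Hx].
    + rewrite Rplus_0_l. now apply (fourier_center df z a 1).
    + pose proof (fourier_parts f df ddf z a 0 x Hf Hdf) as H. simpl in H.
      apply Rmult_eq_reg_l with x; [lra|easy].
  - unfold fourier. rewrite (RInt_ext _ (fun _ => Re (a * f z))).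
    + rewrite RInt_const. unfold scal; simpl; unfold mult; simpl. ring.
    + intros t _. f_equal. f_equal.
      replace (z + RtoC 0 * cis t)%C with z by ring. rewrite Rmult_0_l.
      unfold cis. rewrite cos_0, sin_0. change (1, 0)%R with (RtoC 1). ring.
Qed.

(** Cauchy's theorem on a circle: by [fourier_parts], s times the coefficient has derivative 0, and
    it vanishes at s = 0. *)
Lemma fourier_1 (f df ddf : C -> C) (z a : C) (s : R) : Cdiff f df -> Cdiff df ddf ->
  0 < s -> fourier f z a 1 s = 0.
Proof.
  intros Hf Hdf Hs.
  assert (H : 0 * fourier f z a 1 0 = s * fourier f z a 1 s).
  { apply (const_of_derive_0 (fun s => s * fourier f z a 1 s)). intros x.
    pose proof (fourier_parts f df ddf z a 1 x Hf Hdf) as H. simpl in H.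
    replace 0 with (1 * fourier f z a 1 x + x * fourier df z a (1 + 1) x) by lra.
    apply (is_derive_mult (fun s => s) (fourier f z a 1) x 1 (fourier df z a (1 + 1) x)).
    - apply (is_derive_id (K := R_AbsRing)).
    - now apply (fourier_deriv f df ddf).
    - intros; apply Rmult_comm. }
  apply Rmult_eq_reg_l with s; lra.
Qed.

(** Cauchy's formula for the first derivative: the derivative in s is the mean value of f', which
    does not depend on s. *)
Lemma fourier_m1 (f df ddf d3f : C -> C) (z a : C) (s : R) :
  Cdiff f df -> Cdiff df ddf -> Cdiff ddf d3f ->
  fourier f z a (-1) s = 2 * PI * Re (a * df z) * s.
Proof.
  intros Hf Hdf Hddf. set (b := 2 * PI * Re (a * df z)).
  assert (H : fourier f z a (-1) 0 - b * 0 = fourier f z a (-1) s - b * s).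
  { apply (const_of_derive_0 (fun s => fourier f z a (-1) s - b * s)). intros x.
    replace 0 with (minus (fourier df z a (-1 + 1) x) b).
    - apply (is_derive_minus (V := R_NormedModule)); [now apply (fourier_deriv f df ddf)|].
      auto_derive; [easy|ring].
    - replace (-1 + 1) with 0 by ring. rewrite (fourier_0 df ddf d3f) by easy.
      unfold b, minus, plus, opp; simpl. ring. }
  rewrite (fourier_center f z a (-1)) in H by easy. lra.
Qed.

(* A nonnegative harmonic function has gradient at most [2 / s] times its
   value: integrate [Re f] against [1 - Re (a / cis t) >= 0]. *)
Lemma deriv_le_of_Re_nonneg (f df ddf d3f : C -> C) (z : C) (s : R) :
  Cdiff f df -> Cdiff df ddf -> Cdiff ddf d3f -> 0 < s ->
  (forall w, Cmod (w - z) <= s -> 0 <= Re (f w)) -> s * Cmod (df z) <= 2 * Re (f z).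
Proof.
  intros Hf Hdf Hddf Hs Hpos. pose proof PI_RGT_0.
  assert (Hdir : forall a, Cmod a = 1 -> s * Re (a * df z) <= 2 * Re (f z)).
  { intros a Ha.
    pose proof (fourier_0 f df ddf z 1 s Hf Hdf) as F0.
    pose proof (fourier_1 f df ddf z (Cconj a) s Hf Hdf Hs) as F1.
    pose proof (fourier_m1 f df ddf d3f z a s Hf Hdf Hddf) as F2.
    unfold fourier in *.
    assert (Hex : forall b k, is_RInt (V := R_NormedModule)
      (fun t => Re (b * (f (z + RtoC s * cis t) * cis (k * t)))%C) 0 (2 * PI)
      (RInt (fun t => Re (b * (f (z + RtoC s * cis t) * cis (k * t)))%C) 0 (2 * PI))).
    { intros. apply (RInt_correct (V := R_CompleteNormedModule)). now apply (fourier_ex f df). }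
    assert (Hlin : forall u0 u1 u2 l0 l1 l2, is_RInt (V := R_NormedModule) u0 0 (2 * PI) l0 ->
      is_RInt (V := R_NormedModule) u1 0 (2 * PI) l1 -> is_RInt (V := R_NormedModule) u2 0 (2 * PI) l2 ->
      is_RInt (V := R_NormedModule) (fun t => 2 * u0 t - (u1 t + u2 t)) 0 (2 * PI) (2 * l0 - (l1 + l2))).
    { intros u0 u1 u2 l0 l1 l2 H0 H1 H2. apply (is_RInt_minus (V := R_NormedModule)).
      - now apply (is_RInt_scal (V := R_NormedModule)).
      - now apply (is_RInt_plus (V := R_NormedModule)). }
    assert (HI : is_RInt (fun t => 2 * Re (1 * (f (z + RtoC s * cis t) * cis (0 * t)))%C
        - (Re (Cconj a * (f (z + RtoC s * cis t) * cis (1 * t)))%C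
           + Re (a * (f (z + RtoC s * cis t) * cis (-1 * t)))%C)) 0 (2 * PI)
      (2 * (2 * PI * Re (1 * f z)) - (0 + 2 * PI * Re (a * df z) * s))).
    { pose proof (Hlin _ _ _ _ _ _ (Hex (RtoC 1) 0) (Hex (Cconj a) 1) (Hex a (-1))) as HI.
      rewrite F0, F1, F2 in HI. exact HI. }
    assert (H0 : 0 <= 2 * (2 * PI * Re (1 * f z)) - (0 + 2 * PI * Re (a * df z) * s)).
    { apply (is_RInt_ge_0 _ 0 (2 * PI) _ ltac:(lra) HI). intros t _.
      set (w := (z + RtoC s * cis t)%C).
      assert (Hw : 0 <= Re (f w)).
      { apply Hpos. unfold w. replace (z + RtoC s * cis t - z)%C with (RtoC s * cis t)%C by ring.
        rewrite Cmod_scal, Cmod_cis, Rabs_pos_eq; lra. }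
      assert (Hca : Re (a * Cconj (cis t))%C <= 1).
      { eapply Rle_trans; [apply Rle_abs|]. eapply Rle_trans; [apply re_le_Cmod|].
        rewrite Cmod_mult, Cmod_conj, Cmod_cis, Ha. lra. }
      replace (2 * Re (1 * (f w * cis (0 * t)))%C - (Re (Cconj a * (f w * cis (1 * t)))%C
           + Re (a * (f w * cis (-1 * t)))%C)) with (2 * Re (f w) * (1 - Re (a * Cconj (cis t))%C)).
      - apply Rmult_le_pos; lra.
      - rewrite Rmult_0_l, Rmult_1_l. replace (-1 * t) with (- t) by ring. unfold cis.
        autorewrite with cplx. rewrite cos_0, sin_0, cos_neg, sin_neg. ring. }
    rewrite Cmult_1_l in H0. apply Rmult_le_reg_l with (2 * PI); [lra|].
    set (x := Re (f z)) in *. set (y := Re (a * df z)) in *. lra. }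
  destruct (Req_dec (Cmod (df z)) 0) as [E|E].
  { rewrite E. pose proof (Hpos z) as H0. replace (z - z)%C with (RtoC 0) in H0 by ring.
    rewrite Cmod_0 in H0. specialize (H0 ltac:(lra)). lra. }
  assert (Hd : 0 < Cmod (df z)) by (pose proof (Cmod_ge_0 (df z)); lra).
  set (m := Cmod (df z)) in *.
  specialize (Hdir (RtoC (/ m) * Cconj (df z))%C).
  replace (Re (RtoC (/ m) * Cconj (df z) * df z)) with m in Hdir.
  - apply Hdir. rewrite Cmod_scal, Cmod_conj, Rabs_pos_eq by (left; now apply Rinv_0_lt_compat).
    fold m. field. lra.
  - pose proof (Cmod_sqr (df z)) as Hsq. fold m in Hsq. autorewrite with cplx.
    apply Rmult_eq_reg_l with m; [|lra]. field_simplify; [|lra]. lra.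
Qed.

(** * Calculus of complex derivatives *)

Lemma Cdiff_const (a : C) : Cdiff (fun _ => a) (fun _ => 0).
Proof.
  intros w e He. exists 1. split; [lra|]. intros h _.
  replace (a - a - 0 * h)%C with (RtoC 0) by ring. rewrite Cmod_0.
  apply Rmult_le_pos; [lra|apply Cmod_ge_0].
Qed.

Lemma Cdiff_id : Cdiff (fun z => z) (fun _ => 1).
Proof.
  intros w e He. exists 1. split; [lra|]. intros h _.
  replace (w + h - w - 1 * h)%C with (RtoC 0) by ring. rewrite Cmod_0.
  apply Rmult_le_pos; [lra|apply Cmod_ge_0].
Qed.

Lemma Cdiff_add (f g df dg : C -> C) : Cdiff f df -> Cdiff g dg ->
  Cdiff (fun z => f z + g z)%C (fun z => df z + dg z)%C.
Proof.
  intros Hf Hg z e He. destruct (Hf z (e / 2)) as (d1 & Hd1 & H1); [lra|].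
  destruct (Hg z (e / 2)) as (d2 & Hd2 & H2); [lra|].
  exists (Rmin d1 d2). split; [now apply Rmin_pos|]. intros h Hh.
  pose proof (Rmin_l d1 d2). pose proof (Rmin_r d1 d2).
  specialize (H1 h ltac:(lra)). specialize (H2 h ltac:(lra)).
  replace (f (z + h)%C + g (z + h)%C - (f z + g z) - (df z + dg z) * h)%C
    with ((f (z + h)%C - f z - df z * h) + (g (z + h)%C - g z - dg z * h))%C by ring.
  eapply Rle_trans; [apply Cmod_triangle|]. lra.
Qed.

Lemma Cdiff_mul (f g df dg : C -> C) : Cdiff f df -> Cdiff g dg ->
  Cdiff (fun z => f z * g z)%C (fun z => df z * g z + f z * dg z)%C.
Proof.
  intros Hf Hg z e He.
  set (a := Cmod (f z) + 1). set (b := Cmod (g z) + 1). set (k := Cmod (df z) + 1).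
  assert (Ha : 1 <= a) by (unfold a; pose proof (Cmod_ge_0 (f z)); lra).
  assert (Hb : 1 <= b) by (unfold b; pose proof (Cmod_ge_0 (g z)); lra).
  assert (Hk : 1 <= k) by (unfold k; pose proof (Cmod_ge_0 (df z)); lra).
  destruct (Hf z (Rmin 1 (e / 3 / b))) as (d1 & Hd1 & H1).
  { apply Rmin_pos; [lra|]. apply Rdiv_lt_0_compat; lra. }
  destruct (Hg z (e / 3 / a)) as (d2 & Hd2 & H2); [apply Rdiv_lt_0_compat; lra|].
  destruct (Cdiff_cont g dg Hg z (e / 3 / k)) as (d3 & Hd3 & H3); [apply Rdiv_lt_0_compat; lra|].
  exists (Rmin d1 (Rmin d2 d3)). split; [repeat apply Rmin_pos; easy|]. intros h Hh.
  pose proof (Rmin_l d1 (Rmin d2 d3)). pose proof (Rmin_r d1 (Rmin d2 d3)).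
  pose proof (Rmin_l d2 d3). pose proof (Rmin_r d2 d3).
  specialize (H1 h ltac:(lra)). specialize (H2 h ltac:(lra)). specialize (H3 (z + h)%C).
  replace (z + h - z)%C with h in H3 by ring. specialize (H3 ltac:(lra)).
  pose proof (Rmin_l 1 (e / 3 / b)). pose proof (Rmin_r 1 (e / 3 / b)).
  set (rf := (f (z + h)%C - f z - df z * h)%C) in *.
  set (rg := (g (z + h)%C - g z - dg z * h)%C) in *. set (D := (g (z + h)%C - g z)%C) in *.
  replace (f (z + h)%C * g (z + h)%C - f z * g z - (df z * g z + f z * dg z) * h)%C
    with (rf * g z + f z * rg + (df z * h) * D + rf * D)%C by (unfold rf, rg, D; ring).
  pose proof (Cmod_ge_0 h) as Hh0.
  (* The last two terms combine into [(f (z+h) - f z) D]. *)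
  replace (rf * g z + f z * rg + (df z * h) * D + rf * D)%C
    with (rf * g z + f z * rg + (rf + df z * h) * D)%C by ring.
  eapply Rle_trans; [apply Cmod_triangle|].
  assert (A1 : Cmod (rf * g z + f z * rg) <= e / 3 * Cmod h + e / 3 * Cmod h).
  { eapply Rle_trans; [apply Cmod_triangle|]. rewrite !Cmod_mult. apply Rplus_le_compat.
    - apply Rle_trans with ((e / 3 / b * Cmod h) * b).
      + apply Rmult_le_compat; try apply Cmod_ge_0; [|unfold b; lra].
        eapply Rle_trans; [exact H1|]. apply Rmult_le_compat_r; lra.
      + right. field. lra.
    - apply Rle_trans with (a * (e / 3 / a * Cmod h)).
      + apply Rmult_le_compat; try apply Cmod_ge_0; [unfold a; lra|easy].
      + right. field. lra. }
  assert (A2 : Cmod ((rf + df z * h) * D) <= e / 3 * Cmod h).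
  { rewrite Cmod_mult. apply Rle_trans with ((k * Cmod h) * (e / 3 / k)).
    - apply Rmult_le_compat; try apply Cmod_ge_0; [|lra].
      eapply Rle_trans; [apply Cmod_triangle|]. rewrite Cmod_mult.
      assert (Cmod rf <= 1 * Cmod h).
      { eapply Rle_trans; [exact H1|]. apply Rmult_le_compat_r; lra. }
      unfold k. lra.
    - right. field. lra. }
  lra.
Qed.

Lemma Cdiff_Cexp (f df : C -> C) : Cdiff f df ->
  Cdiff (fun z => Cexp (f z)) (fun z => Cexp (f z) * df z)%C.
Proof.
  intros Hf z e He. set (E := exp (Re (f z))). assert (HE : 0 < E) by apply exp_pos.
  set (k := Cmod (df z) + 1). assert (Hk : 1 <= k) by (unfold k; pose proof (Cmod_ge_0 (df z)); lra).
  destruct (Hf z (Rmin 1 (e / 2 / E))) as (d1 & Hd1 & H1).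
  { apply Rmin_pos; [lra|]. apply Rdiv_lt_0_compat; lra. }
  set (q := e / 2 / (E * (k ^ 2 * exp 1))).
  assert (HQ : 0 < E * (k ^ 2 * exp 1)).
  { repeat apply Rmult_lt_0_compat; try lra. apply exp_pos. }
  assert (Hq : 0 < q) by (unfold q; apply Rdiv_lt_0_compat; lra).
  exists (Rmin d1 (Rmin (/ k) q)).
  split; [repeat apply Rmin_pos; try easy; apply Rinv_0_lt_compat; lra|]. intros h Hh.
  pose proof (Rmin_l d1 (Rmin (/ k) q)). pose proof (Rmin_r d1 (Rmin (/ k) q)).
  pose proof (Rmin_l (/ k) q). pose proof (Rmin_r (/ k) q).
  pose proof (Rmin_l 1 (e / 2 / E)). pose proof (Rmin_r 1 (e / 2 / E)).
  specialize (H1 h ltac:(lra)). pose proof (Cmod_ge_0 h) as Hh0.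
  set (u := (f (z + h)%C - f z)%C).
  set (rf := (f (z + h)%C - f z - df z * h)%C) in *.
  assert (Hu : Cmod u <= k * Cmod h).
  { replace u with (rf + df z * h)%C by (unfold rf, u; ring).
    eapply Rle_trans; [apply Cmod_triangle|]. rewrite Cmod_mult.
    assert (Cmod rf <= 1 * Cmod h).
    { eapply Rle_trans; [exact H1|]. apply Rmult_le_compat_r; lra. }
    unfold k. lra. }
  assert (Hu1 : Cmod u <= 1).
  { eapply Rle_trans; [exact Hu|]. apply Rle_trans with (k * / k); [apply Rmult_le_compat_l; lra|].
    right; field; lra. }
  replace (f (z + h)%C) with (f z + u)%C by (unfold u; ring). rewrite Cexp_add.
  replace (Cexp (f z) * Cexp u - Cexp (f z) - Cexp (f z) * df z * h)%C
    with (Cexp (f z) * (Cexp u - 1 - u) + Cexp (f z) * rf)%C by (unfold rf, u; ring).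
  eapply Rle_trans; [apply Cmod_triangle|]. rewrite !Cmod_mult, Cmod_Cexp. fold E.
  assert (A1 : E * Cmod (Cexp u - 1 - u) <= e / 2 * Cmod h).
  { apply Rle_trans with (E * ((k * Cmod h) ^ 2 * exp 1)).
    - apply Rmult_le_compat_l; [lra|]. eapply Rle_trans; [apply Cmod_Cexp_sub2|].
      apply Rmult_le_compat; [apply pow2_ge_0|left; apply exp_pos| |now apply exp_le].
      apply pow_incr. split; [apply Cmod_ge_0|easy].
    - rewrite Rpow_mult_distr.
      replace (E * (k ^ 2 * Cmod h ^ 2 * exp 1)) with (E * (k ^ 2 * exp 1) * Cmod h * Cmod h) by ring.
      apply Rmult_le_compat_r; [easy|]. apply Rle_trans with (E * (k ^ 2 * exp 1) * q).
      + apply Rmult_le_compat_l; lra.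
      + right. unfold q. field. repeat split; try lra. apply Rgt_not_eq, exp_pos. }
  assert (A2 : E * Cmod rf <= e / 2 * Cmod h).
  { apply Rle_trans with (E * (e / 2 / E * Cmod h)).
    - apply Rmult_le_compat_l; [lra|]. eapply Rle_trans; [exact H1|]. apply Rmult_le_compat_r; lra.
    - right. field. lra. }
  lra.
Qed.

(** The gradient estimate consumes three successive derivatives; this predicate supplies them for
    iterates without explicit formulas. *)
Fixpoint Ck (n : nat) (f : C -> C) : Prop :=
  match n with O => True | S m => exists df, Cdiff f df /\ Ck m df end.

Lemma Ck_weaken (n : nat) (f : C -> C) : Ck (S n) f -> Ck n f.
Proof.
  revert f. induction n as [|n IH]; intros f (df & Hf & Hdf); [easy|].
  exists df. split; [easy|]. now apply IH.
Qed.

Lemma Ck_const (n : nat) (a : C) : Ck n (fun _ => a).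
Proof.
  revert a. induction n as [|n IH]; intros a; [easy|]. exists (fun _ => 0).
  split; [apply Cdiff_const|apply IH].
Qed.

Lemma Ck_id (n : nat) : Ck n (fun z => z).
Proof.
  destruct n; [easy|]. exists (fun _ => 1). split; [apply Cdiff_id|apply Ck_const].
Qed.

Lemma Ck_add (n : nat) (f g : C -> C) : Ck n f -> Ck n g -> Ck n (fun z => f z + g z)%C.
Proof.
  revert f g. induction n as [|n IH]; intros f g; [easy|]. intros (df & Hf & Hdf) (dg & Hg & Hdg).
  exists (fun z => df z + dg z)%C. split; [now apply Cdiff_add|now apply IH].
Qed.

Lemma Ck_mul (n : nat) (f g : C -> C) : Ck n f -> Ck n g -> Ck n (fun z => f z * g z)%C.
Proof.
  revert f g. induction n as [|n IH]; intros f g; [easy|]. intros Hf Hg.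
  pose proof (Ck_weaken n f Hf). pose proof (Ck_weaken n g Hg).
  destruct Hf as (df & Hf & Hdf), Hg as (dg & Hg & Hdg).
  exists (fun z => df z * g z + f z * dg z)%C. split; [now apply Cdiff_mul|].
  apply Ck_add; now apply IH.
Qed.

Lemma Ck_Cexp (n : nat) (f : C -> C) : Ck n f -> Ck n (fun z => Cexp (f z)).
Proof.
  revert f. induction n as [|n IH]; intros f; [easy|]. intros Hf.
  pose proof (Ck_weaken n f Hf). destruct Hf as (df & Hf & Hdf).
  exists (fun z => Cexp (f z) * df z)%C. split; [now apply Cdiff_Cexp|].
  apply Ck_mul; [now apply IH|easy].
Qed.

(** An estimate of Borel-Caratheodory type: the real part of A - f is nonnegative on the disc. *)
Lemma deriv_le_of_Re_le (f df : C -> C) (z : C) (s A : R) :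
  Cdiff f df -> Ck 2 df -> 0 < s -> (forall w, Cmod (w - z) <= s -> Re (f w) <= A) ->
  s * Cmod (df z) <= 2 * (A - Re (f z)).
Proof.
  intros Hf (ddf & Hdf & d3f & Hddf & _) Hs HA.
  assert (Hm : forall g dg, Cdiff g dg -> Cdiff (fun w => RtoC (-1) * g w)%C (fun w => RtoC (-1) * dg w)%C).
  { intros g dg Hg w e He. destruct (Hg w e He) as (d & Hd & H). exists d. split; [easy|].
    intros h Hh. specialize (H h Hh).
    replace (RtoC (-1) * g (w + h)%C - RtoC (-1) * g w - RtoC (-1) * dg w * h)%C
      with (- (g (w + h)%C - g w - dg w * h))%C by (cext; ring). now rewrite Cmod_opp. }
  assert (Hc : Cdiff (fun w => RtoC A + RtoC (-1) * f w)%C (fun w => RtoC (-1) * df w)%C).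
  { intros w e He. destruct (Hm f df Hf w e He) as (d & Hd & H). exists d. split; [easy|].
    intros h Hh. specialize (H h Hh).
    now replace (RtoC A + RtoC (-1) * f (w + h)%C - (RtoC A + RtoC (-1) * f w) - RtoC (-1) * df w * h)%C
      with (RtoC (-1) * f (w + h)%C - RtoC (-1) * f w - RtoC (-1) * df w * h)%C by ring. }
  pose proof (deriv_le_of_Re_nonneg _ _ _ _ z s Hc (Hm _ _ Hdf) (Hm _ _ Hddf) Hs) as H.
  assert (Hp : forall w, Cmod (w - z) <= s -> 0 <= Re (RtoC A + RtoC (-1) * f w)).
  { intros w Hw. rewrite Re_add, Re_scal, Re_RtoC. specialize (HA w Hw). lra. }
  specialize (H Hp). cbv beta in H. rewrite Cmod_scal, Re_add, Re_scal, Re_RtoC in H.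
  replace (Rabs (-1)) with 1 in H by (rewrite Rabs_left; lra). lra.
Qed.

(** With a = 0 this is a Lipschitz bound; with a = f'(x) it yields a lower bound on |f y - f x|. *)
Lemma mean_value_le (f df : C -> C) (x y a : C) (k : R) : Cdiff f df ->
  (forall s, 0 <= s <= 1 -> Cmod (df (x + RtoC s * (y - x)) - a) <= k)%C ->
  Cmod (f y - f x - a * (y - x)) <= k * Cmod (y - x).
Proof.
  intros Hf Hk. remember (f y - f x - a * (y - x))%C as d eqn:Ed.
  assert (Hk0 : 0 <= k).
  { eapply Rle_trans; [apply Cmod_ge_0|]. apply (Hk 0). lra. }
  destruct (Req_dec (Cmod d) 0) as [E|E].
  { rewrite E. apply Rmult_le_pos; [easy|apply Cmod_ge_0]. }
  assert (Hd : 0 < Cmod d) by (pose proof (Cmod_ge_0 d); lra).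
  set (c := fun s => (x + RtoC s * (y - x))%C).
  assert (Haff : forall a b s : R, is_derive (fun s => a + s * b) s b).
  { intros. auto_derive; [easy|ring]. }
  assert (Hc : forall s, curve_deriv c s (y - x)).
  { intros s. split; unfold c.
    - apply is_derive_ext with (fun s => Re x + s * Re (y - x)); [intros u; now autorewrite with cplx|].
      apply Haff.
    - apply is_derive_ext with (fun s => Im x + s * Im (y - x)); [intros u; now autorewrite with cplx|].
      apply Haff. }
  set (g := fun s => Re d * (Re (f (c s)) - s * Re (a * (y - x))) + Im d * (Im (f (c s)) - s * Im (a * (y - x)))).
  set (dg := fun s => Re (Cconj d * ((df (c s) - a) * (y - x)))%C).
  assert (Hlin : forall (p q : R -> R) (p' q' A B D1 D2 s : R), is_derive p s p' -> is_derive q s q' ->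
    is_derive (fun s => D1 * (p s - s * A) + D2 * (q s - s * B)) s (D1 * (p' - A) + D2 * (q' - B))).
  { intros p q p' q' A B D1 D2 s Hp Hq.
    assert (HA : forall A, is_derive (fun s => s * A) s A) by (intros; auto_derive; [easy|ring]).
    apply (is_derive_plus (V := R_NormedModule));
      apply is_derive_scal;
      apply (is_derive_minus (V := R_NormedModule)); auto. }
  assert (Hg : forall s, is_derive g s (dg s)).
  { intros s. destruct (curve_deriv_comp f df c s _ Hf (Hc s)) as [H1 H2].
    replace (dg s) with (Re d * (Re (df (c s) * (y - x)) - Re (a * (y - x)))
                         + Im d * (Im (df (c s) * (y - x)) - Im (a * (y - x))))
      by (unfold dg; autorewrite with cplx; ring).
    now apply (Hlin (fun s => Re (f (c s))) (fun s => Im (f (c s)))). }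
  destruct (MVT_gen g 0 1 dg) as (s & Hs & Hh).
  { intros s _. apply Hg. }
  { intros s _. apply ex_derive_continuity_pt. exists (dg s). apply Hg. }
  rewrite Rmin_left, Rmax_right in Hs by lra.
  assert (E1 : g 1 - g 0 = Cmod d ^ 2).
  { unfold g, c. replace (x + RtoC 1 * (y - x))%C with y by ring.
    replace (x + RtoC 0 * (y - x))%C with x by ring.
    rewrite Cmod_sqr, Ed. autorewrite with cplx. ring. }
  assert (E2 : dg s <= Cmod d * (k * Cmod (y - x))).
  { unfold dg. eapply Rle_trans; [apply Rle_abs|]. eapply Rle_trans; [apply re_le_Cmod|].
    rewrite !Cmod_mult, Cmod_conj. apply Rmult_le_compat_l; [apply Cmod_ge_0|].
    apply Rmult_le_compat_r; [apply Cmod_ge_0|]. now apply Hk. }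
  rewrite Rminus_0_r, Rmult_1_r in Hh. nra.
Qed.

(** * Infinite pigeonhole *)

Definition infinite (P : nat -> Prop) : Prop := forall n, exists m, (n <= m)%nat /\ P m.

Lemma infinite_or (P Q : nat -> Prop) : infinite (fun n => P n \/ Q n) -> infinite P \/ infinite Q.
Proof.
  intros H. destruct (Classical_Prop.classic (infinite P)) as [HP|HP]; [now left|right].
  apply Classical_Pred_Type.not_all_ex_not in HP. destruct HP as [n0 Hn0].
  intros n. destruct (H (max n n0)) as (m & Hm & [HPm|HQm]).
  - exfalso. apply Hn0. exists m. split; [lia|easy].
  - exists m. split; [lia|easy].
Qed.

Lemma pigeonhole_R (P : nat -> Prop) (u : nat -> R) (M e : R) : infinite P -> 0 < e ->
  (forall n, Rabs (u n) <= M) ->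
  exists Q, infinite Q /\ (forall n, Q n -> P n) /\ forall n m, Q n -> Q m -> Rabs (u n - u m) <= e.
Proof.
  intros HP He HM.
  assert (Hind : forall (N : nat) (P : nat -> Prop) a, infinite P ->
    (forall n, P n -> a <= u n <= a + INR N * e) ->
    exists Q, infinite Q /\ (forall n, Q n -> P n) /\ forall n m, Q n -> Q m -> Rabs (u n - u m) <= e).
  { induction N as [|N IH]; intros P' a HP' Ha.
    - exists P'. split; [easy|]. split; [easy|]. intros n m Hn Hm.
      apply Ha in Hn, Hm. simpl in Hn, Hm. apply Rabs_le; lra.
    - destruct (infinite_or (fun n => P' n /\ u n <= a + e) (fun n => P' n /\ a + e <= u n)) as [H|H].
      + intros n. destruct (HP' n) as (m & Hm & HPm). exists m. split; [easy|].
        destruct (Rle_lt_dec (u m) (a + e)); [left|right]; split; try easy; lra.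
      + exists (fun n => P' n /\ u n <= a + e). split; [easy|]. split; [now intros n []|].
        intros n m [Hn Hn'] [Hm Hm']. apply Ha in Hn, Hm. apply Rabs_le; lra.
      + destruct (IH _ (a + e) H) as (Q & HQ & HQP & Hclose).
        * intros n [Hn Hn']. apply Ha in Hn. rewrite S_INR in Hn. lra.
        * exists Q. split; [easy|]. split; [|easy]. intros n Hn. now apply HQP. }
  destruct (INR_archimed e (2 * M)) as [N HN]; [easy|].
  apply (Hind N P (- M) HP). intros n _. specialize (HM n). apply Rabs_le_between in HM. lra.
Qed.

Lemma pigeonhole_C (N : nat) (u : nat -> nat -> C) (M e : R) : 0 < e ->
  (forall i n, (i < N)%nat -> Cmod (u i n) <= M) ->
  exists Q, infinite Q /\ forall n m i, (i < N)%nat -> Q n -> Q m -> Cmod (u i n - u i m) <= e.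
Proof.
  intros He HM. induction N as [|N IH].
  - exists (fun _ => True). split; [intros n; now exists n|lia].
  - destruct IH as (Q & HQ & Hclose); [intros; apply HM; lia|].
    assert (HMN : forall n, Cmod (u N n) <= M) by (intros; apply HM; lia).
    destruct (pigeonhole_R Q (fun n => Re (u N n)) M (e / 2) HQ) as (Q1 & HQ1 & HQ1' & H1); [lra| |].
    { intros n. eapply Rle_trans; [apply re_le_Cmod|apply HMN]. }
    destruct (pigeonhole_R Q1 (fun n => Im (u N n)) M (e / 2) HQ1) as (Q2 & HQ2 & HQ2' & H2); [lra| |].
    { intros n. eapply Rle_trans; [apply im_le_Cmod|apply HMN]. }
    exists Q2. split; [easy|]. intros n m i Hi Hn Hm.
    destruct (Nat.eq_dec i N) as [->|Hne].
    + eapply Rle_trans; [apply Cmod_le_abs|]. rewrite Re_sub, Im_sub.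
      specialize (H1 n m (HQ2' n Hn) (HQ2' m Hm)). specialize (H2 n m Hn Hm). lra.
    + apply Hclose; [lia| |]; auto.
Qed.

(** * No bounded invariant set at an indifferent parameter *)

Fixpoint iter_emap (L : C) (n : nat) (z : C) : C :=
  match n with O => z | S m => emap L (iter_emap L m z) end.

(* A logarithm of the derivative of [iter_emap], where [Cexp l = - L]. *)
Fixpoint log_deriv (l L : C) (n : nat) (z : C) : C :=
  match n with O => RtoC 0 | S m => (log_deriv l L m z + (l + RtoC (-1) * iter_emap L m z))%C end.

Fixpoint dlog_deriv (l L : C) (n : nat) (z : C) : C :=
  match n with
  | O => RtoC 0
  | S m => (dlog_deriv l L m z
            + (0 + (0 * iter_emap L m z + RtoC (-1) * Cexp (log_deriv l L m z))))%C
  end.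

Lemma iter_emap_add (L : C) (n m : nat) (z : C) :
  iter_emap L n (iter_emap L m z) = iter_emap L (n + m) z.
Proof. induction n as [|n IH]; [easy|]. simpl. now rewrite IH. Qed.

Lemma iter_emap_deriv (l L : C) (n : nat) : Cexp l = (- L)%C ->
  Cdiff (iter_emap L n) (fun z => Cexp (log_deriv l L n z)).
Proof.
  intros Hl. induction n as [|n IH].
  - simpl. intros z e He. destruct (Cdiff_id z e He) as (d & Hd & H). exists d. split; [easy|].
    intros h Hh. rewrite Cexp_0. now apply H.
  - pose proof (Cdiff_mul _ _ _ _ (Cdiff_const L)
      (Cdiff_Cexp _ _ (Cdiff_mul _ _ _ _ (Cdiff_const (RtoC (-1))) IH))) as H.
    intros z e He. destruct (H z e He) as (d & Hd & H'). exists d. split; [easy|].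
    intros h Hh. specialize (H' h Hh). simpl. unfold emap.
    assert (Hop : forall w : C, (RtoC (-1) * w)%C = (- w)%C) by (intros; cext; ring).
    rewrite !Hop in H'. rewrite !Cexp_add, Hl, Hop.
    replace (Cexp (log_deriv l L n z) * (- L * Cexp (- iter_emap L n z)))%C
      with (0 * Cexp (- iter_emap L n z) + L * (Cexp (- iter_emap L n z) *
             (0 * iter_emap L n z + - Cexp (log_deriv l L n z))))%C; [exact H'|]. ring.
Qed.

Lemma log_deriv_deriv (l L : C) (n : nat) : Cexp l = (- L)%C ->
  Cdiff (log_deriv l L n) (dlog_deriv l L n).
Proof.
  intros Hl. induction n as [|n IH]; [apply Cdiff_const|]. simpl.
  apply Cdiff_add; [easy|]. apply Cdiff_add; [apply Cdiff_const|].
  apply Cdiff_mul; [apply Cdiff_const|]. now apply iter_emap_deriv.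
Qed.

Lemma Ck_emap (k : nat) (L : C) (f : C -> C) : Ck k f -> Ck k (fun z => emap L (f z)).
Proof.
  intros Hf. unfold emap. apply Ck_mul; [apply Ck_const|]. apply Ck_Cexp.
  assert (H : Ck k (fun z => RtoC (-1) * f z)%C) by (apply Ck_mul; [apply Ck_const|easy]).
  assert (Hext : forall k (f g : C -> C), (forall z, f z = g z) -> Ck k f -> Ck k g).
  { clear. induction k as [|k IH]; [easy|]. intros f g Hfg (df & Hf & Hdf). exists df. split; [|easy].
    intros z e He. destruct (Hf z e He) as (d & Hd & H). exists d. split; [easy|].
    intros h Hh. rewrite <- !Hfg. now apply H. }
  apply (Hext k (fun z => RtoC (-1) * f z)%C); [|easy]. intros z. cext; ring.
Qed.

Lemma Ck_iter_emap (k : nat) (L : C) (n : nat) : Ck k (iter_emap L n).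
Proof.
  induction n as [|n IH]; [apply Ck_id|]. apply (Ck_emap k L _ IH).
Qed.

Lemma Ck_log_deriv (k : nat) (l L : C) (n : nat) : Ck k (log_deriv l L n).
Proof.
  induction n as [|n IH]; [exact (Ck_const k 0)|]. simpl. apply Ck_add; [easy|].
  apply Ck_add; [apply Ck_const|]. apply Ck_mul; [apply Ck_const|]. apply Ck_iter_emap.
Qed.

Lemma Ck_dlog_deriv (k : nat) (l L : C) (n : nat) : Ck k (dlog_deriv l L n).
Proof.
  induction n as [|n IH]; [exact (Ck_const k 0)|]. simpl. apply Ck_add; [easy|].
  apply Ck_add; [apply Ck_const|]. apply Ck_add.
  - apply Ck_mul; [apply Ck_const|]. apply Ck_iter_emap.
  - apply Ck_mul; [apply Ck_const|]. apply Ck_Cexp, Ck_log_deriv.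
Qed.

(** With d = 0 this is the segment from t p to p itself. *)
Definition tube (p : C) (t d : R) (w : C) : Prop :=
  exists s, t <= s <= 1 /\ Cmod (w - RtoC s * p) <= d.

Lemma tube_convex (p : C) (t d : R) : convex (tube p t d).
Proof.
  intros x y u (s & Hs & Hx) (s' & Hs' & Hy) Hu. exists (s + u * (s' - s)).
  split; [split; nra|].
  replace (x + RtoC u * (y - x) - RtoC (s + u * (s' - s)) * p)%C
    with (RtoC (1 - u) * (x - RtoC s * p) + RtoC u * (y - RtoC s' * p))%C by (cext; ring).
  eapply Rle_trans; [apply Cmod_triangle|]. rewrite !Cmod_scal, !Rabs_pos_eq by lra. nra.
Qed.

Lemma tube_ball (p : C) (t d d' : R) (x y : C) :
  tube p t d x -> Cmod (y - x) <= d' -> tube p t (d + d') y.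
Proof.
  intros (s & Hs & Hx) Hy. exists s. split; [easy|].
  pose proof (Cmod_triangle3 y x (RtoC s * p)). lra.
Qed.

Lemma tube_le (p : C) (t d d' : R) (x : C) : d <= d' -> tube p t d x -> tube p t d' x.
Proof. intros Hd (s & Hs & Hx). exists s. split; [easy|lra]. Qed.

(* Distortion of all iterates on a tube around a segment issued from an
   indifferent fixed point: [(f^n)'] never vanishes, and the Harnack
   inequality for [log |(f^n)'|] propagates the value [1] at [p]. *)
Lemma iter_distortion (l L p : C) (t rho M : R) (K : C -> Prop) :
  Cexp l = (- L)%C -> emap L p = p -> Cmod p = 1 -> Re l = Re p ->
  0 < t <= 1 -> 0 < rho <= 1 ->
  (forall w, tube p t rho w -> K w) -> (forall w, K w -> K (emap L w)) -> bounded_by M K ->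
  exists C1 c1 r0, 0 < C1 /\ 0 < c1 /\ 0 < r0 <= rho / 4 /\
    (forall n x y, tube p t (rho / 2) x -> tube p t (rho / 2) y ->
       Cmod (iter_emap L n y - iter_emap L n x) <= C1 * Cmod (y - x)) /\
    (forall n x y, tube p t 0 x -> Cmod (y - x) <= r0 ->
       c1 * Cmod (y - x) <= Cmod (iter_emap L n y - iter_emap L n x)).
Proof.
  intros Hl Hp Hp1 Hlp Ht Hrho HtK HK HM.
  assert (Hdf := fun n => iter_emap_deriv l L n Hl).
  assert (Hdl := fun n => log_deriv_deriv l L n Hl).
  assert (HitK : forall n w, K w -> K (iter_emap L n w)).
  { induction n as [|n IH]; intros w Hw; [easy|]. simpl. auto. }
  assert (HpK : K p).
  { apply HtK. exists 1. split; [lra|]. replace (p - 1 * p)%C with (RtoC 0) by ring. rewrite Cmod_0. lra. }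
  assert (HM0 : 1 <= M) by (rewrite <- Hp1; now apply HM).
  set (C1 := 8 * M / rho). assert (HC1 : 0 < C1) by (unfold C1; apply Rdiv_lt_0_compat; lra).
  set (A := ln C1).
  (* On the disc of radius rho / 2 around w the real part of f^n lies in [-M, M], so |(f^n)'(w)| <=
     2 (2 M) / (rho / 2), which is C1. *)
  assert (Hexp : forall n w, tube p t (rho / 2) w -> exp (Re (log_deriv l L n w)) <= C1).
  { intros n w Hw.
    assert (Hb := deriv_le_of_Re_le _ _ w (rho / 2) M (Hdf n) (Ck_Cexp 2 _ (Ck_log_deriv 2 l L n))).
    cbv beta in Hb. rewrite Cmod_Cexp in Hb.
    assert (HRe : forall v, K v -> Rabs (Re (iter_emap L n v)) <= M).
    { intros v Hv. eapply Rle_trans; [apply re_le_Cmod|]. apply HM. now apply HitK. }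
    assert (H4 : rho / 2 * exp (Re (log_deriv l L n w)) <= 4 * M).
    { eapply Rle_trans; [apply Hb; [lra|]|].
      - intros v Hv. eapply Rle_trans; [apply Rle_abs|]. apply HRe, HtK.
        replace rho with (rho / 2 + rho / 2) by field. now apply (tube_ball p t _ _ w).
      - assert (Hw' : K w) by (apply HtK, (tube_le p t (rho / 2)); [lra|easy]).
        specialize (HRe w Hw'). apply Rabs_le_between in HRe. lra. }
    apply Rmult_le_reg_l with (rho / 2); [lra|]. eapply Rle_trans; [exact H4|].
    right. unfold C1. field. lra. }
  assert (HA : forall n w, tube p t (rho / 2) w -> Re (log_deriv l L n w) <= A).
  { intros n w Hw. unfold A. rewrite <- (ln_exp (Re (log_deriv l L n w))).
    destruct (Hexp n w Hw) as [H|H]; [left; now apply ln_increasing; [apply exp_pos|]|rewrite H; lra]. }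
  assert (Hitp : forall n, iter_emap L n p = p).
  { induction n as [|n IH]; [easy|]. simpl. now rewrite IH. }
  assert (Hlp0 : forall n, Re (log_deriv l L n p) = 0).
  { induction n as [|n IH]; [easy|]. cbn [log_deriv]. autorewrite with cplx. rewrite IH, Hitp, Hlp. ring. }
  assert (Hpt : tube p t (rho / 4) p).
  { exists 1. split; [lra|]. replace (p - 1 * p)%C with (RtoC 0) by ring. rewrite Cmod_0. lra. }
  assert (HA0 : 0 <= A).
  { rewrite <- (Hlp0 0%nat). apply HA. apply (tube_le p t (rho / 4)); [lra|easy]. }
  assert (Hgrad : forall n w, tube p t (rho / 4) w ->
     rho / 4 * Cmod (dlog_deriv l L n w) <= 2 * (A - Re (log_deriv l L n w))).
  { intros n w Hw. apply (deriv_le_of_Re_le _ _ w (rho / 4) A (Hdl n) (Ck_dlog_deriv 2 l L n)); [lra|].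
    intros v Hv. apply HA. replace (rho / 2) with (rho / 4 + rho / 4) by field.
    now apply (tube_ball p t _ _ w). }
  (* Gronwall's inequality for v = A - log |(f^n)'| along the segment from p to y. Its length is at
     most 2 and the gradient of v is at most (8 / rho) v, whence the rate 16 / rho; at p one has v =
     A because the multiplier has modulus 1. *)
  set (k := 16 / rho). assert (Hk : 0 < k) by (unfold k; apply Rdiv_lt_0_compat; lra).
  assert (Hgron : forall n y, tube p t (rho / 4) y -> A - Re (log_deriv l L n y) <= A * exp k).
  { intros n y Hy.
    set (c := fun s => (p + RtoC s * (y - p))%C).
    assert (Hct : forall s, 0 <= s <= 1 -> tube p t (rho / 4) (c s)).
    { intros s Hs. now apply tube_convex. }
    assert (Hyp : Cmod (y - p) <= 2).
    { destruct Hy as (s & Hs & Hy). pose proof (Cmod_triangle3 y (RtoC s * p) p) as H3.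
      replace (RtoC s * p - p)%C with (RtoC (s - 1) * p)%C in H3 by (cext; ring).
      rewrite Cmod_scal, Hp1 in H3. rewrite Rabs_left1 in H3 by lra. lra. }
    set (v := fun s => A - Re (log_deriv l L n (c s))).
    set (dv := fun s => - Re (dlog_deriv l L n (c s) * (y - p))%C).
    assert (Hv : forall s, is_derive v s (dv s)).
    { intros s. assert (Hc : curve_deriv c s (y - p)).
      { assert (Haff : forall a b s : R, is_derive (fun s => a + s * b) s b)
          by (intros; auto_derive; [easy|ring]).
        split; unfold c.
        - apply is_derive_ext with (fun s => Re p + s * Re (y - p)); [intros u; now autorewrite with cplx|].
          apply Haff.
        - apply is_derive_ext with (fun s => Im p + s * Im (y - p)); [intros u; now autorewrite with cplx|].
          apply Haff. }
      destruct (curve_deriv_comp _ _ c s _ (Hdl n) Hc) as [H1 _].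
      replace (dv s) with (minus 0 (Re (dlog_deriv l L n (c s) * (y - p))))
        by (unfold dv, minus, plus, opp; simpl; ring).
      apply (is_derive_minus (V := R_NormedModule)); [|exact H1].
      apply (is_derive_const (K := R_AbsRing) (V := R_NormedModule)). }
    assert (Hdv : forall s, 0 <= s <= 1 -> dv s <= k * v s).
    { intros s Hs. specialize (Hgrad n (c s) (Hct s Hs)). fold (v s) in Hgrad.
      unfold dv. eapply Rle_trans; [apply Rle_abs|]. rewrite Rabs_Ropp.
      eapply Rle_trans; [apply re_le_Cmod|]. rewrite Cmod_mult.
      set (g := Cmod (dlog_deriv l L n (c s))) in *. assert (0 <= g) by apply Cmod_ge_0.
      apply Rle_trans with (g * 2); [now apply Rmult_le_compat_l|].
      apply Rmult_le_reg_l with (rho / 8); [lra|].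
      replace (rho / 8 * (k * v s)) with (2 * v s) by (unfold k; field; lra). lra. }
    assert (Hfin : - (v 0 * exp (- (k * 0))) <= - (v 1 * exp (- (k * 1)))).
    { apply (derive_nonneg_le (fun s => - (v s * exp (- (k * s))))
        (fun s => - (dv s * exp (- (k * s)) + v s * (- k * exp (- (k * s)))))); [lra| |].
      - intros s _. apply (is_derive_opp (fun s => v s * exp (- (k * s)))).
        apply (is_derive_mult v (fun s => exp (- (k * s))) s (dv s) (- k * exp (- (k * s)))).
        + apply Hv.
        + auto_derive; [easy|ring].
        + intros; apply Rmult_comm.
      - intros s Hs. specialize (Hdv s Hs). pose proof (exp_pos (- (k * s))). nra. }
    unfold v, c in Hfin. replace (p + 1 * (y - p))%C with y in Hfin by ring.
    replace (p + 0 * (y - p))%C with p in Hfin by ring.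
    rewrite Hlp0, Rmult_0_r, Ropp_0, exp_0, Rmult_1_r, exp_Ropp in Hfin.
    pose proof (exp_pos k). apply Rmult_le_reg_r with (/ exp k); [now apply Rinv_0_lt_compat|].
    rewrite Rmult_assoc, Rinv_r by lra. rewrite (Rmult_1_r k) in Hfin. lra. }
  set (B := 8 / rho * (A * exp k) + 1).
  assert (HB : 1 <= B).
  { unfold B. pose proof (exp_pos k). assert (0 <= 8 / rho * (A * exp k)); [|lra].
    apply Rmult_le_pos; [left; apply Rdiv_lt_0_compat; lra|]. apply Rmult_le_pos; lra. }
  assert (HdB : forall n w, tube p t (rho / 4) w -> Cmod (dlog_deriv l L n w) <= B).
  { intros n w Hw. pose proof (Hgrad n w Hw) as H1. pose proof (Hgron n w Hw) as H2.
    apply Rmult_le_reg_l with (rho / 4); [lra|]. eapply Rle_trans; [exact H1|].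
    unfold B. replace (rho / 4 * (8 / rho * (A * exp k) + 1)) with (2 * (A * exp k) + rho / 4) by (field; lra).
    lra. }
  (* The exponential bounds |(f^n)'| from below on the segment. Within distance r0 the logarithm of
     (f^n)' varies by at most r0 B <= 1/4, so (f^n)' changes by at most half its modulus; this costs
     the factor 2 in c1. *)
  set (c1 := exp (A - A * exp k) / 2).
  set (r0 := Rmin (rho / 4) (/ (4 * B))).
  assert (Hr0 : 0 < r0 <= rho / 4).
  { split; [apply Rmin_pos; [lra|apply Rinv_0_lt_compat; lra]|apply Rmin_l]. }
  exists C1, c1, r0. split; [easy|]. split; [unfold c1; pose proof (exp_pos (A - A * exp k)); lra|].
  split; [easy|]. split.
  - intros n x y Hx Hy.
    replace (iter_emap L n y - iter_emap L n x)%C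
      with (iter_emap L n y - iter_emap L n x - 0 * (y - x))%C by ring.
    apply (mean_value_le _ _ x y 0 C1 (Hdf n)). intros s Hs.
    replace (Cexp (log_deriv l L n (x + RtoC s * (y - x))%C) - 0)%C
      with (Cexp (log_deriv l L n (x + RtoC s * (y - x))%C)) by ring.
    rewrite Cmod_Cexp. apply Hexp. now apply tube_convex.
  - intros n x y Hx Hyx. pose proof (Cmod_ge_0 (y - x)) as Hyx0.
    assert (Hr0B : r0 * B <= 1 / 4).
    { apply Rle_trans with (/ (4 * B) * B); [apply Rmult_le_compat_r; [lra|apply Rmin_r]|].
      right. field. lra. }
    assert (Hseg : forall s, 0 <= s <= 1 -> tube p t (rho / 4) (x + RtoC s * (y - x))).
    { intros s Hs. replace (rho / 4) with (0 + rho / 4) by ring. apply (tube_ball p t _ _ x); [easy|].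
      replace (x + RtoC s * (y - x) - x)%C with (RtoC s * (y - x))%C by ring.
      rewrite Cmod_scal, Rabs_pos_eq by lra. nra. }
    set (a := Cexp (log_deriv l L n x)).
    assert (Ha : 2 * c1 <= Cmod a).
    { unfold a. rewrite Cmod_Cexp. unfold c1. replace (2 * (exp (A - A * exp k) / 2)) with (exp (A - A * exp k)) by field.
      apply exp_le. assert (Hxt : tube p t (rho / 4) x) by (apply (tube_le p t 0); [lra|easy]).
      specialize (Hgron n x Hxt). lra. }
    assert (Hmv : Cmod (iter_emap L n y - iter_emap L n x - a * (y - x)) <= Cmod a / 2 * Cmod (y - x)).
    { apply (mean_value_le _ _ x y a (Cmod a / 2) (Hdf n)). intros s Hs.
      set (w := (x + RtoC s * (y - x))%C).
      set (u := (log_deriv l L n w - log_deriv l L n x)%C).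
      assert (Hu : Cmod u <= 1 / 4).
      { replace u with (log_deriv l L n w - log_deriv l L n x - 0 * (w - x))%C by (unfold u; ring).
        eapply Rle_trans; [apply (mean_value_le _ _ x w 0 B (Hdl n))|].
        - intros s' Hs'. replace (x + RtoC s' * (w - x))%C with (x + RtoC (s' * s) * (y - x))%C
            by (unfold w; cext; ring).
          replace (dlog_deriv l L n (x + RtoC (s' * s) * (y - x))%C - 0)%C
            with (dlog_deriv l L n (x + RtoC (s' * s) * (y - x))%C) by ring.
          apply HdB, Hseg. split; nra.
        - replace (w - x)%C with (RtoC s * (y - x))%C by (unfold w; ring).
          rewrite Cmod_scal, Rabs_pos_eq by lra.
          assert (s * Cmod (y - x) <= r0) by nra. nra. }
      replace (Cexp (log_deriv l L n w) - a)%C with (a * (Cexp u - 1))%C.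
      2:{ unfold a. replace (log_deriv l L n w) with (log_deriv l L n x + u)%C by (unfold u; ring).
          rewrite Cexp_add. ring. }
      rewrite Cmod_mult. unfold Rdiv. apply Rmult_le_compat_l; [apply Cmod_ge_0|].
      eapply Rle_trans; [apply Cmod_Cexp_sub1|]. pose proof (Cmod_ge_0 u).
      assert (exp (Cmod u) <= 2).
      { assert (E : exp (1 / 4) * (1 - 1 / 4) <= 1).
        { pose proof (exp_ineq1_le (- (1 / 4))) as H1. rewrite exp_Ropp in H1.
          pose proof (exp_pos (1 / 4)).
          apply Rmult_le_compat_l with (r := exp (1 / 4)) in H1; [|lra].
          rewrite Rinv_r in H1 by lra. lra. }
        assert (exp (Cmod u) <= exp (1 / 4)) by now apply exp_le. lra. }
      nra. }
    pose proof (Cmod_triangle_sub (a * (y - x)) (iter_emap L n y - iter_emap L n x)) as Htr.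
    rewrite Cmod_mult in Htr. rewrite (Cmod_sub_sym (a * (y - x))) in Htr.
    assert (Cmod a * Cmod (y - x) <= Cmod (iter_emap L n y - iter_emap L n x) + Cmod a / 2 * Cmod (y - x)) by lra.
    assert (2 * c1 * Cmod (y - x) <= Cmod a * Cmod (y - x)) by (apply Rmult_le_compat_r; lra). lra.
Qed.

(** If f^(n+j) and f^n are close along the segment from p to t p, the lower distortion bound for f^n
    makes f^j close to the identity there, by continuation from p. At the end t p this is
    impossible, since t p is close to 0 and f is bounded away from 0 on [K]. *)
Lemma not_V_infty_indifferent (phi : R) : 0 < phi < PI ->
  ~ V_infty (polar (exp (cos phi)) (bdry_angle phi)).
Proof.
  intros Hphi HV. set (L := polar (exp (cos phi)) (bdry_angle phi)) in *.
  destruct (V_infty_inv L HV) as (K & M & HK & Hcl & HM).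
  set (p := polar 1 phi). pose proof (exp_pos (cos phi)) as Her.
  assert (Hp : emap L p = p).
  { unfold L. rewrite emap_polar. unfold p at 1 2. autorewrite with cplx. unfold p, bdry_angle.
    rewrite <- exp_plus, Rplus_opp_r, exp_0. f_equal. ring. }
  assert (Hp1 : Cmod p = 1) by (apply Cmod_polar_eq; lra).
  assert (HpK : K p) by now apply fixpt_in.
  destruct (fixpt_interior phi L K Hphi HK Hp HpK) as (e & He & Hball). fold p in Hball.
  set (l := (cos phi, bdry_angle phi + PI)).
  assert (Hl : Cexp l = (- L)%C).
  { unfold l, L. cext; rewrite ?cos_plus, ?sin_plus, cos_PI, sin_PI; ring. }
  assert (Hlp : Re l = Re p) by (unfold l, p; simpl; ring).
  assert (HLm : Cmod L = exp (cos phi)) by (apply Cmod_polar_eq; lra).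
  set (c0 := exp (cos phi) * exp (- M)).
  assert (Hc0 : 0 < c0) by (apply Rmult_lt_0_compat; apply exp_pos).
  assert (Haway : forall z, K z -> c0 <= Cmod (emap L z)).
  { intros z Hz. rewrite Cmod_emap, HLm. apply Rmult_le_compat_l; [lra|]. apply exp_le.
    apply HM in Hz. pose proof (re_le_Cmod z). pose proof (Rle_abs (Re z)). lra. }
  (* The bound c0 / 2 on t = |t p| leaves a margin of c0 / 2 below the lower bound c0 for values of
     f on [K]. *)
  set (t := Rmin (1 / 2) (c0 / 2)).
  assert (Ht : 0 < t <= 1 / 2 /\ t <= c0 / 2).
  { unfold t. pose proof (Rmin_l (1 / 2) (c0 / 2)). pose proof (Rmin_r (1 / 2) (c0 / 2)).
    split; [split; [apply Rmin_pos; lra|lra]|lra]. }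
  set (rho := Rmin 1 (t * (e / 2))).
  assert (Hrho : 0 < rho <= 1 /\ rho <= t * (e / 2)).
  { unfold rho. pose proof (Rmin_l 1 (t * (e / 2))). pose proof (Rmin_r 1 (t * (e / 2))).
    assert (0 < t * (e / 2)) by nra. split; [split; [apply Rmin_pos; lra|lra]|lra]. }
  (* The ball around p contained in [K], scaled by s in [t, 1], gives balls around s p of radius at
     least t e; these cover the tube. *)
  assert (Htube : forall w, tube p t rho w -> K w).
  { intros w (s & Hs & Hw). replace w with (RtoC s * (RtoC (/ s) * w))%C.
    2:{ cext; field; lra. }
    apply convex_scal; [apply HK|apply HK| |lra]. apply Hball.
    replace (RtoC (/ s) * w - p)%C with (RtoC (/ s) * (w - RtoC s * p))%C by (cext; field; lra).
    assert (His : 0 < / s) by (apply Rinv_0_lt_compat; lra).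
    rewrite Cmod_scal, Rabs_pos_eq by lra.
    apply Rle_lt_trans with (/ s * (s * (e / 2))).
    - apply Rmult_le_compat_l; [lra|]. apply Rle_trans with (t * (e / 2)); [lra|].
      apply Rmult_le_compat_r; lra.
    - rewrite <- Rmult_assoc, Rinv_l by lra. lra. }
  destruct (iter_distortion l L p t rho M K) as (C1 & c1 & r0 & HC1 & Hc1 & Hr0 & Hlip & Hexpand); auto; try lra.
  { apply HK. }
  assert (HitK : forall n w, K w -> K (iter_emap L n w)).
  { induction n as [|n IH]; intros w Hw; [easy|]. simpl. apply HK. auto. }
  assert (Hseg : forall s, t <= s <= 1 -> tube p t 0 (RtoC s * p)).
  { intros s Hs. exists s. split; [easy|].
    replace (RtoC s * p - RtoC s * p)%C with (RtoC 0) by ring. rewrite Cmod_0. lra. }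
  (* Then sg / c1 is at most r0 / 2, which keeps the continuation within the range of the lower
     distortion bound, and at most c0 / 4, which with t <= c0 / 2 contradicts |f| >= c0. *)
  set (sg := c1 * Rmin r0 (c0 / 2) / 2).
  assert (Hmin : 0 < Rmin r0 (c0 / 2)) by (apply Rmin_pos; lra).
  assert (Hsg : 0 < sg) by (unfold sg; nra).
  (* Two iterates that are close on a net, hence on the whole segment. *)
  assert (Hret : exists n j, (1 <= j)%nat /\ forall s, t <= s <= 1 ->
     Cmod (iter_emap L (n + j) (RtoC s * p) - iter_emap L n (RtoC s * p)) <= sg).
  (* The error sg has three parts of size sg / 3: two come from the Lipschitz constant C1 at
     distance 1 / N from the net, one from the pigeonhole principle on the net. *)
  { destruct (INR_archimed sg (3 * C1)) as [N HN]; [easy|].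
    assert (HN0 : 0 < INR N).
    { destruct (Rlt_le_dec 0 (INR N)); [easy|]. pose proof (pos_INR N). nra. }
    set (x := fun i => (RtoC (t + (1 - t) * (INR i / INR N)) * p)%C).
    assert (Hx : forall i, (i < S N)%nat -> t <= t + (1 - t) * (INR i / INR N) <= 1).
    { intros i Hi. assert (Hi' : INR i <= INR N) by (apply le_INR; lia). pose proof (pos_INR i).
      assert (0 <= INR i / INR N <= 1).
      { split; [apply Rmult_le_pos; [easy|left; now apply Rinv_0_lt_compat]|].
        apply Rmult_le_reg_r with (INR N); [easy|]. unfold Rdiv.
        rewrite Rmult_assoc, Rinv_l, Rmult_1_r by lra. lra. }
      nra. }
    destruct (pigeonhole_C (S N) (fun i n => iter_emap L n (x i)) M (sg / 3)) as (Q & HQ & Hclose); [lra| |].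
    { intros i n Hi. apply HM, HitK, Htube. apply (tube_le p t 0); [lra|]. apply Hseg, Hx, Hi. }
    destruct (HQ 0%nat) as (n & _ & Hn). destruct (HQ (S n)) as (m & Hm & HQm).
    exists n, (m - n)%nat. split; [lia|]. replace (n + (m - n))%nat with m by lia.
    intros s Hs.
    assert (Hi : exists i, (i < S N)%nat /\ Rabs (s - (t + (1 - t) * (INR i / INR N))) <= 1 / INR N).
    { assert (Hind : forall k, (k <= N)%nat -> s <= t + (1 - t) * (INR k / INR N) ->
        exists i, (i < S N)%nat /\ Rabs (s - (t + (1 - t) * (INR i / INR N))) <= 1 / INR N).
      { assert (Hp0 : 0 < / INR N) by now apply Rinv_0_lt_compat.
        induction k as [|k IH]; intros Hk Hsk.
        - exists 0%nat. split; [lia|]. simpl in *. unfold Rdiv in *. rewrite Rmult_0_l in *.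
          rewrite Rabs_left1 by lra. nra.
        - destruct (Rle_lt_dec s (t + (1 - t) * (INR k / INR N))) as [H|H]; [apply IH; [lia|easy]|].
          exists k. split; [lia|]. rewrite S_INR in Hsk. unfold Rdiv in *.
          rewrite Rabs_pos_eq by lra. nra. }
      apply (Hind N (le_n N)). unfold Rdiv. rewrite Rinv_r by lra. lra. }
    destruct Hi as (i & Hi & Hsi). set (si := t + (1 - t) * (INR i / INR N)) in *.
    assert (Hdist : Cmod (RtoC s * p - x i) <= 1 / INR N).
    { unfold x. fold si. replace (RtoC s * p - RtoC si * p)%C with (RtoC (s - si) * p)%C by (cext; ring).
      rewrite Cmod_scal, Hp1. lra. }
    assert (HC1N : C1 * (1 / INR N) <= sg / 3).
    { apply Rmult_le_reg_r with (INR N); [easy|]. unfold Rdiv. field_simplify; [|lra]. lra. }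
    assert (Hts : tube p t (rho / 2) (RtoC s * p)) by (apply (tube_le p t 0); [lra|now apply Hseg]).
    assert (Htx : tube p t (rho / 2) (x i)).
    { apply (tube_le p t 0); [lra|]. apply Hseg. now apply Hx. }
    assert (Hl1 : forall q, Cmod (iter_emap L q (RtoC s * p) - iter_emap L q (x i)) <= sg / 3).
    { intros q. eapply Rle_trans; [now apply Hlip|]. eapply Rle_trans; [|exact HC1N].
      apply Rmult_le_compat_l; lra. }
    pose proof (Hl1 m) as H1. pose proof (Hl1 n) as H2. rewrite Cmod_sub_sym in H2.
    pose proof (Hclose m n i Hi HQm Hn) as H3. cbv beta in H3.
    pose proof (Cmod_triangle3 (iter_emap L m (RtoC s * p)) (iter_emap L m (x i)) (iter_emap L n (RtoC s * p))).
    pose proof (Cmod_triangle3 (iter_emap L m (x i)) (iter_emap L n (x i)) (iter_emap L n (RtoC s * p))).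
    lra. }
  destruct Hret as (n & j & Hj & Hret).
  assert (Hsc : sg / c1 = Rmin r0 (c0 / 2) / 2) by (unfold sg; field; lra).
  pose proof (Rmin_l r0 (c0 / 2)) as Hm1. pose proof (Rmin_r r0 (c0 / 2)) as Hm2.
  assert (Hcont : Ccont (iter_emap L j)) by apply (Cdiff_cont _ _ (iter_emap_deriv l L j Hl)).
  assert (Hend : Cmod (iter_emap L j (RtoC (1 - (1 - t)) * p) - RtoC (1 - (1 - t)) * p) <= sg / c1).
  { apply (real_induction (fun u => Cmod (iter_emap L j (RtoC (1 - u) * p) - RtoC (1 - u) * p) <= sg / c1)
      0 (1 - t)); [lra| | |].
    - replace (RtoC (1 - 0) * p)%C with p by (cext; ring).
      assert (Hjp : iter_emap L j p = p).
      { clear - Hp. induction j as [|j IH]; [easy|]. simpl. now rewrite IH. }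
      rewrite Hjp. replace (p - p)%C with (RtoC 0) by ring. rewrite Cmod_0. lra.
    - intros x Hx Hlim. apply le_epsilon. intros d Hd.
      destruct (Hcont (RtoC (1 - x) * p)%C (d / 2)) as (d1 & Hd1 & H1); [lra|].
      destruct (Hlim (Rmin d1 (d / 2))) as (y & Hy & Hys & Hyx); [apply Rmin_pos; lra|].
      pose proof (Rmin_l d1 (d / 2)). pose proof (Rmin_r d1 (d / 2)).
      assert (Hyx' : Cmod (RtoC (1 - y) * p - RtoC (1 - x) * p) = Rabs (y - x)).
      { replace (RtoC (1 - y) * p - RtoC (1 - x) * p)%C with (RtoC (- (y - x)) * p)%C by (cext; ring).
        rewrite Cmod_scal, Hp1, Rabs_Ropp. ring. }
      specialize (H1 (RtoC (1 - y) * p)%C ltac:(lra)). rewrite Cmod_sub_sym in H1.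
      set (fx := iter_emap L j (RtoC (1 - x) * p)) in *. set (fy := iter_emap L j (RtoC (1 - y) * p)) in *.
      set (zx := (RtoC (1 - x) * p)%C) in *. set (zy := (RtoC (1 - y) * p)%C) in *.
      pose proof (Cmod_triangle3 fx fy zx). pose proof (Cmod_triangle3 fy zy zx). lra.
    (* Closeness up to sg / c1 at x gives closeness up to r0 at nearby y by continuity; there the
       lower bound for f^n applies and improves it to sg / c1 again. *)
    - intros x Hx HSx.
      destruct (Hcont (RtoC (1 - x) * p)%C (r0 / 4)) as (d1 & Hd1 & H1); [lra|].
      set (d := Rmin (d1 / 2) (r0 / 4)).
      assert (Hd : 0 < d /\ d <= d1 / 2 /\ d <= r0 / 4).
      { unfold d. pose proof (Rmin_l (d1 / 2) (r0 / 4)). pose proof (Rmin_r (d1 / 2) (r0 / 4)).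
        split; [apply Rmin_pos; lra|lra]. }
      exists d. split; [easy|]. intros y Hy Hyt.
      assert (Hyx' : Cmod (RtoC (1 - y) * p - RtoC (1 - x) * p) = y - x).
      { replace (RtoC (1 - y) * p - RtoC (1 - x) * p)%C with (RtoC (- (y - x)) * p)%C by (cext; ring).
        rewrite Cmod_scal, Hp1, Rabs_Ropp, Rabs_pos_eq by lra. ring. }
      specialize (H1 (RtoC (1 - y) * p)%C ltac:(lra)).
      assert (Hty : tube p t 0 (RtoC (1 - y) * p)) by (apply Hseg; lra).
      assert (Hclose : Cmod (iter_emap L j (RtoC (1 - y) * p) - RtoC (1 - y) * p) <= r0).
      { set (fx := iter_emap L j (RtoC (1 - x) * p)) in *. set (fy := iter_emap L j (RtoC (1 - y) * p)) in *.
        set (zx := (RtoC (1 - x) * p)%C) in *. set (zy := (RtoC (1 - y) * p)%C) in *.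
        pose proof (Cmod_triangle3 fy fx zy). pose proof (Cmod_triangle3 fx zx zy).
        rewrite (Cmod_sub_sym zx zy) in *. lra. }
      pose proof (Hexpand n _ _ Hty Hclose) as Hex. rewrite iter_emap_add in Hex.
      specialize (Hret (1 - y) ltac:(lra)).
      apply Rmult_le_reg_l with c1; [easy|]. replace (c1 * (sg / c1)) with sg by (field; lra). lra. }
  replace (1 - (1 - t)) with t in Hend by ring.
  (* As j >= 1, the point f^j (t p) is a value of f on [K]. *)
  destruct j as [|j]; [lia|]. simpl in Hend.
  assert (HKj : K (iter_emap L j (RtoC t * p))).
  { apply HitK, Htube. apply (tube_le p t 0); [lra|]. apply Hseg; lra. }
  pose proof (Haway _ HKj) as Hbig.
  pose proof (Cmod_triangle_sub (emap L (iter_emap L j (RtoC t * p))) (RtoC t * p)) as Htr.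
  rewrite Cmod_scal, Hp1, Rabs_pos_eq in Htr by lra. lra.
Qed.

(** * The boundary of [C_infty] *)

(** The parameter for which p is a fixed point of [emap]. The multiplier there is -p, so [C_infty]
    consists of the parameters with an attracting fixed point. *)
Definition lambert (p : C) : C := (p * Cexp p)%C.

Lemma C_infty_lambert (z : C) : C_infty z <-> exists p, Cmod p < 1 /\ z = lambert p.
Proof.
  split.
  - intros (u & Hu & ->). exists (- u)%C. rewrite Cmod_opp. easy.
  - intros (p & Hp & ->). exists (- p)%C. rewrite Cmod_opp. split; [easy|].
    unfold lambert. now replace (- - p)%C with p by ring.
Qed.

Lemma lambert_cont : Ccont lambert.
Proof.
  apply (Cdiff_cont _ _ (Cdiff_mul _ _ _ _ Cdiff_id (Cdiff_Cexp _ _ Cdiff_id))).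
Qed.

Lemma emap_lambert (p : C) : emap (lambert p) p = p.
Proof.
  unfold emap, lambert. rewrite <- Cmult_assoc, <- Cexp_add.
  replace (p + - p)%C with (RtoC 0) by ring. rewrite Cexp_0. ring.
Qed.

Lemma lambert_of_fixed (L p : C) : emap L p = p -> L = lambert p.
Proof.
  intros H. unfold lambert. rewrite <- H at 1. unfold emap.
  rewrite <- Cmult_assoc, <- Cexp_add. replace (- p + p)%C with (RtoC 0) by ring.
  rewrite Cexp_0. ring.
Qed.

(** Compactness of the closed disc. If z is not a value of [lambert] on it, the distance of the
    values to z is bounded below near each of its points; this gives a gauge on a square, with
    points outside the disc kept away from it, and a common lower bound for the gauge. *)
Lemma closure_C_infty (z : C) :
  (forall e, 0 < e -> exists w, C_infty w /\ Cmod (w - z) < e) ->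
  exists p, Cmod p <= 1 /\ z = lambert p.
Proof.
  intros Hz.
  destruct (Classical_Prop.classic (exists p, Cmod p <= 1 /\ z = lambert p)) as [H|H]; [easy|exfalso].
  assert (Hloc : forall q : R * R, exists d : posreal, forall w : C, Cmod w <= 1 ->
    Cmod (w - q)%C < 2 * d -> d <= Cmod (lambert w - z)%C).
  { intros q. destruct (Rle_lt_dec (Cmod q) 1) as [Hq|Hq].
    - set (e := Cmod (lambert q - z)).
      assert (He : 0 < e).
      { pose proof (Cmod_ge_0 (lambert q - z)) as H0. fold e in H0.
        destruct H0 as [H0|H0]; [easy|exfalso].
        apply H. exists q. split; [easy|]. symmetry in H0. apply Cmod_eq_0 in H0.
        replace z with (lambert q - (lambert q - z))%C by ring. rewrite H0. ring. }
      destruct (lambert_cont q (e / 2)) as (d & Hd & Hc); [lra|].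
      assert (Hm : 0 < Rmin (d / 2) (e / 2)) by (apply Rmin_pos; lra).
      exists (mkposreal _ Hm). simpl. intros w _ Hw.
      pose proof (Rmin_l (d / 2) (e / 2)). pose proof (Rmin_r (d / 2) (e / 2)).
      specialize (Hc w ltac:(lra)). rewrite Cmod_sub_sym in Hc.
      pose proof (Cmod_triangle3 (lambert q) (lambert w) z) as H3. fold e in H3. lra.
    - assert (Hm : 0 < (Cmod q - 1) / 2) by lra.
      exists (mkposreal _ Hm). simpl. intros w Hw Hwq. exfalso.
      pose proof (Cmod_triangle_sub q w) as H3. rewrite Cmod_sub_sym in H3. lra. }
  destruct (ClassicalChoice.choice _ Hloc) as [dl Hdl].
  destruct (compactness_value_2d (-1) 1 (-1) 1 (fun x y => dl (x, y))) as [d Hd].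
  destruct (Hz d (cond_pos d)) as (w & Hw & Hwz). apply C_infty_lambert in Hw.
  destruct Hw as (p & Hp & ->).
  pose proof (re_le_Cmod p) as Hre. pose proof (im_le_Cmod p) as Him.
  apply Rabs_le_between in Hre, Him.
  apply (Hd (Re p) (Im p)); [lra|lra|]. intros (u & v & Hu & Hv & Hpu & Hpv & Hduv).
  assert (Hge : dl (u, v) <= Cmod (lambert p - z)%C); [|lra].
  apply Hdl; [lra|]. eapply Rle_lt_trans; [apply Cmod_le_abs|]. autorewrite with cplx. lra.
Qed.

Lemma lambert_scal_lt (p : C) : Cmod (lambert p) <= Cmod p * exp (Cmod p).
Proof.
  unfold lambert. rewrite Cmod_mult, Cmod_Cexp. apply Rmult_le_compat_l; [apply Cmod_ge_0|].
  apply exp_le. pose proof (re_le_Cmod p). pose proof (Rle_abs (Re p)). lra.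
Qed.

Lemma cauchy_C_limit (u : nat -> C) (k B : R) : 0 <= k < 1 ->
  (forall n, Cmod (u (S n) - u n)%C <= B * k ^ n) ->
  exists l : C, forall e, 0 < e -> exists N, forall n, (N <= n)%nat -> Cmod (u n - l) < e.
Proof.
  intros Hk Hu.
  assert (Hlim : forall v : nat -> R, (forall n, Rabs (v (S n) - v n) <= B * k ^ n) ->
    exists l : R, is_lim_seq v l).
  { intros v Hv.
    assert (Hex : ex_series (fun n => v (S n) - v n)).
    { apply (ex_series_le (K := R_AbsRing) (V := R_CompleteNormedModule) _ (fun n => B * k ^ n)); [exact Hv|].
      apply (ex_series_scal (K := R_AbsRing) (V := R_NormedModule) B (fun n => k ^ n)), ex_series_geom.
      rewrite Rabs_pos_eq; lra. }
    destruct Hex as [l Hl]. exists (l + v 0%nat).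
    apply is_lim_seq_incr_1.
    apply is_lim_seq_ext with (fun n => sum_n (fun n => v (S n) - v n) n + v 0%nat).
    - induction n as [|n IH]; [rewrite sum_O; ring|]. rewrite sum_Sn. unfold plus; simpl. lra.
    - apply (is_lim_seq_plus' _ _ l (v 0%nat)); [exact Hl|apply is_lim_seq_const]. }
  destruct (Hlim (fun n => Re (u n))) as [a Ha].
  { intros n. eapply Rle_trans; [|apply Hu]. apply (re_le_Cmod (u (S n) - u n)). }
  destruct (Hlim (fun n => Im (u n))) as [b Hb].
  { intros n. eapply Rle_trans; [|apply Hu]. apply (im_le_Cmod (u (S n) - u n)). }
  exists (a, b). intros e He.
  apply is_lim_seq_spec in Ha, Hb. assert (He2 : 0 < e / 2) by lra.
  destruct (Ha (mkposreal _ He2)) as [N1 H1]. destruct (Hb (mkposreal _ He2)) as [N2 H2].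
  exists (max N1 N2). intros n Hn. eapply Rle_lt_trans; [apply Cmod_le_abs|].
  specialize (H1 n ltac:(lia)). specialize (H2 n ltac:(lia)). simpl in H1, H2.
  autorewrite with cplx. lra.
Qed.

(** Persistence of an attracting fixed point replaces the open mapping theorem: for L' near L, the
    map [emap L'] contracts a ball around p, and its fixed point there still has modulus below 1. *)
Lemma C_infty_open (z : C) : C_infty z -> exists d, 0 < d /\ forall w, Cmod (w - z) < d -> C_infty w.
Proof.
  intros Hz. apply C_infty_lambert in Hz. destruct Hz as (p & Hp & ->).
  set (L := lambert p). pose proof (emap_lambert p) as Hfix. fold L in Hfix.
  set (E := exp (- Re p)). assert (HE : 0 < E) by apply exp_pos.
  destruct (cont_pos (fun e => 1 - (Cmod p + e) * exp (3 * e)) 0) as (e1 & He1 & Hk).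
  { cont_auto. easy. }
  { rewrite Rmult_0_r, exp_0. lra. }
  set (eta := Rmin e1 ((1 - Cmod p) / 2)).
  assert (Heta : 0 < eta /\ eta <= e1 /\ eta <= (1 - Cmod p) / 2).
  { unfold eta. pose proof (Rmin_l e1 ((1 - Cmod p) / 2)). pose proof (Rmin_r e1 ((1 - Cmod p) / 2)).
    split; [apply Rmin_pos; lra|lra]. }
  specialize (Hk eta ltac:(rewrite Rabs_pos_eq; lra)). cbv beta in Hk.
  (* Images of the ball of radius eta have modulus at most (|p| + eta) e^eta, and [emap_lipschitz]
     adds e^(2 eta) for points at distance at most 2 eta. *)
  set (k := (Cmod p + eta) * exp (3 * eta)) in *.
  pose proof (Cmod_ge_0 p) as Hp0. pose proof (exp_pos (3 * eta)) as Hex3.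
  assert (Hk0 : 0 <= k) by (unfold k; apply Rmult_le_pos; lra).
  set (dd := Rmin eta ((1 - k) * eta)).
  assert (Hdd : 0 < dd /\ dd <= eta /\ dd <= (1 - k) * eta).
  { assert (0 < (1 - k) * eta) by (apply Rmult_lt_0_compat; lra).
    unfold dd. pose proof (Rmin_l eta ((1 - k) * eta)). pose proof (Rmin_r eta ((1 - k) * eta)).
    split; [apply Rmin_pos; lra|lra]. }
  exists (dd / E). split; [apply Rdiv_lt_0_compat; lra|]. intros L' HL'.
  assert (HLE : Cmod (L' - L) * E <= dd).
  { apply Rle_trans with (dd / E * E); [apply Rmult_le_compat_r; lra|]. right. field. lra. }
  assert (Hdiff : Cmod (emap L' p - p) <= dd).
  { replace (emap L' p - p)%C with ((L' - L) * Cexp (- p))%C.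
    2:{ transitivity (emap L' p - emap L p)%C; [unfold emap; ring|now rewrite Hfix]. }
    rewrite Cmod_mult, Cmod_Cexp. exact HLE. }
  assert (HLp : Cmod L * E = Cmod p).
  { unfold E. now rewrite <- (Cmod_emap L p), Hfix. }
  assert (Hcontr : forall a b, Cmod (a - p) <= eta -> Cmod (b - p) <= eta ->
    Cmod (emap L' a - emap L' b) <= k * Cmod (a - b)).
  { intros a b Ha Hb. eapply Rle_trans; [apply emap_lipschitz|].
    assert (Hab : Cmod (a - b) <= 2 * eta).
    { pose proof (Cmod_triangle3 a p b). rewrite (Cmod_sub_sym p b) in *. lra. }
    assert (Hfb : Cmod (emap L' b) <= (Cmod p + eta) * exp eta).
    { rewrite Cmod_emap.
      assert (exp (- Re b) <= E * exp eta).
      { unfold E. rewrite <- exp_plus. apply exp_le. pose proof (re_le_Cmod (b - p)) as Hr.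
        rewrite Re_sub in Hr. apply Rabs_le_between in Hr. lra. }
      apply Rle_trans with (Cmod L' * (E * exp eta)); [apply Rmult_le_compat_l; [apply Cmod_ge_0|easy]|].
      rewrite <- Rmult_assoc. apply Rmult_le_compat_r; [left; apply exp_pos|].
      pose proof (Cmod_triangle_sub L' L). nra. }
    assert (Hexp : exp (Cmod (a - b)) <= exp (2 * eta)) by now apply exp_le.
    pose proof (Cmod_ge_0 (a - b)).
    apply Rle_trans with ((Cmod p + eta) * exp eta * (Cmod (a - b) * exp (2 * eta))).
    - apply Rmult_le_compat; [apply Cmod_ge_0| |easy|now apply Rmult_le_compat_l].
      apply Rmult_le_pos; [easy|left; apply exp_pos].
    - right. unfold k. replace (3 * eta) with (eta + 2 * eta) by ring. rewrite exp_plus. ring. }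
  set (u := fun n => iter_emap L' n p).
  assert (Hu : forall n, Cmod (u n - p) <= eta).
  { induction n as [|n IH].
    - unfold u. simpl. replace (p - p)%C with (RtoC 0) by ring. rewrite Cmod_0. lra.
    - change (u (S n)) with (emap L' (u n)).
      pose proof (Cmod_triangle3 (emap L' (u n)) (emap L' p) p) as H3.
      specialize (Hcontr (u n) p IH). replace (p - p)%C with (RtoC 0) in Hcontr by ring.
      rewrite Cmod_0 in Hcontr. specialize (Hcontr ltac:(lra)). nra. }
  destruct (cauchy_C_limit u k dd) as [q Hq]; [lra| |].
  { induction n as [|n IH].
    - unfold u. simpl. lra.
    - change (u (S (S n))) with (emap L' (u (S n))). change (u (S n)) with (emap L' (u n)) at 2.
      eapply Rle_trans; [now apply Hcontr|]. simpl. rewrite <- Rmult_assoc, (Rmult_comm dd), Rmult_assoc.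
      now apply Rmult_le_compat_l. }
  assert (Hqp : Cmod (q - p) <= eta).
  { apply le_epsilon. intros e He. destruct (Hq e He) as [N HN]. specialize (HN N (le_n N)).
    pose proof (Cmod_triangle3 q (u N) p) as H3. rewrite (Cmod_sub_sym q (u N)) in H3. specialize (Hu N). lra. }
  assert (Hqf : emap L' q = q).
  { assert (H0 : Cmod (emap L' q - q) <= 0).
    { apply le_epsilon. intros e He. destruct (Hq (e / 2)) as [N HN]; [lra|].
      pose proof (HN N (le_n N)) as H1. pose proof (HN (S N) ltac:(lia)) as H2.
      change (u (S N)) with (emap L' (u N)) in H2.
      pose proof (Cmod_triangle3 (emap L' q) (emap L' (u N)) q).
      pose proof (Hcontr q (u N) Hqp (Hu N)) as H3. rewrite (Cmod_sub_sym q (u N)) in H3.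
      pose proof (Cmod_ge_0 (u N - q)). nra. }
    assert (E0 : Cmod (emap L' q - q) = 0) by (pose proof (Cmod_ge_0 (emap L' q - q)); lra).
    apply Cmod_eq_0 in E0. replace (emap L' q) with (q + (emap L' q - q))%C by ring. rewrite E0. ring. }
  apply C_infty_lambert. exists q. split.
  - pose proof (Cmod_triangle_sub q p). lra.
  - now apply lambert_of_fixed.
Qed.

Lemma boundary_closure (S : C -> Prop) (z : C) : boundary S z ->
  forall e, 0 < e -> exists w, S w /\ Cmod (w - z) < e.
Proof.
  intros [H _] e He. destruct (H (fun w => Cmod (w - z) < e)) as (w & H1 & H2).
  - apply locally_Cmod. exists e. split; [easy|]. auto.
  - now exists w.
Qed.

Lemma boundary_intro (S : C -> Prop) (z : C) :
  (forall e, 0 < e -> exists w, S w /\ Cmod (w - z) < e) ->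
  (forall e, 0 < e -> exists w, ~ S w /\ Cmod (w - z) < e) -> boundary S z.
Proof.
  intros H1 H2. split.
  - intros P HP. apply locally_Cmod in HP. destruct HP as (d & Hd & HP).
    destruct (H1 d Hd) as (w & Hw & Hwz). exists w. auto.
  - intros HI. apply locally_Cmod in HI. destruct HI as (d & Hd & HI).
    destruct (H2 d Hd) as (w & Hw & Hwz). auto.
Qed.

Lemma boundary_C_infty (z : C) : boundary C_infty z -> exists p, Cmod p = 1 /\ z = lambert p.
Proof.
  intros Hz. destruct (closure_C_infty z (boundary_closure _ _ Hz)) as (p & Hp & Hzp).
  exists p. split; [|easy]. destruct Hp as [Hp|Hp]; [|easy]. exfalso.
  destruct Hz as [_ Hint]. apply Hint. apply locally_Cmod, C_infty_open.
  apply C_infty_lambert. now exists p.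
Qed.

Lemma not_V_infty_near (p : C) : Cmod p = 1 -> Im p <> 0 ->
  exists d, 0 < d /\ forall w, Cmod (w - lambert p) < d -> ~ V_infty w.
Proof.
  assert (Hup : forall p, Cmod p = 1 -> 0 < Im p ->
    exists d, 0 < d /\ forall w, Cmod (w - lambert p) < d -> ~ V_infty w).
  { intros q Hq HI. destruct (polar_upper q HI) as (phi & Hphi & E). rewrite Hq in E.
    assert (El : lambert q = polar (exp (cos phi)) (bdry_angle phi)).
    { rewrite E. unfold lambert, bdry_angle. cext; rewrite ?cos_plus, ?sin_plus; ring. }
    apply not_V_infty_open.
    - rewrite El, Im_polar. apply Rmult_lt_0_compat; [apply exp_pos|].
      pose proof (bdry_angle_bounds phi Hphi). apply sin_gt_0; lra.
    - rewrite El. now apply not_V_infty_indifferent. }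
  intros Hp HI. destruct (Rtotal_order 0 (Im p)) as [H|[H|H]]; [now apply Hup|lra|].
  destruct (Hup (Cconj p)) as (d & Hd & Hw).
  - now rewrite Cmod_conj.
  - rewrite Im_conj. lra.
  - exists d. split; [easy|]. intros w Hwp HV. apply (Hw (Cconj w)); [|now apply V_infty_conj].
    replace (Cconj w - lambert (Cconj p))%C with (Cconj (w - lambert p)).
    + now rewrite Cmod_conj.
    + unfold lambert. cext; rewrite ?cos_neg, ?sin_neg; ring.
Qed.

Lemma boundary_C_infty_nonreal (z : C) :
  boundary C_infty z -> Im z <> 0 -> locally z (fun w => ~ U_infty w).
Proof.
  intros Hz HI. destruct (boundary_C_infty z Hz) as (p & Hp & ->).
  destruct (not_V_infty_near p Hp) as (d & Hd & Hw).
  - intros E. apply HI. unfold lambert. autorewrite with cplx. rewrite E, sin_0. ring.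
  - apply locally_Cmod. exists d. split; [easy|]. intros w Hwd HU.
    apply (Hw w Hwd). now apply (locally_singleton w V_infty).
Qed.

Lemma lambert_real (x : R) : lambert (RtoC x) = RtoC (x * exp x).
Proof. unfold lambert. cext; rewrite ?cos_0, ?sin_0; ring. Qed.

Lemma boundary_both_real (z : C) : boundary U_infty z -> boundary C_infty z ->
  z = RtoC (- exp (-1)) \/ z = RtoC (exp 1).
Proof.
  intros HU HC. destruct (boundary_C_infty z HC) as (p & Hp & ->).
  destruct (Req_dec (Im p) 0) as [HI|HI].
  - assert (Ep : p = RtoC (Re p)) by (cext; easy).
    pose proof (Cmod_sqr p) as Hsq. rewrite Hp, HI in Hsq.
    assert (Hx : (Re p - 1) * (Re p + 1) = 0) by lra.
    apply Rmult_integral in Hx. rewrite Ep, lambert_real. destruct Hx as [Hx|Hx].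
    + right. replace (Re p) with 1 by lra. f_equal. ring.
    + left. replace (Re p) with (-1) by lra. f_equal. ring.
  - exfalso. destruct (not_V_infty_near p Hp HI) as (d & Hd & Hw).
    destruct (boundary_closure _ _ HU d Hd) as (w & HUw & Hwd). apply (Hw w Hwd).
    now apply (locally_singleton w V_infty).
Qed.

Lemma lambert_near (p : R) (e : R) : 0 < e ->
  exists d, 0 < d /\ forall x, Rabs (x - p) < d -> Cmod (lambert (RtoC x) - lambert (RtoC p)) < e.
Proof.
  intros He. destruct (lambert_cont (RtoC p) e He) as (d & Hd & H). exists d. split; [easy|].
  intros x Hx. apply H. rewrite <- RtoC_minus, Cmod_R. easy.
Qed.

Lemma boundary_C_infty_e : boundary C_infty (RtoC (exp 1)).
Proof.
  replace (exp 1) with (1 * exp 1) by ring. rewrite <- lambert_real.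
  apply boundary_intro; intros e He.
  - destruct (lambert_near 1 e He) as (d & Hd & H).
    set (x := 1 - Rmin (d / 2) (1 / 2)).
    assert (Hm : 0 < Rmin (d / 2) (1 / 2)) by (apply Rmin_pos; lra).
    pose proof (Rmin_l (d / 2) (1 / 2)). pose proof (Rmin_r (d / 2) (1 / 2)).
    exists (lambert (RtoC x)). split; [|apply H; unfold x; apply Rabs_def1; lra].
    apply C_infty_lambert. exists (RtoC x). split; [|easy]. rewrite Cmod_R.
    unfold x. apply Rabs_def1; lra.
  - exists (lambert (RtoC 1)). split.
    + intros H. apply C_infty_lambert in H. destruct H as (p & Hp & E).
      pose proof (lambert_scal_lt p) as H1. rewrite <- E, lambert_real, Cmod_R in H1.
      rewrite Rabs_pos_eq in H1 by (pose proof (exp_pos 1); lra).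
      pose proof (Cmod_ge_0 p). assert (exp (Cmod p) <= exp 1) by (apply exp_le; lra).
      pose proof (exp_pos (Cmod p)). pose proof (exp_pos 1). nra.
    + replace (lambert (RtoC 1) - lambert (RtoC 1))%C with (RtoC 0) by ring. now rewrite Cmod_0.
Qed.

Lemma C_infty_real_ge (x : R) : C_infty (RtoC x) -> - exp (-1) <= x.
Proof.
  intros H. apply C_infty_lambert in H. destruct H as ([a b] & Hp & E).
  assert (E1 : x = exp a * (a * cos b - b * sin b)).
  { apply (f_equal Re) in E. unfold lambert in E. autorewrite with cplx in E. rewrite E. ring. }
  assert (E2 : a * sin b + b * cos b = 0).
  { apply (f_equal Im) in E. unfold lambert in E. autorewrite with cplx in E.
    pose proof (exp_pos a). apply Rmult_eq_reg_l with (exp a); lra. }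
  pose proof (Cmod_sqr (a, b)) as Hsq. simpl in Hsq. pose proof (Cmod_ge_0 (a, b)).
  assert (Hab : a * a + b * b < 1) by nra.
  assert (Hb : b = 0).
  { destruct (Req_dec b 0) as [Hb|Hb]; [easy|exfalso].
    (* From [a = - b cot b], the modulus is [b / sin b], above [1]. *)
    assert (Hsin : sin b ^ 2 < b ^ 2).
    { assert (Hs : forall y, 0 < y -> sin y ^ 2 < y ^ 2).
      { intros y Hy. pose proof (gamma_eq_lt 0 y (Rle_refl 0) Hy) as Hg. rewrite sin_0 in Hg. lra. }
      destruct (Rtotal_order b 0) as [H0|[H0|H0]]; [|easy|now apply Hs].
      specialize (Hs (- b) ltac:(lra)). rewrite sin_neg in Hs. nra. }
    pose proof (sin2_cos2 b) as Hsc. unfold Rsqr in Hsc.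
    assert (E3 : (a * a + b * b) * (sin b * sin b) = b * b).
    { assert (E4 : a * sin b = - (b * cos b)) by lra.
      replace ((a * a + b * b) * (sin b * sin b)) with ((a * sin b) * (a * sin b) + b * b * (sin b * sin b)) by ring.
      rewrite E4. replace (sin b * sin b) with (1 - cos b * cos b) by lra. ring. }
    assert (0 <= sin b * sin b) by nra. nra. }
  subst b. rewrite cos_0, sin_0 in E1.
  pose proof (exp_ineq1_le (- a - 1)) as H1.
  assert (H2 : exp a * exp (- a - 1) = exp (-1)) by (rewrite <- exp_plus; f_equal; ring).
  pose proof (exp_pos a). nra.
Qed.

Lemma near_left_real (x e : R) : 0 < e -> exists y, y < x /\ x - e < y /\ Cmod (RtoC y - RtoC x) < e.
Proof.
  intros He. exists (x - e / 2). repeat split; try lra.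
  rewrite <- RtoC_minus, Cmod_R. apply Rabs_def1; lra.
Qed.

Lemma boundary_C_infty_inv_e : boundary C_infty (RtoC (- exp (-1))).
Proof.
  apply boundary_intro; intros e He.
  - replace (- exp (-1)) with (-1 * exp (-1)) by ring. rewrite <- lambert_real.
    destruct (lambert_near (-1) e He) as (d & Hd & H).
    set (x := -1 + Rmin (d / 2) (1 / 2)).
    assert (Hm : 0 < Rmin (d / 2) (1 / 2)) by (apply Rmin_pos; lra).
    pose proof (Rmin_l (d / 2) (1 / 2)). pose proof (Rmin_r (d / 2) (1 / 2)).
    exists (lambert (RtoC x)). split; [|apply H; unfold x; apply Rabs_def1; lra].
    apply C_infty_lambert. exists (RtoC x). split; [|easy]. rewrite Cmod_R.
    unfold x. apply Rabs_def1; lra.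
  - destruct (near_left_real (- exp (-1)) e He) as (y & Hy & _ & Hye).
    exists (RtoC y). split; [|easy]. intros H. apply C_infty_real_ge in H. lra.
Qed.

(** On the negative reals, in the coordinate y = -z, the map is y -> |x| e^y. The supremum a of the
    y in [K] satisfies |x| e^a <= a, and a <= e^(a-1) forces |x| <= e^(-1). *)
Lemma V_infty_real_ge (x : R) : x < 0 -> V_infty (RtoC x) -> - exp (-1) <= x.
Proof.
  intros Hx HV. destruct (V_infty_inv _ HV) as (K & M & HK & _ & HM).
  destruct (completeness (fun y => K (RtoC (- y)))) as [a [Hub Hlub]].
  - exists M. intros y Hy. apply HM in Hy. rewrite Cmod_R, Rabs_Ropp in Hy.
    pose proof (Rle_abs y). lra.
  - exists 0. replace (RtoC (- 0)) with (RtoC 0) by (f_equal; ring). apply HK.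
  - assert (Hstep : forall y, K (RtoC (- y)) -> - x * exp y <= a).
    { intros y Hy. apply Hub. apply (ic_emap _ _ HK) in Hy.
      replace (RtoC (- (- x * exp y))) with (emap (RtoC x) (RtoC (- y))); [easy|].
      unfold emap. cext; rewrite ?Ropp_involutive, ?cos_0, ?sin_0; ring. }
    assert (Ha : - x * exp a <= a).
    { apply le_epsilon. intros e He.
      assert (H0 : exists y, K (RtoC (- y)) /\ exp a - e / - x <= exp y).
      { destruct (Classical_Prop.classic (exists y, K (RtoC (- y)) /\ exp a - e / - x <= exp y)) as [H|H];
          [easy|exfalso].
        assert (He' : 0 < e / - x) by (apply Rdiv_lt_0_compat; lra).
        assert (Hlt : forall y, K (RtoC (- y)) -> exp y < exp a - e / - x).
        { intros y Hy. destruct (Rlt_le_dec (exp y) (exp a - e / - x)); [easy|]. exfalso. eauto. }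
        assert (H1 : 0 < exp a - e / - x).
        { pose proof (Hlt 0) as H1. pose proof (exp_pos 0).
          replace (RtoC (- 0)) with (RtoC 0) in H1 by (f_equal; ring). specialize (H1 (ic_0 _ _ HK)). lra. }
        assert (H2 : a <= ln (exp a - e / - x)).
        { apply Hlub. intros y Hy. rewrite <- (ln_exp y). left. apply ln_increasing; [apply exp_pos|auto]. }
        assert (H3 : ln (exp a - e / - x) < ln (exp a)) by (apply ln_increasing; lra).
        rewrite ln_exp in H3. lra. }
      destruct H0 as (y & Hy & Hye). specialize (Hstep y Hy).
      apply Rmult_le_compat_l with (r := - x) in Hye; [|lra].
      replace (- x * (exp a - e / - x)) with (- x * exp a - e) in Hye by (field; lra). lra. }
    pose proof (exp_ineq1_le (a - 1)) as H1.
    assert (H2 : exp (-1) * exp a = exp (a - 1)) by (rewrite <- exp_plus; f_equal; ring).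
    pose proof (exp_pos a). destruct (Rle_lt_dec (- exp (-1)) x) as [H5|H5]; [easy|]. nra.
Qed.

Lemma boundary_U_infty_inv_e : boundary U_infty (RtoC (- exp (-1))).
Proof.
  pose proof (exp_pos (-1)) as Hpos. apply boundary_intro; intros e He.
  - set (s := Rmin (e / 2) (exp (-1) / 2)).
    assert (Hs : 0 < s) by (apply Rmin_pos; lra).
    pose proof (Rmin_l (e / 2) (exp (-1) / 2)) as Hl. pose proof (Rmin_r (e / 2) (exp (-1) / 2)) as Hr.
    fold s in Hl, Hr.
    exists (RtoC (- exp (-1) + s)). split.
    + apply U_infty_small. rewrite Cmod_R, Rabs_left1 by lra. lra.
    + rewrite <- RtoC_minus, Cmod_R. apply Rabs_def1; lra.
  - destruct (near_left_real (- exp (-1)) e He) as (y & Hy & _ & Hye).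
    exists (RtoC y). split; [|easy]. intros H.
    apply (locally_singleton (RtoC y) V_infty), V_infty_real_ge in H; lra.
Qed.

(** * Real analytic functions *)

Ltac rring := match goal with |- @eq _ ?a ?b => apply (Rminus_diag_uniq a b) end; ring.

(** The geometric bound on the coefficients is part of the definition so that products and
    compositions have a radius of convergence at hand; [ana_intro] obtains it from convergence
    alone, since the terms of a convergent series are bounded. *)
Definition ana (f : R -> R) (t0 : R) : Prop := exists (a : nat -> R) (rho M : R), 0 < rho /\
  (forall n, Rabs (a n) * rho ^ n <= M) /\
  forall x, Rabs x < rho -> is_pseries a x (f (t0 + x)).

Lemma ana_intro (f : R -> R) (t0 : R) (a : nat -> R) (rho : R) : 0 < rho ->
  (forall x, Rabs x < rho -> is_pseries a x (f (t0 + x))) -> ana f t0.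
Proof.
  intros Hr H. assert (H2 : Rabs (rho / 2) < rho) by (rewrite Rabs_pos_eq; lra).
  specialize (H (rho / 2) H2) as Hs. rewrite is_pseries_R in Hs.
  assert (Hex : ex_series (fun n => a n * (rho / 2) ^ n)) by (eexists; exact Hs).
  apply ex_series_lim_0 in Hex.
  destruct (filterlim_bounded (K := R_AbsRing) (V := R_NormedModule) (fun n => a n * (rho / 2) ^ n)) as [M HM].
  { exists 0. exact Hex. }
  exists a, (rho / 2), M. split; [lra|]. split.
  - intros n. specialize (HM n). unfold norm in HM; simpl in HM. unfold abs in HM; simpl in HM.
    rewrite Rabs_mult, (Rabs_pos_eq ((rho / 2) ^ n)) in HM by (apply pow_le; lra). exact HM.
  - intros x Hx. apply H. lra.
Qed.

Lemma CV_radius_ge (a : nat -> R) (rho M : R) : (forall n, Rabs (a n) * rho ^ n <= M) -> 0 < rho ->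
  forall x, Rabs x < rho -> Rbar_lt (Rabs x) (CV_radius a).
Proof.
  intros Ha Hr x Hx. apply Rbar_lt_le_trans with rho; [exact Hx|].
  apply (CV_radius_bounded a). exists M. intros n.
  rewrite Rabs_mult, (Rabs_pos_eq (rho ^ n)) by (apply pow_le; lra). apply Ha.
Qed.

Lemma ana_ext (f g : R -> R) (t0 d : R) : 0 < d ->
  (forall x, Rabs (x - t0) < d -> f x = g x) -> ana f t0 -> ana g t0.
Proof.
  intros Hd Hfg (a & rho & M & Hr & _ & H).
  apply (ana_intro g t0 a (Rmin rho d)); [now apply Rmin_pos|].
  intros x Hx. pose proof (Rmin_l rho d). pose proof (Rmin_r rho d).
  rewrite <- Hfg; [apply H; lra|]. replace (t0 + x - t0) with x by rring. lra.
Qed.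

Lemma sum_n_R_S (u : nat -> R) (n : nat) : sum_n u (S n) = sum_n u n + u (S n).
Proof. apply (sum_Sn u n). Qed.

Lemma is_pseries_finite (a : nat -> R) (x : R) (N : nat) : (forall n, (N < n)%nat -> a n = 0) ->
  is_pseries a x (sum_n (fun n => a n * x ^ n) N).
Proof.
  intros Ha. rewrite is_pseries_R.
  assert (Hc : forall n, (N <= n)%nat -> sum_n (fun n => a n * x ^ n) N = sum_n (fun n => a n * x ^ n) n).
  { intros n Hn. induction Hn as [|n Hn IH]; [easy|]. rewrite sum_n_R_S, <- IH, Ha by lia. rring. }
  apply (filterlim_ext_loc (fun _ => sum_n (fun n => a n * x ^ n) N)).
  - exists N. exact Hc.
  - apply filterlim_const.
Qed.

Lemma ana_const (c t0 : R) : ana (fun _ => c) t0.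
Proof.
  apply (ana_intro _ _ (fun n => match n with O => c | _ => 0 end) 1); [lra|]. intros x _.
  pose proof (is_pseries_finite (fun n => match n with O => c | _ => 0 end) x 0) as H.
  rewrite sum_O in H. replace (c * x ^ 0) with c in H by (simpl; rring). apply H.
  intros [|n] Hn; [lia|easy].
Qed.

Lemma ana_id (t0 : R) : ana (fun x => x) t0.
Proof.
  set (a := fun n => match n with O => t0 | S O => 1 | _ => 0 end).
  apply (ana_intro _ _ a 1); [lra|]. intros x _.
  pose proof (is_pseries_finite a x 1) as H.
  rewrite sum_n_R_S, sum_O in H. simpl in H.
  replace (t0 + x) with (t0 * 1 + 1 * (x * 1)) by rring. apply H.
  intros [|[|n]] Hn; [lia|lia|easy].
Qed.

Lemma ana_plus (f g : R -> R) (t0 : R) : ana f t0 -> ana g t0 -> ana (fun x => f x + g x) t0.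
Proof.
  intros (a & r & M & Hr & _ & Hf) (b & r' & M' & Hr' & _ & Hg).
  apply (ana_intro _ _ (PS_plus a b) (Rmin r r')); [now apply Rmin_pos|].
  intros x Hx. pose proof (Rmin_l r r'). pose proof (Rmin_r r r').
  apply (is_pseries_plus a b x); [apply Hf|apply Hg]; lra.
Qed.

Lemma ana_mult (f g : R -> R) (t0 : R) : ana f t0 -> ana g t0 -> ana (fun x => f x * g x) t0.
Proof.
  intros (a & r & M & Hr & HM & Hf) (b & r' & M' & Hr' & HM' & Hg).
  apply (ana_intro _ _ (PS_mult a b) (Rmin r r')); [now apply Rmin_pos|].
  intros x Hx. pose proof (Rmin_l r r'). pose proof (Rmin_r r r').
  apply (is_pseries_mult a b x); [apply Hf|apply Hg| |]; try lra.
  - apply (CV_radius_ge a r M); auto; lra.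
  - apply (CV_radius_ge b r' M'); auto; lra.
Qed.

(** * Composition of power series *)

Fixpoint PS_pow (a : nat -> R) (k : nat) : nat -> R :=
  match k with
  | O => fun n => match n with O => 1 | _ => 0 end
  | S k => PS_mult (PS_pow a k) a
  end.

Lemma sum_f_R0_zero (u : nat -> R) (n : nat) : (forall i, (i <= n)%nat -> u i = 0) -> sum_f_R0 u n = 0.
Proof.
  intros H. induction n as [|n IH]; simpl; [apply H; lia|].
  rewrite IH, H by (intros; try apply H; lia). rring.
Qed.

Lemma PS_pow_zero (a : nat -> R) (k n : nat) : a O = 0 -> (n < k)%nat -> PS_pow a k n = 0.
Proof.
  intros Ha. revert n. induction k as [|k IH]; intros n Hn; [lia|]. simpl. unfold PS_mult.
  apply sum_f_R0_zero. intros i Hi. destruct (le_lt_dec k i) as [H|H].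
  - replace (n - i)%nat with O by lia. rewrite Ha. rring.
  - rewrite IH by easy. rring.
Qed.

Lemma PS_pow_abs (a : nat -> R) (k n : nat) :
  Rabs (PS_pow a k n) <= PS_pow (fun n => Rabs (a n)) k n.
Proof.
  revert n. induction k as [|k IH]; intros n.
  - simpl. destruct n; rewrite Rabs_pos_eq; lra.
  - simpl. unfold PS_mult. eapply Rle_trans; [apply Rsum_abs|].
    apply sum_Rle. intros i _. rewrite Rabs_mult. apply Rmult_le_compat_r; [apply Rabs_pos|apply IH].
Qed.

Lemma PS_pow_nonneg (a : nat -> R) (k n : nat) : 0 <= PS_pow (fun n => Rabs (a n)) k n.
Proof. eapply Rle_trans; [apply Rabs_pos|apply PS_pow_abs]. Qed.

Lemma is_series_nonneg_term (u : nat -> R) (l : R) (n : nat) : (forall n, 0 <= u n) -> is_series u l -> u n <= l.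
Proof.
  intros Hu Hl. apply Rle_trans with (sum_n u n).
  - destruct n as [|n]; [rewrite sum_O; lra|]. rewrite sum_n_R_S. 
    assert (0 <= sum_n u n); [|lra]. clear Hl. induction n as [|n IH]; [rewrite sum_O; apply Hu|].
    rewrite sum_n_R_S.  specialize (Hu (S n)). lra.
  - apply (is_lim_seq_incr_compare (sum_n u) l); [exact Hl|].
    intros m. rewrite sum_n_R_S.  specialize (Hu (S m)). lra.
Qed.

Lemma PS_pow_series (a : nat -> R) (k : nat) (rho x F : R) :
  0 <= x < rho -> (exists M, forall n, Rabs (a n) * rho ^ n <= M) ->
  is_pseries (fun n => Rabs (a n)) x F ->
  is_series (fun n => PS_pow (fun n => Rabs (a n)) k n * x ^ n) (F ^ k).
Proof.
  intros Hx HM HF. rewrite is_pseries_R in HF. induction k as [|k IH].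
  - simpl pow at 2. rewrite <- is_pseries_R.
    pose proof (is_pseries_finite (PS_pow (fun n => Rabs (a n)) 0) x 0) as H. rewrite sum_O in H.
    replace (PS_pow (fun n => Rabs (a n)) 0 0 * x ^ 0) with 1 in H by (simpl; rring).
    apply H. intros [|n] Hn; [lia|easy].
  - assert (Hm : is_series (fun n => sum_f_R0 (fun i => (PS_pow (fun n => Rabs (a n)) k i * x ^ i)
       * (Rabs (a (n - i)%nat) * x ^ (n - i))) n) (F ^ k * F)).
    { apply (is_series_mult_pos _ _ _ _ IH HF).
      - intros n. apply Rmult_le_pos; [apply PS_pow_nonneg|apply pow_le; lra].
      - intros n. apply Rmult_le_pos; [apply Rabs_pos|apply pow_le; lra]. }
    replace (F ^ S k) with (F ^ k * F) by (simpl; rring).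
    eapply is_series_ext; [|exact Hm]. intros n. simpl. unfold PS_mult.
    rewrite (Rmult_comm _ (x ^ n)), scal_sum. apply sum_eq. intros i Hi.
    replace (x ^ n) with (x ^ i * x ^ (n - i)) by (rewrite <- pow_add; f_equal; lia). rring.
Qed.

Lemma geom_tail (u : nat -> R) (l q B : R) (N : nat) : 0 <= q < 1 -> 0 <= B ->
  (forall n, Rabs (u n) <= B * q ^ n) -> is_series u l ->
  Rabs (l - sum_n u N) <= B * q ^ S N / (1 - q).
Proof.
  intros Hq HB Hu Hl.
  assert (Hlim : is_lim_seq (fun m => Rabs (sum_n u (m + N) - sum_n u N)) (Rabs (l - sum_n u N))).
  { apply (is_lim_seq_abs _ (l - sum_n u N)).
    apply (is_lim_seq_minus' _ _ l (sum_n u N)); [|apply is_lim_seq_const].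
    apply (is_lim_seq_incr_n (sum_n u) N l). exact Hl. }
  apply (is_lim_seq_le (fun m => Rabs (sum_n u (m + N) - sum_n u N))
    (fun _ => B * q ^ S N / (1 - q)) (Rabs (l - sum_n u N)) (B * q ^ S N / (1 - q)));
    [|exact Hlim|apply is_lim_seq_const].
  intros m.
  assert (Hb : Rabs (sum_n u (m + N) - sum_n u N) <= B * q ^ S N * ((1 - q ^ m) / (1 - q))).
  { induction m as [|m IH].
    - simpl. rewrite Rminus_diag, Rabs_R0. unfold Rdiv. rewrite Rminus_diag. lra.
    - replace (S m + N)%nat with (S (m + N)) by lia. rewrite sum_n_R_S. 
      replace (sum_n u (m + N) + u (S (m + N)) - sum_n u N)
        with ((sum_n u (m + N) - sum_n u N) + u (S (m + N))) by rring.
      eapply Rle_trans; [apply Rabs_triang|]. specialize (Hu (S (m + N))).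
      replace (B * q ^ S N * ((1 - q ^ S m) / (1 - q)))
        with (B * q ^ S N * ((1 - q ^ m) / (1 - q)) + B * q ^ S (m + N)); [lra|].
      simpl. rewrite pow_add. field. lra. }
  eapply Rle_trans; [exact Hb|]. unfold Rdiv. rewrite <- (Rmult_assoc _ (1 - q ^ m)).
  apply Rmult_le_compat_r; [left; apply Rinv_0_lt_compat; lra|].
  assert (0 <= B * q ^ S N) by (apply Rmult_le_pos; [easy|apply pow_le; lra]).
  assert (0 <= q ^ m) by (apply pow_le; lra). nra.
Qed.

Lemma is_series_sum_n_abs_le (b : nat -> R) (r B : R) (N : nat) : 0 < r -> 
  (forall k, Rabs (b k) * r ^ k <= B) -> sum_n (fun k => Rabs (b k) * (r / 2) ^ k) N <= 2 * B.
Proof.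
  intros Hr Hb.
  assert (H : sum_n (fun k => Rabs (b k) * (r / 2) ^ k) N <= 2 * B * (1 - (/ 2) ^ S N)).
  { assert (Ht : forall k, Rabs (b k) * (r / 2) ^ k <= B * (/ 2) ^ k).
    { intros k. unfold Rdiv. rewrite Rpow_mult_distr, <- Rmult_assoc.
      apply Rmult_le_compat_r; [apply pow_le; lra|apply Hb]. }
    induction N as [|N IH]; [rewrite sum_O; specialize (Ht 0%nat); simpl in *; lra|].
    rewrite sum_n_R_S.  specialize (Ht (S N)).
    change (/ 2 ^ S (S N)) with (/ 2 ^ S (S N)).
    replace (2 * B * (1 - (/ 2) ^ S (S N))) with (2 * B * (1 - (/ 2) ^ S N) + B * (/ 2) ^ S N)
      by (simpl; field). lra. }
  assert (HB : 0 <= B).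
  { specialize (Hb 0%nat). simpl in Hb. pose proof (Rabs_pos (b 0%nat)). lra. }
  assert (0 <= (/ 2) ^ S N) by (apply pow_le; lra). nra.
Qed.

Lemma sum_n_R_le (u v : nat -> R) (N : nat) : (forall k, u k <= v k) -> sum_n u N <= sum_n v N.
Proof.
  intros H. induction N as [|N IH]; [rewrite !sum_O; apply H|].
  rewrite !sum_n_R_S.  specialize (H (S N)). lra.
Qed.

Lemma sum_n_R_abs (u : nat -> R) (N : nat) : Rabs (sum_n u N) <= sum_n (fun k => Rabs (u k)) N.
Proof.
  induction N as [|N IH]; [rewrite !sum_O; lra|].
  rewrite !sum_n_R_S.  eapply Rle_trans; [apply Rabs_triang|]. lra.
Qed.

Lemma sum_n_R_scal (c : R) (u : nat -> R) (N : nat) : sum_n (fun k => c * u k) N = c * sum_n u N.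
Proof.
  induction N as [|N IH]; [rewrite !sum_O; rring|].
  rewrite !sum_n_R_S, IH.  rring.
Qed.

Lemma sum_n_R_minus (u v : nat -> R) (N : nat) : sum_n (fun k => u k - v k) N = sum_n u N - sum_n v N.
Proof.
  induction N as [|N IH]; [rewrite !sum_O; rring|].
  rewrite !sum_n_R_S, IH.  rring.
Qed.

(* Since the inner series has no constant term, each coefficient of the
   composition is a finite sum, and the truncation error is geometric. *)
Lemma ana_comp (g f : R -> R) (t0 : R) : ana g (f t0) -> ana f t0 -> ana (fun x => g (f x)) t0.
Proof.
  intros (b & r & B & Hr & HB & Hg) (a0 & s & M & Hs & HM & Hf).
  assert (Ha0 : a0 O = f t0).
  { specialize (Hf 0 ltac:(rewrite Rabs_R0; lra)). rewrite Rplus_0_r in Hf.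
    apply is_pseries_unique in Hf. rewrite <- Hf. symmetry. apply PSeries_0. }
  set (a := fun n => match n with O => 0 | S m => a0 n end).
  assert (Hfa : forall x, Rabs x < s -> is_pseries a x (f (t0 + x) - f t0)).
  { intros x Hx.
    pose proof (is_pseries_plus a0 (fun n => match n with O => - f t0 | _ => 0 end) x _ (- f t0) (Hf x Hx)) as H.
    apply is_pseries_ext with (PS_plus a0 (fun n => match n with O => - f t0 | _ => 0 end)).
    - intros [|n]; unfold PS_plus, a, plus; simpl; [rewrite Ha0; rring|rring].
    - apply H.
      pose proof (is_pseries_finite (fun n => match n with O => - f t0 | _ => 0 end) x 0) as H0.
      rewrite sum_O in H0. replace (- f t0 * x ^ 0) with (- f t0) in H0 by (simpl; rring). apply H0.
      intros [|n] Hn; [lia|easy]. }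
  assert (HMa : forall n, Rabs (a n) * s ^ n <= M).
  { intros [|n]; [|apply HM]. specialize (HM O). pose proof (Rabs_pos (a0 O)).
    unfold a. rewrite Rabs_R0. simpl in *. lra. }
  assert (HM0 : 0 <= M).
  { specialize (HMa O). unfold a in HMa. rewrite Rabs_R0 in HMa. lra. }
  (* A radius at which the absolute inner series is at most [r / 2]. *)
  assert (Hrho : exists rho F, 0 < rho < s /\ 0 <= F <= r / 2 /\ is_pseries (fun n => Rabs (a n)) rho F).
  { set (q := Rmin (1 / 2) (r / (4 * (M + 1)))).
    assert (Hq : 0 < q).
    { unfold q. apply Rmin_pos; [lra|]. apply Rdiv_lt_0_compat; lra. }
    pose proof (Rmin_l (1 / 2) (r / (4 * (M + 1)))) as Hq1. fold q in Hq1.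
    pose proof (Rmin_r (1 / 2) (r / (4 * (M + 1)))) as Hq2. fold q in Hq2.
    assert (Hterm : forall n, Rabs (a n) * (q * s) ^ n <= M * q ^ n).
    { intros n. rewrite Rpow_mult_distr.
      replace (Rabs (a n) * (q ^ n * s ^ n)) with (Rabs (a n) * s ^ n * q ^ n) by rring.
      apply Rmult_le_compat_r; [apply pow_le; lra|apply HMa]. }
    assert (Hex : ex_series (fun n => Rabs (a n) * (q * s) ^ n)).
    { apply (ex_series_le (K := R_AbsRing) (V := R_CompleteNormedModule) _ (fun n => M * q ^ n)).
      - intros n. unfold norm; simpl. unfold abs; simpl. rewrite Rabs_pos_eq; [apply Hterm|].
        apply Rmult_le_pos; [apply Rabs_pos|apply pow_le; nra].
      - apply (ex_series_scal (K := R_AbsRing) (V := R_NormedModule) M (fun n => q ^ n)), ex_series_geom.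
        rewrite Rabs_pos_eq; lra. }
    destruct Hex as [F HF]. exists (q * s), F. split; [split; nra|]. split.
    - assert (HF0 : Rabs (F - sum_n (fun n => Rabs (a n) * (q * s) ^ n) 0) <= M * q ^ 1 / (1 - q)).
      { apply geom_tail; [lra|easy| |easy]. intros n. rewrite Rabs_pos_eq; [apply Hterm|].
        apply Rmult_le_pos; [apply Rabs_pos|apply pow_le; nra]. }
      rewrite sum_O in HF0. unfold a at 1 in HF0. rewrite Rabs_R0, Rmult_0_l, Rminus_0_r in HF0.
      assert (H2 : M * q ^ 1 / (1 - q) <= r / 2).
      { apply Rmult_le_reg_r with (1 - q); [lra|]. unfold Rdiv at 1.
        rewrite Rmult_assoc, Rinv_l by lra.
        assert (q * (4 * (M + 1)) <= r).
        { apply Rle_trans with (r / (4 * (M + 1)) * (4 * (M + 1))); [apply Rmult_le_compat_r; lra|].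
          right. field. lra. }
        nra. }
      split; [|pose proof (Rle_abs F); lra].
      pose proof (is_series_nonneg_term _ F 0 (fun n => Rmult_le_pos _ _ (Rabs_pos (a n)) (pow_le (q * s) n ltac:(nra))) HF) as H3.
      simpl in H3. rewrite Rabs_R0 in H3. lra.
    - now rewrite is_pseries_R. }
  destruct Hrho as (rho & F & Hrho & HF & HFs).
  set (c := PS_pow a).
  set (d := fun n => sum_n (fun k => b k * c k n) n).
  apply (ana_intro _ _ d rho); [lra|]. intros x Hx.
  set (y := f (t0 + x) - f t0).
  assert (HB0 : 0 <= B).
  { specialize (HB O). simpl in HB. pose proof (Rabs_pos (b O)). lra. }
  set (q := Rabs x / rho).
  assert (Hq : 0 <= q < 1).
  { unfold q. split; [apply Rmult_le_pos; [apply Rabs_pos|left; apply Rinv_0_lt_compat; lra]|].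
    apply Rmult_lt_reg_r with rho; [lra|]. unfold Rdiv. rewrite Rmult_assoc, Rinv_l by lra. lra. }
  assert (Hcterm : forall k n, Rabs (c k n * x ^ n) <= F ^ k * q ^ n).
  { intros k n. rewrite Rabs_mult, <- RPow_abs.
    assert (Hxq : Rabs x = q * rho) by (unfold q; field; lra). rewrite Hxq, Rpow_mult_distr.
    assert (Hk : Rabs (c k n) * rho ^ n <= F ^ k).
    { apply Rle_trans with (PS_pow (fun n => Rabs (a n)) k n * rho ^ n).
      - apply Rmult_le_compat_r; [apply pow_le; lra|apply PS_pow_abs].
      - apply (is_series_nonneg_term (fun n => PS_pow (fun n => Rabs (a n)) k n * rho ^ n)).
        + intros m. apply Rmult_le_pos; [apply PS_pow_nonneg|apply pow_le; lra].
        + apply (PS_pow_series a k s); [lra|now exists M|easy]. }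
    replace (Rabs (c k n) * (q ^ n * rho ^ n)) with (Rabs (c k n) * rho ^ n * q ^ n) by rring.
    apply Rmult_le_compat_r; [apply pow_le; lra|easy]. }
  assert (HF0 : forall k, 0 <= F ^ k) by (intros; apply pow_le; lra).
  assert (Hcser : forall k, is_series (fun n => c k n * x ^ n) (y ^ k)).
  { assert (Hrad : forall k, Rbar_lt (Rabs x) (CV_radius (c k))).
    { intros k. apply (CV_radius_ge (c k) rho (F ^ k)); [|lra|easy].
      intros n. apply Rle_trans with (PS_pow (fun n => Rabs (a n)) k n * rho ^ n).
      - apply Rmult_le_compat_r; [apply pow_le; lra|apply PS_pow_abs].
      - apply (is_series_nonneg_term (fun n => PS_pow (fun n => Rabs (a n)) k n * rho ^ n)).
        + intros m. apply Rmult_le_pos; [apply PS_pow_nonneg|apply pow_le; lra].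
        + apply (PS_pow_series a k s); [lra|now exists M|easy]. }
    intros k. rewrite <- is_pseries_R. induction k as [|k IH].
    - pose proof (is_pseries_finite (c O) x 0) as H0. rewrite sum_O in H0.
      replace (c O O * x ^ 0) with (y ^ 0) in H0 by (unfold c; simpl; rring). apply H0.
      intros [|n] Hn; [lia|easy].
    - replace (y ^ S k) with (y ^ k * y) by (simpl; rring).
      apply (is_pseries_mult (c k) a x); [easy|apply Hfa; lra|apply Hrad|].
      apply (CV_radius_ge a s M); [easy|lra|lra]. }
  assert (Hyr : Rabs y <= r / 2).
  { eapply Rle_trans; [|apply HF]. apply Rle_trans with (F ^ 1); [|simpl; lra].
    replace y with (y ^ 1) by rring.
    assert (Hle : is_lim_seq (fun N => Rabs (sum_n (fun n => c 1%nat n * x ^ n) N)) (Rabs (y ^ 1))).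
    { apply (is_lim_seq_abs _ (y ^ 1)). exact (Hcser 1%nat). }
    apply (is_lim_seq_le (fun N => Rabs (sum_n (fun n => c 1%nat n * x ^ n) N)) (fun _ => F ^ 1)
      (Rabs (y ^ 1)) (F ^ 1)); [|exact Hle|apply is_lim_seq_const].
    intros N. eapply Rle_trans; [apply sum_n_R_abs|].
    assert (HS : is_series (fun n => PS_pow (fun n => Rabs (a n)) 1 n * rho ^ n) (F ^ 1)).
    { apply (PS_pow_series a 1 s); [lra|now exists M|easy]. }
    eapply Rle_trans; [|apply (is_lim_seq_incr_compare (sum_n (fun n => PS_pow (fun n => Rabs (a n)) 1 n * rho ^ n)) (F ^ 1)); [exact HS|] ].
    - apply sum_n_R_le. intros k. rewrite Rabs_mult, <- RPow_abs.
      apply Rmult_le_compat; [apply Rabs_pos|apply pow_le, Rabs_pos|apply PS_pow_abs|].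
      apply pow_incr. split; [apply Rabs_pos|lra].
    - intros n. rewrite sum_n_R_S. 
      assert (0 <= PS_pow (fun n => Rabs (a n)) 1 (S n) * rho ^ S n)
        by (apply Rmult_le_pos; [apply PS_pow_nonneg|apply pow_le; lra]). lra. }
  specialize (Hg y ltac:(lra)). replace (f t0 + y) with (f (t0 + x)) in Hg by (unfold y; rring).
  rewrite is_pseries_R in Hg |- *.
  (* The coefficient of x^n in y^k vanishes for n < k. So the N-th partial sum of the composition
     combines the truncations at N of the series of y^k for k <= N, and each truncation leaves a
     geometric tail in q. *)
  assert (Hdiff : forall N, Rabs (sum_n (fun k => b k * y ^ k) N - sum_n (fun n => d n * x ^ n) N)
    <= 2 * B / (1 - q) * q ^ S N).
  { intros N.
    assert (Ed : sum_n (fun n => d n * x ^ n) N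
      = sum_n (fun k => b k * sum_n (fun n => c k n * x ^ n) N) N).
    { transitivity (sum_n (fun n => sum_n (fun k => b k * (c k n * x ^ n)) N) N).
      - apply sum_n_ext_loc. intros n Hn. unfold d.
        rewrite Rmult_comm, <- sum_n_R_scal.
        transitivity (sum_n (fun k => b k * (c k n * x ^ n)) n).
        + apply sum_n_ext. intros k. rring.
        + induction Hn as [|N' Hn IH]; [easy|]. rewrite sum_n_R_S, <- IH.
          unfold c. rewrite PS_pow_zero by (try easy; lia).  rring.
      - rewrite sum_n_switch. apply sum_n_ext. intros k. apply sum_n_R_scal. }
    rewrite Ed, <- sum_n_R_minus. eapply Rle_trans; [apply sum_n_R_abs|].
    apply Rle_trans with (sum_n (fun k => q ^ S N / (1 - q) * (Rabs (b k) * (r / 2) ^ k)) N).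
    - apply sum_n_R_le. intros k. rewrite <- Rmult_minus_distr_l, Rabs_mult.
      pose proof (geom_tail _ _ q (F ^ k) N Hq (HF0 k) (Hcterm k) (Hcser k)) as Ht.
      apply Rle_trans with (Rabs (b k) * (F ^ k * q ^ S N / (1 - q))).
      + apply Rmult_le_compat_l; [apply Rabs_pos|exact Ht].
      + assert (HFk : F ^ k <= (r / 2) ^ k) by (apply pow_incr; lra).
        assert (Hqq : 0 <= q ^ S N / (1 - q)).
        { apply Rmult_le_pos; [apply pow_le; lra|left; apply Rinv_0_lt_compat; lra]. }
        replace (Rabs (b k) * (F ^ k * q ^ S N / (1 - q)))
          with (q ^ S N / (1 - q) * (Rabs (b k) * F ^ k)) by (unfold Rdiv; rring).
        apply Rmult_le_compat_l; [easy|]. apply Rmult_le_compat_l; [apply Rabs_pos|easy].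
    - rewrite sum_n_R_scal.
      pose proof (is_series_sum_n_abs_le b r B N Hr HB) as Hs2.
      replace (2 * B / (1 - q) * q ^ S N) with (q ^ S N / (1 - q) * (2 * B)) by (unfold Rdiv; rring).
      apply Rmult_le_compat_l; [|easy].
      apply Rmult_le_pos; [apply pow_le; lra|left; apply Rinv_0_lt_compat; lra]. }
  assert (Hz : is_lim_seq (fun N => sum_n (fun k => b k * y ^ k) N - sum_n (fun n => d n * x ^ n) N) 0).
  { apply is_lim_seq_abs_0. apply (is_lim_seq_le_le (fun _ => 0) _ (fun N => 2 * B / (1 - q) * q ^ S N)).
    - intros N. split; [apply Rabs_pos|apply Hdiff].
    - apply is_lim_seq_const.
    - replace 0 with (2 * B / (1 - q) * 0) at 1 by rring.
      apply (is_lim_seq_scal_l (fun N => q ^ S N) (2 * B / (1 - q)) 0).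
      apply (is_lim_seq_incr_1 (fun N => q ^ N)). apply is_lim_seq_geom. rewrite Rabs_pos_eq; lra. }
  assert (Hfin : is_lim_seq (fun N => sum_n (fun k => b k * y ^ k) N
     - (sum_n (fun k => b k * y ^ k) N - sum_n (fun n => d n * x ^ n) N)) (g (f (t0 + x)) - 0)).
  { apply (is_lim_seq_minus' _ _ (g (f (t0 + x))) 0); [exact Hg|exact Hz]. }
  rewrite Rminus_0_r in Hfin.
  change (is_lim_seq (sum_n (fun n => d n * x ^ n)) (g (f (t0 + x)))).
  eapply is_lim_seq_ext; [|exact Hfin]. intros N. cbv beta. rring.
Qed.

(** * Elementary analytic functions *)

Lemma ana_exp (u : R) : ana exp u.
Proof.
  apply (ana_intro _ _ (PS_scal (exp u) (fun n => / INR (fact n))) 1); [lra|]. intros x _.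
  rewrite exp_plus. exact (is_pseries_scal (exp u) _ x _ (Rmult_comm _ _) (is_exp_Reals x)).
Qed.

Lemma ana_entire (a : nat -> R) (g : R -> R) : (forall x, infinite_sum (fun n => a n * x ^ n) (g x)) -> ana g 0.
Proof.
  intros H. apply (ana_intro _ _ a 1); [lra|]. intros x _. rewrite Rplus_0_l.
  rewrite is_pseries_R. apply is_series_Reals, H.
Qed.

(** The series defining [cos] and [sin] are power series in x^2; their sums as functions of y = x^2
    are entire. *)
Definition cos_sq (y : R) : R := proj1_sig (exist_cos y).
Definition sin_sq (y : R) : R := proj1_sig (exist_sin y).

Lemma cos_sq_spec (x : R) : cos x = cos_sq (x ^ 2).
Proof. unfold cos, cos_sq, Rsqr. replace (x ^ 2) with (x * x) by ring. now destruct (exist_cos (x * x)). Qed.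

Lemma sin_sq_spec (x : R) : sin x = x * sin_sq (x ^ 2).
Proof. unfold sin, sin_sq, Rsqr. replace (x ^ 2) with (x * x) by ring. now destruct (exist_sin (x * x)). Qed.

Lemma ana_cos_sq : ana cos_sq 0.
Proof. apply (ana_entire cos_n). intros x. unfold cos_sq. now destruct (exist_cos x). Qed.

Lemma ana_sin_sq : ana sin_sq 0.
Proof. apply (ana_entire sin_n). intros x. unfold sin_sq. now destruct (exist_sin x). Qed.

Lemma ana_sqr (t0 : R) : ana (fun x => x ^ 2) t0.
Proof.
  apply (ana_ext (fun x => x * x) _ t0 1); [lra|intros; ring|]. apply ana_mult; apply ana_id.
Qed.

Lemma ana_shift (f : R -> R) (t0 : R) : ana f t0 <-> ana (fun x => f (t0 + x)) 0.
Proof.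
  split; intros (a & r & M & Hr & HM & H); exists a, r, M; (split; [easy|]); (split; [easy|]);
    intros x Hx; specialize (H x Hx); now rewrite Rplus_0_l in *.
Qed.

Lemma ana_cos0 : ana cos 0.
Proof.
  apply (ana_ext (fun x => cos_sq (x ^ 2)) _ 0 1); [lra|intros; symmetry; apply cos_sq_spec|].
  apply (ana_comp cos_sq (fun x => x ^ 2)); [|apply ana_sqr].
  replace (0 ^ 2) with 0 by ring. apply ana_cos_sq.
Qed.

Lemma ana_sin0 : ana sin 0.
Proof.
  apply (ana_ext (fun x => x * sin_sq (x ^ 2)) _ 0 1); [lra|intros; symmetry; apply sin_sq_spec|].
  apply ana_mult; [apply ana_id|].
  apply (ana_comp sin_sq (fun x => x ^ 2)); [|apply ana_sqr].
  replace (0 ^ 2) with 0 by ring. apply ana_sin_sq.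
Qed.

Lemma ana_cos (u : R) : ana cos u.
Proof.
  apply ana_shift. apply (ana_ext (fun x => cos u * cos x + (- sin u) * sin x) _ 0 1); [lra| |].
  - intros x _. rewrite cos_plus. ring.
  - apply ana_plus; apply ana_mult; [apply ana_const|apply ana_cos0|apply ana_const|apply ana_sin0].
Qed.

Lemma ana_sin (u : R) : ana sin u.
Proof.
  apply ana_shift. apply (ana_ext (fun x => sin u * cos x + cos u * sin x) _ 0 1); [lra| |].
  - intros x _. rewrite sin_plus. ring.
  - apply ana_plus; apply ana_mult; [apply ana_const|apply ana_cos0|apply ana_const|apply ana_sin0].
Qed.

Lemma ana_inv (u : R) : u <> 0 -> ana Rinv u.
Proof.
  intros Hu. apply (ana_intro _ _ (fun n => / u * (- / u) ^ n) (Rabs u)); [now apply Rabs_pos_lt|].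
  intros x Hx. rewrite is_pseries_R.
  assert (Hq : Rabs (- / u * x) < 1).
  { rewrite Rabs_mult, Rabs_Ropp, Rabs_inv. apply Rmult_lt_reg_l with (Rabs u); [now apply Rabs_pos_lt|].
    rewrite <- Rmult_assoc, Rinv_r, Rmult_1_l, Rmult_1_r by now apply Rabs_no_R0. easy. }
  assert (Hux : u + x <> 0).
  { intros E. replace x with (- u) in Hx by lra. rewrite Rabs_Ropp in Hx. lra. }
  pose proof (is_series_scal (K := R_AbsRing) (V := R_NormedModule) (/ u) _ _ (is_series_geom _ Hq)) as H.
  replace (/ (u + x)) with (scal (/ u) (/ (1 - - / u * x))).
  - eapply is_series_ext; [|exact H]. intros n. unfold scal; simpl. unfold mult; simpl.
    rewrite Rpow_mult_distr. ring.
  - unfold scal; simpl. unfold mult; simpl. field. repeat split; easy.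
Qed.

Lemma ana_continuous (f : R -> R) (t0 : R) : ana f t0 -> continuity_pt f t0.
Proof.
  intros (a & r & M & Hr & HM & H).
  assert (Hd : ex_derive (fun x => PSeries a (x - t0)) t0).
  { apply (ex_derive_comp (V := R_NormedModule) (PSeries a) (fun x => x - t0)).
    - rewrite Rminus_diag. eexists. apply is_derive_PSeries.
      apply (CV_radius_ge a r M HM Hr). rewrite Rabs_R0. lra.
    - auto_derive. easy. }
  apply (continuity_pt_ext_loc (fun x => PSeries a (x - t0))).
  - exists (mkposreal r Hr). intros y Hy. unfold ball in Hy; simpl in Hy. unfold AbsRing_ball in Hy; simpl in Hy.
    unfold minus, plus, opp, abs in Hy; simpl in Hy.
    specialize (H (y - t0) Hy). replace (t0 + (y - t0)) with y in H by rring.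
    now apply is_pseries_unique.
  - now apply ex_derive_continuity_pt.
Qed.

(* The binomial series [b] satisfies [2 (u + x) y' = y], so [y ^ 2 / (u + x)]
   is constant. *)
Lemma ana_sqrt (u : R) : 0 < u -> ana sqrt u.
Proof.
  intros Hu.
  (* The coefficients sqrt u binom(1/2, n) / u^n, in recursive form. *)
  set (b := fix b (n : nat) := match n with O => sqrt u | S k => b k * (1 / 2 - INR k) / ((INR k + 1) * u) end).
  assert (HbS : forall n, b (S n) = b n * (1 / 2 - INR n) / ((INR n + 1) * u)) by easy.
  assert (Hb0 : b O = sqrt u) by easy. clearbody b.
  assert (HM : forall n, Rabs (b n) * u ^ n <= sqrt u).
  { induction n as [|n IH].
    - rewrite Hb0, Rabs_pos_eq by apply sqrt_pos. simpl. lra.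
    - rewrite HbS. pose proof (pos_INR n). unfold Rdiv.
      rewrite !Rabs_mult, Rabs_inv, (Rabs_pos_eq ((INR n + 1) * u)) by nra.
      assert (Hq : Rabs (1 * / 2 - INR n) <= INR n + 1) by (apply Rabs_le; lra).
      replace (Rabs (b n) * Rabs (1 * / 2 - INR n) * / ((INR n + 1) * u) * u ^ S n)
        with (Rabs (b n) * u ^ n * (Rabs (1 * / 2 - INR n) / (INR n + 1))) by (simpl; field; lra).
      rewrite <- (Rmult_1_r (sqrt u)). apply Rmult_le_compat; try easy.
      + apply Rmult_le_pos; [apply Rabs_pos|apply pow_le; lra].
      + apply Rmult_le_pos; [apply Rabs_pos|left; apply Rinv_0_lt_compat; lra].
      + apply Rmult_le_reg_r with (INR n + 1); [lra|]. unfold Rdiv. rewrite Rmult_assoc, Rinv_l by lra. lra. }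
  assert (Hrad := CV_radius_ge b u _ HM Hu).
  set (G := PSeries b). set (G' := PSeries (PS_derive b)).
  assert (HG : forall x, Rabs x < u -> is_derive G x (G' x)).
  { intros x Hx. apply is_derive_PSeries. now apply Hrad. }
  assert (Hode : forall x, Rabs x < u -> 2 * (u + x) * G' x = G x).
  { intros x Hx.
    assert (S0 : is_pseries b x (G x)) by (apply PSeries_correct, CV_radius_inside; now apply Hrad).
    assert (S1 : is_pseries (PS_derive b) x (G' x)).
    { apply PSeries_correct, CV_radius_inside. rewrite (CV_radius_derive b). now apply Hrad. }
    pose proof (is_pseries_incr_1 _ _ _ S1) as S2.
    pose proof (is_pseries_scal (2 * u) _ x _ (Rmult_comm _ _) S1) as S3.
    pose proof (is_pseries_scal 2 _ x _ (Rmult_comm _ _) S2) as S4.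
    pose proof (is_pseries_plus _ _ _ _ _ S3 S4) as S5.
    assert (Heq : forall n, PS_plus (PS_scal (2 * u) (PS_derive b)) (PS_scal 2 (PS_incr_1 (PS_derive b))) n = b n).
    { intros n. unfold PS_plus, PS_scal, PS_incr_1, PS_derive, plus, scal, zero; simpl.
      unfold mult; simpl. destruct n as [|n].
      - rewrite HbS. simpl. field. lra.
      - rewrite !HbS. pose proof (pos_INR n). rewrite !S_INR.
        change (match n with 0%nat => 1 | S _ => INR n + 1 end) with (INR (S n)). rewrite S_INR.
        field. lra. }
    pose proof (is_pseries_ext _ _ _ _ Heq S5) as S6.
    apply is_pseries_unique in S6.
    change (G x = 2 * u * G' x + 2 * (x * G' x)) in S6. rewrite S6. ring. }
  assert (Hsq : forall x, Rabs x < u -> G x ^ 2 = u + x).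
  { intros x Hx.
    assert (Hder : forall y, Rabs y < u -> is_derive (fun y => G y ^ 2 * / (u + y)) y 0).
    { intros y Hy. assert (Huy : u + y <> 0).
      { apply Rabs_def2 in Hy. lra. }
      assert (H2 : is_derive (fun y => G y * G y) y (G' y * G y + G y * G' y)).
      { apply (is_derive_mult G G y _ _ (HG y Hy) (HG y Hy)). intros; apply Rmult_comm. }
      assert (H3 : is_derive (fun y => / (u + y)) y (- / (u + y) ^ 2)).
      { auto_derive; [easy|]. field. easy. }
      replace 0 with ((G' y * G y + G y * G' y) * / (u + y) + (G y * G y) * (- / (u + y) ^ 2)).
      - apply (is_derive_ext (fun y => G y * G y * / (u + y))); [intros t; simpl; ring|].
        apply (is_derive_mult (fun y => G y * G y) (fun y => / (u + y)) y _ _ H2 H3).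
        intros; apply Rmult_comm.
      - rewrite <- (Hode y Hy) at 2 3 4. rewrite <- (Hode y Hy). field. easy. }
    destruct (MVT_gen (fun y => G y ^ 2 * / (u + y)) 0 x (fun _ => 0)) as (c & _ & Hc).
    - intros y Hy. apply Hder. apply Rabs_def2 in Hx. unfold Rmin, Rmax in Hy.
      destruct (Rle_dec 0 x); apply Rabs_def1; lra.
    - intros y Hy. apply ex_derive_continuity_pt. exists 0. apply Hder. apply Rabs_def2 in Hx.
      unfold Rmin, Rmax in Hy. destruct (Rle_dec 0 x); apply Rabs_def1; lra.
    - assert (H0 : G 0 = sqrt u) by (unfold G; now rewrite PSeries_0).
      rewrite H0, pow2_sqrt, Rplus_0_r, Rinv_r in Hc by lra.
      assert (Hux : u + x <> 0) by (apply Rabs_def2 in Hx; lra).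
      apply Rmult_eq_reg_r with (/ (u + x)); [|now apply Rinv_neq_0_compat].
      rewrite Rinv_r by easy. lra. }
  assert (HG0 : 0 < G 0) by (unfold G; rewrite PSeries_0, Hb0; now apply sqrt_lt_R0).
  destruct (cont_pos G 0) as (d & Hd & Hpos); [|easy|].
  { apply ex_derive_continuity_pt. eexists. apply HG. rewrite Rabs_R0. easy. }
  apply (ana_intro _ _ b (Rmin u d)); [now apply Rmin_pos|]. intros x Hx.
  pose proof (Rmin_l u d). pose proof (Rmin_r u d).
  replace (sqrt (u + x)) with (G x).
  - apply PSeries_correct, CV_radius_inside, Hrad. lra.
  - symmetry. rewrite <- Hsq by lra. apply sqrt_pow2. left. apply Hpos. rewrite Rminus_0_r. lra.
Qed.

Lemma real_analytic_pair (u v : R -> R) (t0 : R) : ana u t0 -> ana v t0 ->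
  real_analytic_at (fun t => (u t, v t)) t0.
Proof.
  intros (a & r & M & Hr & _ & Hu) (b & r' & M' & Hr' & _ & Hv).
  exists (fun n => (a n, b n)). assert (Hm : 0 < Rmin r r') by now apply Rmin_pos.
  exists (mkposreal _ Hm). intros t Ht. pose proof (Rmin_l r r'). pose proof (Rmin_r r r').
  assert (Ht' : Rabs (t - t0) < Rmin r r') by exact Ht.
  specialize (Hu (t - t0) ltac:(lra)). specialize (Hv (t - t0) ltac:(lra)).
  replace (t0 + (t - t0)) with t in Hu, Hv by rring.
  assert (Hsum : forall n, sum_n (fun k => scal (pow_n (t - t0) k) ((a k, b k) : C_R_NormedModule)) n =
     (sum_n (fun k => scal (pow_n (t - t0) k) (a k)) n, sum_n (fun k => scal (pow_n (t - t0) k) (b k)) n)).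
  { induction n as [|n IH]; [now rewrite !sum_O|]. rewrite !sum_Sn, IH. reflexivity. }
  intros P [e He].
  destruct (Hu _ (locally_ball (u t) e)) as [N1 H1]. destruct (Hv _ (locally_ball (v t) e)) as [N2 H2].
  exists (max N1 N2). intros n Hn. rewrite Hsum. apply He. split; [apply H1|apply H2]; lia.
Qed.

(** * The curve parametrized by [gamma] *)

Definition cos_tail (y : R) : R := PSeries (PS_decr_n cos_n 2) y.

Lemma cos_n_pseries (y : R) : is_pseries cos_n y (cos_sq y).
Proof.
  rewrite is_pseries_R. apply is_series_Reals. unfold cos_sq. now destruct (exist_cos y).
Qed.

Lemma cos_sq_tail (y : R) : cos_sq y = 1 - y / 2 + y ^ 2 * cos_tail y.
Proof.
  rewrite <- (is_pseries_unique _ _ _ (cos_n_pseries y)).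
  rewrite (PSeries_decr_n cos_n 1) by (eexists; apply cos_n_pseries).
  unfold cos_tail. simpl sum_f_R0. unfold cos_n at 1 2. simpl. field.
Qed.

Lemma ana_cos_tail : ana cos_tail 0.
Proof.
  apply (ana_intro _ _ (PS_decr_n cos_n 2) 1); [lra|]. intros x _. rewrite Rplus_0_l.
  apply PSeries_correct, (ex_pseries_decr_n (K := R_AbsRing) (V := R_NormedModule)).
  - destruct (Req_dec x 0) as [->|Hx]; [now left|right]. exists (/ x). now apply Rinv_l.
  - eexists. apply cos_n_pseries.
Qed.

(** The quotient (x^2 - sin^2 x) / x^4, extended over 0 by 1/3: in cos (2 x) = 1 - 2 sin^2 x the
    left side is expanded to second order in 4 x^2. *)
Definition gap (x : R) : R := 8 * cos_tail (4 * x ^ 2).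

Lemma gap_spec (x : R) : gap x * x ^ 4 = x ^ 2 - sin x ^ 2.
Proof.
  pose proof (cos_sq_spec (2 * x)) as H. replace ((2 * x) ^ 2) with (4 * x ^ 2) in H by ring.
  rewrite cos_sq_tail, cos_2a_sin in H. unfold gap. nra.
Qed.

Lemma gap_pos (x : R) : 0 < gap x.
Proof.
  destruct (Req_dec x 0) as [->|Hx].
  - unfold gap, cos_tail. replace (4 * 0 ^ 2) with 0 by ring. rewrite PSeries_0.
    unfold PS_decr_n, cos_n. simpl. lra.
  - assert (Hp : forall y, 0 < y -> 0 < y ^ 2 - sin y ^ 2).
    { intros y Hy. pose proof (gamma_eq_lt 0 y (Rle_refl 0) Hy) as H. rewrite sin_0 in H. lra. }
    assert (H : 0 < x ^ 2 - sin x ^ 2).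
    { destruct (Rtotal_order x 0) as [H|[H|H]]; [|easy|now apply Hp].
      specialize (Hp (- x) ltac:(lra)). rewrite sin_neg in Hp. nra. }
    rewrite <- gap_spec in H. assert (H4 : 0 < x ^ 4).
    { replace (x ^ 4) with ((x * x) * (x * x)) by ring.
      assert (0 < x * x) by nra. nra. }
    nra.
Qed.

Lemma ana_gap (t0 : R) : ana gap t0.
Proof.
  destruct (Req_dec t0 0) as [->|Ht].
  - unfold gap. apply ana_mult; [apply ana_const|].
    apply (ana_comp cos_tail (fun x => 4 * x ^ 2)).
    + replace (4 * 0 ^ 2) with 0 by ring. apply ana_cos_tail.
    + apply ana_mult; [apply ana_const|apply ana_sqr].
  - apply (ana_ext (fun x => (x * x + (-1) * (sin x * sin x)) * / (x * x * (x * x))) _ t0 (Rabs t0)).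
    + now apply Rabs_pos_lt.
    + intros x Hx. assert (Hx0 : x <> 0).
      { intros ->. rewrite Rminus_0_l, Rabs_Ropp in Hx. lra. }
      replace (x * x + -1 * (sin x * sin x)) with (x ^ 2 - sin x ^ 2) by ring.
      rewrite <- gap_spec. field. easy.
    + apply ana_mult.
      * apply ana_plus; [apply ana_mult; apply ana_id|]. apply ana_mult; [apply ana_const|].
        apply ana_mult; apply ana_sin.
      * apply (ana_comp Rinv (fun x => x * x * (x * x))).
        { apply ana_inv. repeat apply Rmult_integral_contrapositive_currified; easy. }
        repeat apply ana_mult; apply ana_id.
Qed.

Definition sinc (x : R) : R := sin_sq (x ^ 2).

Lemma sinc_spec (x : R) : x * sinc x = sin x.
Proof. unfold sinc. now rewrite <- sin_sq_spec. Qed.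

Lemma sinc_pos (x : R) : Rabs x < PI -> 0 < sinc x.
Proof.
  intros Hx. apply Rabs_def2 in Hx. destruct (Req_dec x 0) as [->|Hx0].
  - unfold sinc, sin_sq. replace (0 ^ 2) with 0 by ring. destruct (exist_sin 0) as [l Hl]. simpl.
    apply is_series_Reals in Hl. rewrite <- is_pseries_R in Hl. apply is_pseries_unique in Hl.
    rewrite PSeries_0 in Hl. rewrite <- Hl. unfold sin_n. simpl. lra.
  - pose proof (sinc_spec x) as H. destruct (Rtotal_order x 0) as [H0|[H0|H0]]; [|easy|].
    + assert (0 < sin (- x)) by (apply sin_gt_0; lra). rewrite sin_neg in *. nra.
    + assert (0 < sin x) by (apply sin_gt_0; lra). nra.
Qed.

Lemma ana_sinc (t0 : R) : ana sinc t0.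
Proof.
  destruct (Req_dec t0 0) as [->|Ht].
  - apply (ana_comp sin_sq (fun x => x ^ 2)); [|apply ana_sqr].
    replace (0 ^ 2) with 0 by ring. apply ana_sin_sq.
  - apply (ana_ext (fun x => sin x * / x) _ t0 (Rabs t0)).
    + now apply Rabs_pos_lt.
    + intros x Hx. assert (Hx0 : x <> 0).
      { intros ->. rewrite Rminus_0_l, Rabs_Ropp in Hx. lra. }
      rewrite <- sinc_spec. field. easy.
    + apply ana_mult; [apply ana_sin|]. now apply ana_inv.
Qed.

(** The inverse function of [gamma]. Near 0 [gamma] behaves like a square root, so only this
    direction is analytic there. *)
Definition theta (x : R) : R := x ^ 2 * sqrt (gap x).

(** This is [radius (theta x) x] with the common factors x cancelled, which gives it a meaning at x
    = 0. *)
Definition arc_radius (x : R) : R :=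
  (1 + x * sqrt (gap x)) * / sinc x * exp ((1 + -1 * (x * sqrt (gap x))) * (cos x * / sinc x)).

Definition arc (x : R) : C := polar (arc_radius x) (theta x).

Lemma ana_arc (t0 : R) : Rabs t0 < PI ->
  ana (fun x => Re (arc x)) t0 /\ ana (fun x => Im (arc x)) t0.
Proof.
  intros Ht.
  assert (Hs : ana (fun x => sqrt (gap x)) t0).
  { apply (ana_comp sqrt gap); [apply ana_sqrt, gap_pos|apply ana_gap]. }
  assert (Hxs : ana (fun x => x * sqrt (gap x)) t0) by (apply ana_mult; [apply ana_id|easy]).
  assert (Hi : ana (fun x => / sinc x) t0).
  { apply (ana_comp Rinv sinc); [|apply ana_sinc]. apply ana_inv. apply Rgt_not_eq, sinc_pos, Ht. }
  assert (Hth : ana theta t0) by (apply ana_mult; [apply ana_sqr|easy]).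
  assert (HR : ana arc_radius t0).
  { apply ana_mult.
    - apply ana_mult; [|easy]. apply ana_plus; [apply ana_const|easy].
    - apply (ana_comp exp); [apply ana_exp|]. apply ana_mult.
      + apply ana_plus; [apply ana_const|]. apply ana_mult; [apply ana_const|easy].
      + apply ana_mult; [apply ana_cos|easy]. }
  split; (apply ana_mult; [easy|]).
  - apply (ana_comp cos theta); [apply ana_cos|easy].
  - apply (ana_comp sin theta); [apply ana_sin|easy].
Qed.

Lemma theta_sqr (x : R) : theta x ^ 2 = x ^ 2 - sin x ^ 2.
Proof.
  unfold theta. rewrite Rpow_mult_distr, pow2_sqrt by (left; apply gap_pos).
  rewrite <- gap_spec. ring.
Qed.

Lemma theta_pos (x : R) : x <> 0 -> 0 < theta x.
Proof.
  intros Hx. apply Rmult_lt_0_compat; [|apply sqrt_lt_R0, gap_pos].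
  assert (0 < x * x) by nra. simpl. lra.
Qed.

Lemma theta_0 : theta 0 = 0.
Proof. unfold theta. ring. Qed.

Lemma theta_nonneg (x : R) : 0 <= theta x.
Proof. destruct (Req_dec x 0) as [->|H]; [rewrite theta_0; lra|left; now apply theta_pos]. Qed.

Lemma theta_lt (x y : R) : 0 <= x -> x < y -> theta x < theta y.
Proof.
  intros Hx Hxy. pose proof (gamma_eq_lt x y Hx Hxy) as H. rewrite <- !theta_sqr in H.
  pose proof (theta_nonneg x). pose proof (theta_nonneg y). nra.
Qed.

Lemma theta_inj (x y : R) : 0 <= x -> 0 <= y -> theta x = theta y -> x = y.
Proof.
  intros Hx Hy H. destruct (Rtotal_order x y) as [H1|[H1|H1]]; [|easy|].
  - pose proof (theta_lt x y Hx H1). lra.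
  - pose proof (theta_lt y x Hy H1). lra.
Qed.

Lemma theta_bound (x : R) : 0 < x <= 1 / 5 -> 0 < theta x < PI /\ theta x <= 1 / 40.
Proof.
  intros Hx. pose proof (theta_pos x ltac:(lra)).
  pose proof (angle_bounds x (theta x) Hx ltac:(lra) (eq_sym (theta_sqr x))).
  pose proof PI2_3_2. assert (x ^ 2 <= 1 / 25) by nra. lra.
Qed.

Lemma gamma_theta (x : R) : 0 < x <= 1 / 5 -> gamma (theta x) = x.
Proof.
  intros Hx. destruct (theta_bound x Hx) as [Ht _].
  destruct (gamma_eq_unique (theta x) Ht) as (g & _ & Hu).
  rewrite <- (Hu (gamma (theta x)) (gamma_spec _ Ht)). apply Hu. split; [lra|].
  symmetry. apply theta_sqr.
Qed.

Lemma theta_gamma (t : R) : 0 < t < PI -> theta (gamma t) = t.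
Proof.
  intros Ht. destruct (gamma_spec t Ht) as [Hg He]. rewrite <- theta_sqr in He.
  pose proof (theta_pos (gamma t) ltac:(lra)). nra.
Qed.

Lemma gamma_lt (t x : R) : 0 < t < theta x -> 0 < x <= 1 / 5 -> gamma t < x.
Proof.
  intros Ht Hx. destruct (theta_bound x Hx) as [Hb _].
  destruct (Rlt_le_dec (gamma t) x) as [H|H]; [easy|exfalso].
  pose proof (theta_gamma t ltac:(lra)) as E. destruct H as [H|H].
  - pose proof (theta_lt x (gamma t) ltac:(lra) H). lra.
  - rewrite <- H in E. lra.
Qed.

Lemma arc_radius_eq (x : R) : 0 < x < PI -> arc_radius x = radius (theta x) x.
Proof.
  intros Hx. unfold arc_radius, radius, theta, cot. rewrite <- (sinc_spec x).
  assert (Hs : 0 < sinc x) by (apply sinc_pos, Rabs_def1; lra).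
  f_equal; [field; lra|]. f_equal. field. lra.
Qed.

Lemma arc_0 : arc 0 = RtoC (exp 1).
Proof.
  unfold arc. rewrite theta_0. unfold arc_radius.
  assert (Hs : sinc 0 = 1).
  { unfold sinc, sin_sq. replace (0 ^ 2) with 0 by ring. destruct (exist_sin 0) as [l Hl]. simpl.
    apply is_series_Reals in Hl. rewrite <- is_pseries_R in Hl. apply is_pseries_unique in Hl.
    rewrite PSeries_0 in Hl. rewrite <- Hl. unfold sin_n. simpl. field. }
  rewrite Hs, Rmult_0_l, cos_0, Rinv_1.
  replace ((1 + -1 * 0) * (1 * 1)) with 1 by ring. cext; rewrite ?cos_0, ?sin_0; ring.
Qed.

Lemma arc_radius_pos (x : R) : 0 <= x < PI -> 0 < arc_radius x.
Proof.
  intros Hx. unfold arc_radius. assert (0 < sinc x) by (apply sinc_pos; rewrite Rabs_pos_eq; lra).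
  pose proof (sqrt_pos (gap x)).
  apply Rmult_lt_0_compat; [apply Rmult_lt_0_compat; [nra|now apply Rinv_0_lt_compat]|apply exp_pos].
Qed.

Lemma arc_Lambda_hat (x : R) : 0 <= x <= 1 / 5 -> arc x = Lambda_hat (theta x).
Proof.
  intros Hx. pose proof PI2_3_2. destruct (proj1 Hx) as [H0|H0].
  - destruct (theta_bound x ltac:(lra)) as [Ht _].
    rewrite Lambda_hat_polar, gamma_theta by lra. unfold arc. now rewrite arc_radius_eq by lra.
  - rewrite <- H0, arc_0, theta_0. unfold Lambda_hat. now destruct (Req_EM_T 0 0).
Qed.

(** * The argument in the right half-plane *)

Definition arg (z : C) : R := atan (Im z / Re z).

Lemma arg_polar (r t : R) : 0 < r -> - PI / 2 < t < PI / 2 -> arg (polar r t) = t.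
Proof.
  intros Hr Ht. unfold arg. autorewrite with cplx.
  assert (0 < cos t) by (apply cos_gt_0; lra).
  replace (r * sin t / (r * cos t)) with (tan t) by (unfold tan; field; lra).
  apply atan_tan. lra.
Qed.

Lemma polar_arg (z : C) : 0 < Re z -> z = polar (Cmod z) (arg z).
Proof.
  intros Hz. unfold arg. pose proof (Cmod_sqr z) as Hsq.
  set (q := Im z / Re z). assert (Hq : Im z = q * Re z) by (unfold q; field; lra).
  assert (Hs : sqrt (1 + q²) = Cmod z / Re z).
  { apply sqrt_lem_1.
    - pose proof (Rle_0_sqr q). lra.
    - apply Rmult_le_pos; [apply Cmod_ge_0|left; now apply Rinv_0_lt_compat].
    - unfold Rsqr. replace (Cmod z / Re z * (Cmod z / Re z)) with (Cmod z ^ 2 / (Re z) ^ 2) by (field; lra).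
      rewrite Hsq, Hq. field. lra. }
  assert (Hm : 0 < Cmod z) by (pose proof (re_le_Cmod z); pose proof (Rle_abs (Re z)); lra).
  cext; rewrite ?cos_atan, ?sin_atan, Hs; field_simplify; try lra; rewrite Hq; field; lra.
Qed.

Lemma arg_continuous (z : C) (e : R) : 0 < Re z -> 0 < e ->
  exists d, 0 < d /\ forall w, Cmod (w - z) < d -> 0 < Re w /\ Rabs (arg w - arg z) < e.
Proof.
  intros Hz He.
  destruct (continuity_pt_eps atan (Im z / Re z) e) as (d1 & Hd1 & H1); [|easy|].
  { apply ex_derive_continuity_pt. eexists. apply is_derive_atan. }
  set (x := Re z) in *. set (q := Im z / x) in *.
  assert (Hq : Im z = q * x) by (unfold q; field; lra).
  exists (Rmin (x / 2) (x / 2 * d1 / (2 * (1 + Rabs q)))).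
  pose proof (Rabs_pos q) as Hq0.
  assert (Hb : 0 < x / 2 * d1 / (2 * (1 + Rabs q))).
  { apply Rdiv_lt_0_compat; [|lra]. apply Rmult_lt_0_compat; lra. }
  split; [apply Rmin_pos; lra|]. intros w Hw.
  pose proof (Rmin_l (x / 2) (x / 2 * d1 / (2 * (1 + Rabs q)))).
  pose proof (Rmin_r (x / 2) (x / 2 * d1 / (2 * (1 + Rabs q)))).
  set (m := Cmod (w - z)) in *.
  pose proof (re_le_Cmod (w - z)) as Hre. pose proof (im_le_Cmod (w - z)) as Him.
  rewrite Re_sub in Hre. rewrite Im_sub in Him. fold m x in Hre. fold m in Him.
  assert (Hrew : x / 2 < Re w) by (apply Rabs_le_between in Hre; lra).
  split; [lra|]. apply H1. fold q.
  replace (Im w / Re w - q) with (((Im w - Im z) - q * (Re w - x)) / Re w) by (rewrite Hq; field; lra).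
  unfold Rdiv. rewrite Rabs_mult, Rabs_inv, (Rabs_pos_eq (Re w)) by lra.
  assert (Hnum : Rabs (Im w - Im z - q * (Re w - x)) <= m * (1 + Rabs q)).
  { unfold Rminus at 1. eapply Rle_trans; [apply Rabs_triang|]. rewrite Rabs_Ropp, Rabs_mult. nra. }
  assert (Hmd : m * (1 + Rabs q) <= x / 2 * d1 / 2).
  { apply Rle_trans with (x / 2 * d1 / (2 * (1 + Rabs q)) * (1 + Rabs q)).
    - apply Rmult_le_compat_r; lra.
    - right. field. lra. }
  apply Rmult_lt_reg_r with (Re w); [lra|]. rewrite Rmult_assoc, Rinv_l, Rmult_1_r by lra.
  assert (x / 2 * d1 <= Re w * d1) by (apply Rmult_le_compat_r; lra). nra.
Qed.

Lemma arg_conj (z : C) : arg (Cconj z) = - arg z.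
Proof.
  unfold arg. rewrite Re_conj, Im_conj. unfold Rdiv. rewrite <- Ropp_mult_distr_l. apply atan_opp.
Qed.

(** * The boundary near [e] *)

(** Put x = t / g. In the exponent (g + t) / sin g contributes about x + g^2 / 6 and (g - t) cot g
    about 1 - x - g^2 / 3. The terms x cancel and a loss of order g^2 remains, which by
    [angle_bounds] is comparable to t. *)
Lemma radius_gamma_le (t : R) : 0 < t < theta (1 / 5) -> radius t (gamma t) <= exp (1 - t / 12).
Proof.
  intros Ht. destruct (theta_bound (1 / 5) ltac:(lra)) as [Hb _].
  pose proof (gamma_lt t (1 / 5) Ht ltac:(lra)) as Hg5.
  destruct (gamma_spec t ltac:(lra)) as [Hg He]. set (g := gamma t) in *.
  pose proof (angle_bounds g t ltac:(lra) ltac:(lra) He) as Hab.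
  assert (Hg2 : g ^ 2 <= 1 / 25) by nra.
  assert (Hs0 : g * (1 - g ^ 2 / 6) <= sin g) by (pose proof (sin_ge_3 g ltac:(lra)); nra).
  assert (Hs : 0 < sin g) by nra.
  set (x := t / g). assert (Htx : t = x * g) by (unfold x; field; lra).
  assert (Hx : 0 <= x <= 12 / 100) by (split; nra).
  unfold radius. set (y := g ^ 2 / 6).
  assert (H1 : (g + t) / sin g <= exp x * exp (y / (1 - y))).
  { assert (Hy : y <= 1 / 150) by (unfold y; lra).
    apply Rle_trans with ((1 + x) * (/ (1 - y))).
    - rewrite Htx. replace (g + x * g) with ((1 + x) * g) by ring. unfold Rdiv. rewrite Rmult_assoc.
      apply Rmult_le_compat_l; [lra|]. apply Rmult_le_reg_r with (sin g * (1 - y)); [nra|].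
      replace (g * / sin g * (sin g * (1 - y))) with (g * (1 - y)) by (field; lra).
      replace (/ (1 - y) * (sin g * (1 - y))) with (sin g) by (field; lra). exact Hs0.
    - apply Rmult_le_compat; [lra|left; apply Rinv_0_lt_compat; lra|apply exp_ineq1_le|].
      replace (/ (1 - y)) with (1 + y / (1 - y)) by (field; lra). apply exp_ineq1_le. }
  assert (H2 : (g - t) * cot g <= (1 - x) * (1 - g ^ 2 / 4)).
  { unfold cot. rewrite Htx. replace ((g - x * g) * (cos g / sin g)) with ((1 - x) * (g * cos g / sin g))
      by (field; lra).
    apply Rmult_le_compat_l; [lra|]. apply Rmult_le_reg_r with (sin g); [easy|].
    unfold Rdiv at 1. rewrite Rmult_assoc, Rinv_l, Rmult_1_r by lra.
    pose proof (cos_le_4 g ltac:(lra)).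
    apply Rle_trans with (g * (1 - g ^ 2 / 2 + g ^ 4 / 24)); [apply Rmult_le_compat_l; lra|].
    apply Rle_trans with ((1 - g ^ 2 / 4) * (g * (1 - g ^ 2 / 6))); [|apply Rmult_le_compat_l; lra].
    replace ((1 - g ^ 2 / 4) * (g * (1 - g ^ 2 / 6))) with (g * (1 - 5 / 12 * g ^ 2 + g ^ 4 / 24)) by field.
    apply Rmult_le_compat_l; lra. }
  apply Rle_trans with (exp x * exp (y / (1 - y)) * exp ((1 - x) * (1 - g ^ 2 / 4))).
  - apply Rmult_le_compat; [|left; apply exp_pos|easy|now apply exp_le].
    apply Rmult_le_pos; [lra|left; now apply Rinv_0_lt_compat].
  - rewrite <- !exp_plus. apply exp_le.
    assert (Hyy : y / (1 - y) <= 101 / 600 * g ^ 2).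
    { assert (Hy : y <= 1 / 150) by (unfold y; lra).
      apply Rmult_le_reg_r with (1 - y); [lra|]. unfold Rdiv at 1. rewrite Rmult_assoc, Rinv_l by lra.
      unfold y in *. nra. }
    assert (Hxg : x * g ^ 2 <= 12 / 100 * g ^ 2) by (apply Rmult_le_compat_r; [apply pow2_ge_0|lra]).
    nra.
Qed.

Lemma radius_gamma_lt_e (t : R) : 0 < t < theta (1 / 5) -> radius t (gamma t) < exp 1.
Proof.
  intros Ht. eapply Rle_lt_trans; [now apply radius_gamma_le|]. apply exp_increasing. lra.
Qed.

Lemma U_infty_conj (z : C) : U_infty z -> U_infty (Cconj z).
Proof.
  intros H. apply locally_Cmod in H. destruct H as (d & Hd & H). apply locally_Cmod.
  exists d. split; [easy|]. intros w Hw. rewrite <- (Cconj_conj w). apply V_infty_conj, H.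
  replace (Cconj w - z)%C with (Cconj (w - Cconj z)) by (cext; ring). now rewrite Cmod_conj.
Qed.

Lemma boundary_U_conj (z : C) : boundary U_infty z -> boundary U_infty (Cconj z).
Proof.
  intros Hz. pose proof (boundary_closure _ _ Hz) as Hcl. destruct Hz as [_ Hint]. split.
  - intros P HP. apply locally_Cmod in HP. destruct HP as (d & Hd & HP).
    destruct (Hcl d Hd) as (w & Hw & Hwz). exists (Cconj w). split; [|now apply U_infty_conj].
    apply HP. replace (Cconj w - Cconj z)%C with (Cconj (w - z)) by (cext; ring). now rewrite Cmod_conj.
  - intros HI. apply Hint. apply locally_Cmod in HI. destruct HI as (d & Hd & HI). apply locally_Cmod.
    exists d. split; [easy|]. intros w Hw. rewrite <- (Cconj_conj w). apply U_infty_conj, HI.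
    replace (Cconj w - Cconj z)%C with (Cconj (w - z)) by (cext; ring). now rewrite Cmod_conj.
Qed.

Lemma U_infty_interior (z : C) : U_infty z -> interior_set U_infty z.
Proof. intros H. apply (locally_locally z V_infty H). Qed.

Lemma V_infty_sector (z : C) (b : R) : 0 < Re z -> Rabs (arg z) < theta (1 / 5) ->
  Rabs (arg z) <= b < PI -> Cmod z <= radius (Rabs (arg z)) b -> V_infty z.
Proof.
  assert (Hup : forall z, 0 < Re z -> 0 < arg z < theta (1 / 5) -> arg z <= b < PI ->
    Cmod z <= radius (arg z) b -> V_infty z).
  { intros w Hw Ht Hb Hr. rewrite (polar_arg w Hw).
    destruct (theta_bound (1 / 5) ltac:(lra)) as [Hb5 _].
    apply V_infty_inside; [lra|left; apply gamma_lt; lra|]. split.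
    - pose proof (re_le_Cmod w). pose proof (Rle_abs (Re w)). lra.
    - eapply Rle_trans; [exact Hr|]. apply radius_le_gamma; lra. }
  intros Hz Ht Hb Hr. destruct (Rtotal_order (arg z) 0) as [H0|[H0|H0]].
  - rewrite Rabs_left in * by easy. rewrite <- (Cconj_conj z). apply V_infty_conj.
    rewrite <- arg_conj in *. apply Hup; rewrite ?Re_conj, ?Cmod_conj; try lra.
    split; [rewrite arg_conj|]; lra.
  - rewrite (polar_arg z Hz), H0. replace (polar (Cmod z) 0) with (RtoC (Cmod z)).
    + apply V_infty_real_pos, Cmod_ge_0.
    + cext; rewrite ?cos_0, ?sin_0; ring.
  - rewrite Rabs_pos_eq in * by lra. apply Hup; auto; lra.
Qed.

(** A fixed angle b takes the place of [gamma]: [radius t b] is at most the value at [gamma t] and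
    is visibly continuous in t, so a strict inequality persists nearby and no continuity of [gamma]
    has to be proved. *)
Lemma U_infty_sector (z : C) (b : R) : 0 < Re z -> Rabs (arg z) < theta (1 / 5) ->
  Rabs (arg z) < b < PI -> Cmod z < radius (Rabs (arg z)) b -> U_infty z.
Proof.
  intros Hz Ht Hb Hr. pose proof (Rabs_pos (arg z)).
  assert (Hc : continuity_pt (fun t => radius t b) (Rabs (arg z))).
  { unfold radius. cont_auto. exact I. }
  destruct (continuity_pt_eps _ _ ((radius (Rabs (arg z)) b - Cmod z) / 2) Hc) as (d1 & Hd1 & H1); [lra|].
  set (e := Rmin d1 (Rmin (theta (1 / 5) - Rabs (arg z)) (b - Rabs (arg z)))).
  assert (He : 0 < e) by (repeat apply Rmin_pos; lra).
  assert (He' : e <= d1 /\ e <= theta (1 / 5) - Rabs (arg z) /\ e <= b - Rabs (arg z)).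
  { unfold e. pose proof (Rmin_l d1 (Rmin (theta (1 / 5) - Rabs (arg z)) (b - Rabs (arg z)))).
    pose proof (Rmin_r d1 (Rmin (theta (1 / 5) - Rabs (arg z)) (b - Rabs (arg z)))).
    pose proof (Rmin_l (theta (1 / 5) - Rabs (arg z)) (b - Rabs (arg z))).
    pose proof (Rmin_r (theta (1 / 5) - Rabs (arg z)) (b - Rabs (arg z))). lra. }
  destruct (arg_continuous z e Hz He) as (d2 & Hd2 & H2).
  apply locally_Cmod. exists (Rmin d2 ((radius (Rabs (arg z)) b - Cmod z) / 2)).
  split; [apply Rmin_pos; lra|]. intros w Hw.
  pose proof (Rmin_l d2 ((radius (Rabs (arg z)) b - Cmod z) / 2)).
  pose proof (Rmin_r d2 ((radius (Rabs (arg z)) b - Cmod z) / 2)).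
  destruct (H2 w ltac:(lra)) as [Hrew Harg].
  pose proof (Rabs_triang_inv2 (arg w) (arg z)) as Htri.
  specialize (H1 (Rabs (arg w)) ltac:(lra)). apply Rabs_def2 in H1.
  apply Rabs_le_between in Htri.
  apply (V_infty_sector w b); [easy|lra|split; lra|].
  pose proof (Cmod_triangle_sub w z). lra.
Qed.

(** At argument 0 the thresholds satisfy [radius 0 b] >= e^(1 - b^2 / 2), which tends to e as b
    tends to 0. *)
Lemma U_infty_real (x : R) : 0 < x < exp 1 -> U_infty (RtoC x).
Proof.
  intros Hx. pose proof PI2_3_2 as Hpi.
  destruct (theta_bound (1 / 5) ltac:(lra)) as [Hb5 _].
  destruct (cont_pos (fun b => exp (1 - b ^ 2 / 2) - x) 0) as (d & Hd & H).
  { cont_auto. easy. }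
  { replace (1 - 0 ^ 2 / 2) with 1 by field. lra. }
  set (b := Rmin d 1). assert (Hb : 0 < b) by (apply Rmin_pos; lra).
  assert (Hb1 : b <= d /\ b <= 1) by (split; [apply Rmin_l|apply Rmin_r]).
  specialize (H b). rewrite Rminus_0_r, Rabs_pos_eq in H by lra. specialize (H (proj1 Hb1)). cbv beta in H.
  assert (Harg : arg (RtoC x) = 0).
  { unfold arg. rewrite Im_RtoC. unfold Rdiv. rewrite Rmult_0_l. apply atan_0. }
  apply (U_infty_sector _ b); rewrite ?Harg, ?Rabs_R0; [simpl; lra|lra|lra|].
  rewrite Cmod_R, Rabs_pos_eq by lra. apply Rlt_le_trans with (exp (1 - b ^ 2 / 2)); [lra|].
  assert (Hs : 0 < sin b) by (apply sin_gt_0; lra).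
  assert (Hsb : sin b < b) by (now apply sin_lt_x).
  assert (Hq : 1 <= b / sin b).
  { apply Rmult_le_reg_r with (sin b); [easy|]. unfold Rdiv. rewrite Rmult_assoc, Rinv_l by lra. lra. }
  unfold radius. rewrite Rplus_0_r, Rminus_0_r.
  rewrite <- (Rmult_1_l (exp (1 - b ^ 2 / 2))).
  apply Rmult_le_compat; [lra|left; apply exp_pos|easy|]. apply exp_le.
  replace (b * cot b) with (b / sin b * cos b) by (unfold cot; field; lra).
  pose proof (cos_ge_2 b ltac:(lra)). assert (0 <= cos b) by (apply cos_ge_0; lra). nra.
Qed.

(** The points of this half-line belong to [V_infty], but nearby non-real points do not, because
    [radius t (gamma t)] stays below e for small t > 0. *)
Lemma not_U_infty_real (x : R) : exp 1 < x ->
  exists d, 0 < d /\ forall w, Cmod (w - RtoC x) < d -> ~ U_infty w.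
Proof.
  intros Hx. pose proof (exp_pos 1).
  destruct (theta_bound (1 / 5) ltac:(lra)) as [Hb5 _].
  assert (Harg : arg (RtoC x) = 0).
  { unfold arg. rewrite Im_RtoC. unfold Rdiv. rewrite Rmult_0_l. apply atan_0. }
  destruct (arg_continuous (RtoC x) (theta (1 / 5))) as (d1 & Hd1 & H1); [simpl; lra|lra|].
  set (d := Rmin d1 (x - exp 1)). assert (Hd : 0 < d) by (apply Rmin_pos; lra).
  assert (Hd' : d <= d1 /\ d <= x - exp 1) by (split; [apply Rmin_l|apply Rmin_r]).
  assert (Hup : forall w, Cmod (w - RtoC x) < d -> 0 < Im w -> ~ V_infty w).
  { intros w Hw HI HV. destruct (H1 w ltac:(lra)) as [Hre Ha]. rewrite Harg, Rminus_0_r in Ha.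
    assert (Hap : 0 < arg w).
    { unfold arg. rewrite <- atan_0. apply atan_increasing. now apply Rdiv_lt_0_compat. }
    apply Rabs_def2 in Ha. rewrite (polar_arg w Hre) in HV. revert HV.
    apply not_V_infty_outside; [lra|]. eapply Rlt_trans; [apply radius_gamma_lt_e; lra|].
    pose proof (Cmod_triangle_sub (RtoC x) w) as Ht. rewrite Cmod_sub_sym, Cmod_R in Ht.
    rewrite Rabs_pos_eq in Ht by lra. lra. }
  exists d. split; [easy|]. intros w Hw HU.
  assert (HV : V_infty w) by now apply (locally_singleton w V_infty).
  destruct (Rtotal_order 0 (Im w)) as [HI|[HI|HI]].
  - now apply (Hup w).
  - apply locally_Cmod in HU. destruct HU as (d2 & Hd2 & HU).
    set (s := Rmin (d2 / 2) ((d - Cmod (w - RtoC x)) / 2)).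
    assert (Hs : 0 < s) by (apply Rmin_pos; lra).
    assert (Hs' : s <= d2 / 2 /\ s <= (d - Cmod (w - RtoC x)) / 2) by (split; [apply Rmin_l|apply Rmin_r]).
    assert (Hm : Cmod (RtoC s * Ci) = s) by (rewrite Cmod_scal, Cmod_Ci, Rabs_pos_eq; lra).
    apply (Hup (w + RtoC s * Ci)%C).
    + replace (w + RtoC s * Ci - RtoC x)%C with ((w - RtoC x) + RtoC s * Ci)%C by ring.
      eapply Rle_lt_trans; [apply Cmod_triangle|]. lra.
    + autorewrite with cplx. lra.
    + apply HU. replace (w + RtoC s * Ci - w)%C with (RtoC s * Ci)%C by ring. lra.
  - apply (Hup (Cconj w)).
    + replace (Cconj w - RtoC x)%C with (Cconj (w - RtoC x)) by (cext; ring). now rewrite Cmod_conj.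
    + rewrite Im_conj. lra.
    + now apply V_infty_conj.
Qed.

Lemma boundary_U_real (x : R) : 0 < x -> boundary U_infty (RtoC x) -> x = exp 1.
Proof.
  intros Hx Hb. destruct (Rtotal_order x (exp 1)) as [H|[H|H]]; [|easy|].
  - exfalso. apply Hb. apply U_infty_interior, U_infty_real. lra.
  - exfalso. destruct (not_U_infty_real x H) as (d & Hd & HU).
    destruct (boundary_closure _ _ Hb d Hd) as (w & Hw & Hwx). now apply (HU w).
Qed.

Lemma boundary_U_e : boundary U_infty (RtoC (exp 1)).
Proof.
  pose proof (exp_pos 1). apply boundary_intro; intros e He.
  - set (s := Rmin (e / 2) (exp 1 / 2)). assert (Hs : 0 < s) by (apply Rmin_pos; lra).
    assert (Hs' : s <= e / 2 /\ s <= exp 1 / 2) by (split; [apply Rmin_l|apply Rmin_r]).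
    exists (RtoC (exp 1 - s)). split; [apply U_infty_real; lra|].
    rewrite <- RtoC_minus, Cmod_R. apply Rabs_def1; lra.
  - exists (RtoC (exp 1 + e / 2)). split.
    + destruct (not_U_infty_real (exp 1 + e / 2)) as (d & Hd & HU); [lra|]. apply HU.
      replace (RtoC (exp 1 + e / 2) - RtoC (exp 1 + e / 2))%C with (RtoC 0) by ring. now rewrite Cmod_0.
    + rewrite <- RtoC_minus, Cmod_R. apply Rabs_def1; lra.
Qed.

Lemma boundary_U_polar (r t : R) : 0 < r -> 0 < t < theta (1 / 5) ->
  (boundary U_infty (polar r t) <-> r = radius t (gamma t)).
Proof.
  intros Hr Ht. destruct (theta_bound (1 / 5) ltac:(lra)) as [Hb5 Hb40]. pose proof PI2_3_2.
  assert (HU : forall s, 0 < s < radius t (gamma t) -> U_infty (polar s t)).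
  { intros s Hs. assert (Ha : arg (polar s t) = t) by (apply arg_polar; lra).
    assert (Hat : Rabs (arg (polar s t)) = t) by (rewrite Ha; apply Rabs_pos_eq; lra).
    pose proof (gamma_bounds t ltac:(lra)).
    apply (U_infty_sector _ (gamma t)); rewrite ?Hat; try lra.
    - rewrite Re_polar. apply Rmult_lt_0_compat; [lra|]. apply cos_gt_0; lra.
    - rewrite Cmod_polar_eq; lra. }
  split.
  - intros Hb. destruct (Rtotal_order r (radius t (gamma t))) as [Hlt|[He|Hgt]]; [|easy|]; exfalso.
    + apply Hb, U_infty_interior, HU. lra.
    + destruct (not_V_infty_open (polar r t)) as (d & Hd & HV).
      * rewrite Im_polar. apply Rmult_lt_0_compat; [easy|]. apply sin_gt_0; lra.
      * apply not_V_infty_outside; lra.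
      * destruct (boundary_closure _ _ Hb d Hd) as (w & Hw & Hwd). apply (HV w Hwd).
        now apply (locally_singleton w V_infty).
  - intros ->. set (rho := radius t (gamma t)) in *.
    assert (Hdist : forall s, Cmod (polar s t - polar rho t) = Rabs (s - rho)).
    { intros s. replace (polar s t - polar rho t)%C with (RtoC (s - rho) * polar 1 t)%C by (cext; ring).
      rewrite Cmod_scal, Cmod_polar_eq by lra. ring. }
    apply boundary_intro; intros e He.
    + set (s := Rmin (e / 2) (rho / 2)). assert (Hs : 0 < s) by (apply Rmin_pos; lra).
      assert (Hs' : s <= e / 2 /\ s <= rho / 2) by (split; [apply Rmin_l|apply Rmin_r]).
      exists (polar (rho - s) t). split; [apply HU; lra|]. rewrite Hdist. apply Rabs_def1; lra.
    + exists (polar (rho + e / 2) t). split.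
      * intros HUw. apply (locally_singleton _ V_infty) in HUw. revert HUw.
        apply not_V_infty_outside; [lra|]. fold rho. lra.
      * rewrite Hdist. apply Rabs_def1; lra.
Qed.

Lemma norm_C_R (z : C) : norm (z : C_R_NormedModule) = Cmod z.
Proof.
  change (sqrt (Rabs (fst z) ^ 2 + Rabs (snd z) ^ 2) = Cmod z). unfold Cmod. now rewrite !pow2_abs.
Qed.

Lemma is_derive_components (f : R -> C) (x : R) (l : C) :
  is_derive (f : R -> C_R_NormedModule) x l ->
  is_derive (fun t => Re (f t)) x (Re l) /\ is_derive (fun t => Im (f t)) x (Im l).
Proof.
  intros [_ H]. specialize (H x (fun P HP => HP)).
  assert (Hc : forall e, 0 < e -> exists d, 0 < d /\ forall h, Rabs h < d ->
    Cmod (f (x + h)%R - f x - RtoC h * l)%C <= e * Rabs h).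
  { intros e He. destruct (H (mkposreal e He)) as [d Hd]. exists d. split; [apply cond_pos|].
    intros h Hh. specialize (Hd (x + h)).
    assert (Hb : ball x d (x + h)).
    { change (Rabs (x + h - x) < d). now replace (x + h - x) with h by ring. }
    specialize (Hd Hb). rewrite norm_C_R in Hd.
    change (Cmod (f (x + h)%R - f x - scal (V := C_R_NormedModule) (x + h - x)%R l)%C
      <= e * Rabs (x + h - x)) in Hd.
    replace (x + h - x) with h in Hd by ring. rewrite scal_R_Cmult in Hd. exact Hd. }
  split; apply is_derive_eps; intros e He; destruct (Hc e He) as (d & Hd & Hb);
    exists d; (split; [easy|]); intros h Hh; (eapply Rle_trans; [|apply (Hb h Hh)]).
  - eapply Rle_trans; [|apply re_le_Cmod]. right. autorewrite with cplx. f_equal. ring.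
  - eapply Rle_trans; [|apply im_le_Cmod]. right. autorewrite with cplx. f_equal. ring.
Qed.

Lemma arg_arc (x : R) : 0 <= x <= 1 / 5 -> arg (arc x) = theta x.
Proof.
  intros Hx. pose proof PI2_3_2. unfold arc. apply arg_polar; [apply arc_radius_pos; lra|].
  destruct (proj1 Hx) as [H0| <-]; [|rewrite theta_0; lra].
  pose proof (theta_bound x ltac:(lra)). lra.
Qed.

Lemma arc_inj (x y : R) : 0 <= x <= 1 / 5 -> 0 <= y <= 1 / 5 -> arc x = arc y -> x = y.
Proof.
  intros Hx Hy H. apply theta_inj; try lra.
  rewrite <- (arg_arc x Hx), <- (arg_arc y Hy). now f_equal.
Qed.

(* Otherwise [theta x ^ 2 = x ^ 2 - sin x ^ 2], a function of [arg (arc x)], would be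
   stationary as well. *)
Lemma arc_velocity (x : R) : 0 < x < 1 / 5 ->
  ~ (is_derive (fun x => Re (arc x)) x 0 /\ is_derive (fun x => Im (arc x)) x 0).
Proof.
  intros Hx [HR HI].
  assert (Hre : 0 < Re (arc x)).
  { unfold arc. autorewrite with cplx. pose proof PI2_3_2.
    apply Rmult_lt_0_compat; [apply arc_radius_pos; lra|].
    pose proof (theta_bound x ltac:(lra)). apply cos_gt_0; lra. }
  assert (Hq : is_derive (fun y => Im (arc y) / Re (arc y)) x 0).
  { replace 0 with ((0 * Re (arc x) - Im (arc x) * 0) / Re (arc x) ^ 2) by (unfold Rdiv; ring).
    refine (is_derive_div _ _ x _ _ HI HR _). lra. }
  assert (Ha : is_derive (fun y => arg (arc y)) x 0).
  { pose proof (proj2 (is_derive_Reals _ _ _) (derivable_pt_lim_atan (Im (arc x) / Re (arc x)))) as Hd.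
    pose proof (is_derive_comp (V := R_NormedModule) atan _ x _ _ Hd Hq) as Hc.
    rewrite (scal_zero_l (V := R_NormedModule)) in Hc. exact Hc. }
  assert (Ht : is_derive theta x 0).
  { apply (is_derive_ext_loc (V := R_NormedModule) (fun y => arg (arc y))); [|exact Ha].
    assert (Hm : 0 < Rmin x (1 / 5 - x)) by (apply Rmin_pos; lra).
    exists (mkposreal _ Hm). intros y Hy. change (Rabs (y - x) < Rmin x (1 / 5 - x)) in Hy.
    pose proof (Rmin_l x (1 / 5 - x)). pose proof (Rmin_r x (1 / 5 - x)).
    apply Rabs_def2 in Hy. apply arg_arc. lra. }
  assert (H1 : is_derive (fun y => theta y * theta y) x 0).
  { pose proof (is_derive_mult theta theta x 0 0 Ht Ht ltac:(intros; apply Rmult_comm)) as H.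
    replace 0 with (plus (mult 0 (theta x)) (mult (theta x) 0)); [exact H|].
    change (0 * theta x + theta x * 0 = 0). ring. }
  assert (H2 : is_derive (fun y => theta y * theta y) x (2 * x - 2 * sin x * cos x)).
  { apply (is_derive_ext (V := R_NormedModule) (fun y => y ^ 2 - sin y ^ 2)).
    - intros y. rewrite <- theta_sqr. simpl. ring.
    - auto_derive; [easy|]. ring. }
  pose proof (is_derive_unique _ _ _ H1) as E1. rewrite (is_derive_unique _ _ _ H2) in E1.
  pose proof PI2_3_2.
  pose proof (sin_lt_x x ltac:(lra)). pose proof (sin_gt_0 x ltac:(lra) ltac:(lra)).
  pose proof (COS_bound x). nra.
Qed.

Lemma arc_analytic (s : R) : s = 1 \/ s = -1 ->
  analytic_arc (image (fun x => (Re (arc x), s * Im (arc x))) (fun x => 0 <= x <= 1 / 10)).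
Proof.
  intros Hs. assert (Hs0 : s * s = 1) by (destruct Hs; subst; ring).
  pose proof PI2_3_2. exists (fun x => (Re (arc x), s * Im (arc x))), 0, (1 / 10).
  split; [lra|]. split; [|split; [|split; [|easy]]].
  - intros t Ht. destruct (ana_arc t) as [H1 H2]; [apply Rabs_def1; lra|].
    apply real_analytic_pair; [easy|]. apply ana_mult; [apply ana_const|easy].
  - intros x y Hx Hy Heq. apply (f_equal (fun z => (Re z, s * Im z))) in Heq.
    injection Heq as H1 H2. apply arc_inj; [lra|lra|]. apply C_ext; [easy|].
    autorewrite with cplx in H2. rewrite <- !Rmult_assoc, Hs0, !Rmult_1_l in H2. exact H2.
  - intros x Hx Hd. apply is_derive_components in Hd. destruct Hd as [H1 H2].
    apply (arc_velocity x ltac:(lra)). split; [exact H1|].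
    apply (is_derive_ext (V := R_NormedModule) (fun x => s * (s * Im (arc x)))).
    + intros t. rewrite <- Rmult_assoc, Hs0. apply Rmult_1_l.
    + replace 0 with (s * 0) by ring. apply is_derive_scal. exact H2.
Qed.

Lemma analytic_arc_ext (S S' : C -> Prop) : (forall z, S z <-> S' z) ->
  analytic_arc S -> analytic_arc S'.
Proof.
  intros H (f & a & b & H1 & H2 & H3 & H4 & H5). exists f, a, b. repeat (split; [easy|]).
  intros z. rewrite <- H. apply H5.
Qed.

Lemma Gamma_arc (z : C) : Gamma (theta (1 / 10)) z <-> image arc (fun x => 0 <= x <= 1 / 10) z.
Proof.
  pose proof (theta_bound (1 / 10) ltac:(lra)) as [Hb _]. split; intros (t & Ht & ->).
  - destruct (proj1 Ht) as [H0| <-].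
    + exists (gamma t). assert (Hg : 0 <= gamma t <= 1 / 10).
      { destruct (gamma_spec t ltac:(lra)) as [Hg _]. split; [lra|].
        destruct (proj2 Ht) as [H1|H1].
        - left. apply gamma_lt; lra.
        - subst t. rewrite gamma_theta; lra. }
      split; [easy|]. rewrite arc_Lambda_hat by lra. now rewrite theta_gamma by lra.
    + exists 0. split; [lra|]. rewrite arc_Lambda_hat by lra. now rewrite theta_0.
  - exists (theta t). split.
    + split; [apply theta_nonneg|]. destruct (proj2 Ht) as [H1| ->]; [|lra].
      left. apply theta_lt; lra.
    + apply arc_Lambda_hat. lra.
Qed.

Definition edge (x : R) : C := if Rle_dec 0 x then arc x else Cconj (arc (- x)).

Lemma edge_nonneg (x : R) : 0 <= x -> edge x = arc x.
Proof. intros H. unfold edge. now destruct (Rle_dec 0 x). Qed.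

Lemma edge_nonpos (x : R) : x <= 0 -> edge x = Cconj (arc (- x)).
Proof.
  intros H. unfold edge. destruct (Rle_dec 0 x) as [H0|H0]; [|easy].
  replace x with 0 by lra. rewrite Ropp_0, arc_0. cext; ring.
Qed.

Lemma edge_components (x : R) :
  edge x = (Re (arc (Rabs x)), Im (arc ((Rabs x + x) * / 2)) - Im (arc ((Rabs x + - x) * / 2))).
Proof.
  assert (Hi : Im (arc 0) = 0) by now rewrite arc_0.
  destruct (Rle_dec 0 x) as [H|H].
  - rewrite edge_nonneg by easy. rewrite Rabs_pos_eq by easy.
    replace ((x + x) * / 2) with x by field. replace ((x + - x) * / 2) with 0 by field.
    rewrite Hi. cext; ring.
  - rewrite edge_nonpos by lra. rewrite Rabs_left by lra.
    replace ((- x + x) * / 2) with 0 by field. replace ((- x + - x) * / 2) with (- x) by field.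
    rewrite Hi. cext; ring.
Qed.

Lemma edge_continuous (x e : R) : Rabs x < PI -> 0 < e ->
  exists d, 0 < d /\ forall y, Rabs (y - x) < d -> Cmod (edge y - edge x) < e.
Proof.
  intros Hx He. pose proof (Rcontinuity_abs x) as Ha.
  assert (Hc : forall f : R -> R, (forall t, Rabs t < PI -> continuity_pt f t) ->
    forall s, s = 1 \/ s = -1 -> continuity_pt (fun y => f ((Rabs y + s * y) * / 2)) x).
  { intros f Hf s Hs.
    apply (continuity_pt_comp (fun y => (Rabs y + s * y) * / 2) f).
    - apply continuity_pt_mult; [|now apply continuity_pt_const].
      apply continuity_pt_plus; [easy|]. apply continuity_pt_mult.
      + now apply continuity_pt_const.
      + apply derivable_continuous_pt, derivable_pt_id.
    - apply Hf. destruct (Rle_dec 0 x); [rewrite (Rabs_pos_eq x) in *|rewrite (Rabs_left x) in *];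
        try lra; destruct Hs; subst s; apply Rabs_def1; lra. }
  assert (Hre : continuity_pt (fun y => Re (arc (Rabs y))) x).
  { apply (continuity_pt_comp Rabs (fun t => Re (arc t))); [easy|].
    apply ana_continuous, ana_arc. now rewrite Rabs_Rabsolu. }
  assert (Him : continuity_pt (fun y => Im (arc ((Rabs y + y) * / 2)) - Im (arc ((Rabs y + - y) * / 2))) x).
  { apply continuity_pt_minus.
    - apply (continuity_pt_ext (fun y => Im (arc ((Rabs y + 1 * y) * / 2)))).
      { intros t. now rewrite Rmult_1_l. }
      apply (Hc (fun t => Im (arc t))); [|now left]. intros t Ht. now apply ana_continuous, ana_arc.
    - apply (continuity_pt_ext (fun y => Im (arc ((Rabs y + -1 * y) * / 2)))).
      { intros t. now replace (-1 * t) with (- t) by ring. }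
      apply (Hc (fun t => Im (arc t))); [|now right]. intros t Ht. now apply ana_continuous, ana_arc. }
  destruct (curve_eps _ _ x e Hre Him He) as (d & Hd & H). exists d. split; [easy|].
  intros y Hy. rewrite !edge_components. now apply H.
Qed.

Lemma arg_edge (x : R) : Rabs x <= 1 / 5 ->
  arg (edge x) = if Rle_dec 0 x then theta x else - theta (- x).
Proof.
  intros Hx. apply Rabs_le_between in Hx. unfold edge. destruct (Rle_dec 0 x) as [H|H].
  - apply arg_arc. lra.
  - rewrite arg_conj. f_equal. apply arg_arc. lra.
Qed.

Lemma edge_inj (x y : R) : Rabs x <= 1 / 5 -> Rabs y <= 1 / 5 -> edge x = edge y -> x = y.
Proof.
  intros Hx Hy H. apply (f_equal arg) in H. rewrite (arg_edge x Hx), (arg_edge y Hy) in H.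
  destruct (Rle_dec 0 x) as [H1|H1], (Rle_dec 0 y) as [H2|H2].
  - now apply theta_inj.
  - pose proof (theta_nonneg x). pose proof (theta_pos (- y) ltac:(lra)). lra.
  - pose proof (theta_nonneg y). pose proof (theta_pos (- x) ltac:(lra)). lra.
  - apply Ropp_eq_reg. apply theta_inj; lra.
Qed.

Lemma boundary_U_edge (x : R) : Rabs x < 1 / 5 -> boundary U_infty (edge x).
Proof.
  assert (Hpos : forall x, 0 <= x < 1 / 5 -> boundary U_infty (arc x)).
  { intros y Hy. pose proof PI2_3_2. destruct (proj1 Hy) as [H0| <-].
    - pose proof (theta_lt y (1 / 5) ltac:(lra) ltac:(lra)). pose proof (theta_pos y ltac:(lra)).
      apply boundary_U_polar; [apply arc_radius_pos; lra|lra|].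
      rewrite gamma_theta by lra. apply arc_radius_eq. lra.
    - rewrite arc_0. apply boundary_U_e. }
  intros Hx. apply Rabs_lt_between in Hx. unfold edge. destruct (Rle_dec 0 x) as [H|H].
  - apply Hpos. lra.
  - apply boundary_U_conj, Hpos. lra.
Qed.

Lemma boundary_U_is_edge (z : C) : 0 < Re z -> Rabs (arg z) < theta (1 / 10) ->
  boundary U_infty z -> image edge (fun x => - (1 / 10) <= x <= 1 / 10) z.
Proof.
  pose proof (theta_bound (1 / 10) ltac:(lra)) as [Hb10 _].
  pose proof (theta_lt (1 / 10) (1 / 5) ltac:(lra) ltac:(lra)) as Hlt.
  assert (Hup : forall z, 0 < Re z -> 0 < arg z < theta (1 / 10) -> boundary U_infty z ->
    exists x, 0 < x < 1 / 10 /\ z = arc x).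
  { intros w Hw Ha HB. exists (gamma (arg w)).
    pose proof (gamma_lt (arg w) (1 / 10) Ha ltac:(lra)).
    destruct (gamma_spec (arg w) ltac:(lra)) as [Hg _]. split; [lra|].
    pose proof (re_le_Cmod w). pose proof (Rle_abs (Re w)). pose proof PI2_3_2.
    rewrite (polar_arg w Hw) in HB. apply boundary_U_polar in HB; [|lra|lra].
    rewrite (polar_arg w Hw) at 1. rewrite HB. unfold arc.
    rewrite arc_radius_eq by lra. now rewrite theta_gamma by lra. }
  intros Hz Ha HB. destruct (Rtotal_order (arg z) 0) as [H0|[H0|H0]].
  - rewrite Rabs_left in Ha by easy. destruct (Hup (Cconj z)) as (x & Hx & Hzx).
    + now rewrite Re_conj.
    + rewrite arg_conj. lra.
    + now apply boundary_U_conj.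
    + exists (- x). split; [lra|]. rewrite edge_nonpos by lra. rewrite Ropp_involutive, <- Hzx.
      now rewrite Cconj_conj.
  - exists 0. split; [lra|]. rewrite edge_nonneg, arc_0 by lra.
    pose proof (re_le_Cmod z). pose proof (Rle_abs (Re z)).
    assert (Hr : z = RtoC (Cmod z)).
    { rewrite (polar_arg z Hz) at 1. rewrite H0. cext; rewrite ?cos_0, ?sin_0; ring. }
    rewrite Hr in HB |- *. f_equal. apply boundary_U_real; [lra|easy].
  - rewrite Rabs_pos_eq in Ha by lra. destruct (Hup z Hz ltac:(lra) HB) as (x & Hx & ->).
    exists x. split; [lra|]. now rewrite edge_nonneg by lra.
Qed.

Lemma boundary_U_near_e : locally (RtoC (exp 1)) (fun z =>
  boundary U_infty z <-> image edge (fun x => - (1 / 10) <= x <= 1 / 10) z).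
Proof.
  pose proof (theta_bound (1 / 10) ltac:(lra)) as [Hb10 _]. pose proof (exp_pos 1).
  destruct (arg_continuous (RtoC (exp 1)) (theta (1 / 10))) as (d & Hd & H1); [easy|easy|].
  assert (Ha : arg (RtoC (exp 1)) = 0).
  { unfold arg. rewrite Im_RtoC. unfold Rdiv. now rewrite Rmult_0_l, atan_0. }
  apply locally_Cmod. exists d. split; [easy|]. intros z Hz.
  destruct (H1 z Hz) as [Hre Harg]. rewrite Ha, Rminus_0_r in Harg. split.
  - now apply boundary_U_is_edge.
  - intros (x & Hx & ->). apply boundary_U_edge, Rabs_def1; lra.
Qed.

Lemma boundary_U_piecewise_analytic : piecewise_analytic_near (boundary U_infty) (RtoC (exp 1)).
Proof.
  pose proof PI2_3_2. exists edge, 2%nat, (fun i => (INR i - 1) / 10).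
  replace ((INR 0 - 1) / 10) with (- (1 / 10)) by (simpl; field).
  replace ((INR 2 - 1) / 10) with (1 / 10) by (simpl; field).
  split; [lra|]. split; [now rewrite edge_nonneg, arc_0 by lra|].
  split; [|split; [|split]].
  - intros x Hx P HP. apply locally_Cmod in HP. destruct HP as (e & He & HP).
    destruct (edge_continuous x e) as (d & Hd & H1); [apply Rabs_def1; lra|easy|].
    exists (mkposreal d Hd). intros y Hy _. apply HP, H1. exact Hy.
  - intros x y Hx Hy. apply edge_inj; apply Rabs_le; lra.
  - intros i Hi. assert (Hi' : i = 0%nat \/ i = 1%nat) by lia. destruct Hi' as [-> | ->]; simpl INR.
    + split; [lra|]. eapply analytic_arc_ext; [|apply (arc_analytic (-1)); now right].
      intros z. split; intros (x & Hx & ->); exists (- x); (split; [lra|]).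
      * rewrite edge_nonpos by lra. rewrite Ropp_involutive. cext; ring.
      * rewrite edge_nonpos by lra. cext; ring.
    + split; [lra|]. eapply analytic_arc_ext; [|apply (arc_analytic 1); now left].
      intros z. split; intros (x & Hx & ->); exists x; (split; [lra|]); rewrite edge_nonneg by lra;
        cext; ring.
  - apply boundary_U_near_e.
Qed.

Lemma boundary_U_wedge (z : C) : 0 < Re z -> Rabs (arg z) < theta (1 / 10) ->
  boundary U_infty z -> Re z <= exp 1 - Rabs (Im z) / 24.
Proof.
  pose proof (exp_pos 1).
  assert (Hpos : forall x, 0 <= x <= 1 / 10 -> Re (arc x) <= exp 1 - Im (arc x) / 24 /\ 0 <= Im (arc x)).
  { intros x Hx. destruct (proj1 Hx) as [H0| <-]; [|rewrite arc_0; autorewrite with cplx; lra].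
    pose proof (theta_bound x ltac:(lra)) as [Hb Hb40].
    pose proof (theta_lt x (1 / 5) ltac:(lra) ltac:(lra)) as Hlt. pose proof PI2_3_2.
    pose proof (radius_gamma_le (theta x) ltac:(lra)) as Hr. rewrite gamma_theta in Hr by lra.
    rewrite <- arc_radius_eq in Hr by lra. pose proof (arc_radius_pos x ltac:(lra)).
    pose proof (sin_lt_x (theta x) ltac:(lra)). pose proof (sin_gt_0 (theta x) ltac:(lra) ltac:(lra)).
    pose proof (COS_bound (theta x)).
    assert (He : exp (1 - theta x / 12) <= exp 1 * (1 - theta x / 24)).
    { pose proof (exp_ineq1_le (theta x / 12)) as Hexp. pose proof (exp_pos (theta x / 12)).
      replace (1 - theta x / 12) with (1 + - (theta x / 12)) by ring. rewrite exp_plus.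
      apply Rmult_le_compat_l; [lra|]. rewrite exp_Ropp.
      apply (Rmult_le_reg_r (exp (theta x / 12))); [easy|]. rewrite Rinv_l by lra. nra. }
    unfold arc. autorewrite with cplx.
    assert (arc_radius x <= exp 1) by nra.
    assert (arc_radius x * sin (theta x) <= exp 1 * theta x) by (apply Rmult_le_compat; lra).
    split; nra. }
  intros Hz Ha HB. destruct (boundary_U_is_edge z Hz Ha HB) as (x & Hx & ->).
  unfold edge. destruct (Rle_dec 0 x) as [Hx0|Hx0].
  - destruct (Hpos x ltac:(lra)) as [H1 H2]. rewrite Rabs_pos_eq; lra.
  - destruct (Hpos (- x) ltac:(lra)) as [H1 H2]. autorewrite with cplx.
    rewrite Rabs_Ropp, Rabs_pos_eq; lra.
Qed.

Lemma boundary_U_not_smooth : ~ smooth_near (boundary U_infty) (RtoC (exp 1)).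
Proof.
  intros (f & df & h & a & Ha & Hf0 & Hf & _ & Hloc).
  pose proof (theta_bound (1 / 10) ltac:(lra)) as [Hb10 _]. pose proof (exp_pos 1).
  destruct (Hf 0 ltac:(lra)) as (Hd & _ & Hnz). apply is_derive_components in Hd.
  destruct Hd as [HR HI]. pose proof (proj1 (is_derive_eps _ _ _) HR) as ER.
  pose proof (proj1 (is_derive_eps _ _ _) HI) as EI.
  cbv beta in ER, EI. rewrite Hf0 in ER, EI. rewrite Re_RtoC in ER. rewrite Im_RtoC in EI.
  apply locally_Cmod in Hloc. destruct Hloc as (d1 & Hd1 & Hloc).
  destruct (arg_continuous (RtoC (exp 1)) (theta (1 / 10))) as (d2 & Hd2 & Harg); [easy|easy|].
  assert (Ha0 : arg (RtoC (exp 1)) = 0).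
  { unfold arg. rewrite Im_RtoC. unfold Rdiv. now rewrite Rmult_0_l, atan_0. }
  assert (Hw : exists d, 0 < d /\ forall x, Rabs x < d -> Re (f x) <= exp 1 - Rabs (Im (f x)) / 24).
  { destruct (curve_eps (fun x => Re (f x)) (fun x => Im (f x)) 0 (Rmin d1 d2)) as (d & Hd & Hc).
    - apply ex_derive_continuity_pt. eexists. exact HR.
    - apply ex_derive_continuity_pt. eexists. exact HI.
    - now apply Rmin_pos.
    - exists (Rmin d a). split; [now apply Rmin_pos|]. intros x Hx.
      pose proof (Rmin_l d a). pose proof (Rmin_r d a).
      pose proof (Rmin_l d1 d2). pose proof (Rmin_r d1 d2).
      assert (Hcx : Cmod (f x - RtoC (exp 1)) < Rmin d1 d2).
      { rewrite <- Hf0. specialize (Hc x). rewrite Rminus_0_r in Hc.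
        rewrite (surjective_pairing (f x)), (surjective_pairing (f 0)). apply Hc. lra. }
      destruct (Harg (f x) ltac:(lra)) as [Hre Harx]. rewrite Ha0, Rminus_0_r in Harx.
      apply boundary_U_wedge; [easy|easy|]. apply Hloc; [lra|].
      exists x. split; [|easy]. assert (Hxa : Rabs x < a) by lra. apply Rabs_def2 in Hxa. lra. }
  destruct Hw as (d & Hdp & Hw).
  assert (Hbound : forall e, 0 < e -> Rabs (Re (df 0)) <= e /\ Rabs (Im (df 0)) <= 50 * e).
  { intros e He. destruct (ER e He) as (r1 & Hr1 & H1). destruct (EI e He) as (r2 & Hr2 & H2).
    set (x := Rmin d (Rmin r1 r2) / 2).
    assert (Hm : 0 < Rmin d (Rmin r1 r2)) by (repeat apply Rmin_pos; easy).
    pose proof (Rmin_l d (Rmin r1 r2)). pose proof (Rmin_r d (Rmin r1 r2)).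
    pose proof (Rmin_l r1 r2). pose proof (Rmin_r r1 r2).
    assert (Hx : 0 < x /\ x < d /\ x < r1 /\ x < r2) by (unfold x; lra). clearbody x.
    assert (Hax : Rabs x = x) by (apply Rabs_pos_eq; lra).
    assert (Hanx : Rabs (- x) = x) by (now rewrite Rabs_Ropp).
    pose proof (Hw x ltac:(lra)) as W1. pose proof (Hw (- x) ltac:(lra)) as W2.
    specialize (H2 x ltac:(lra)). rewrite Hax, Rplus_0_l, Rminus_0_r in H2.
    pose proof (H1 x ltac:(lra)) as P1. pose proof (H1 (- x) ltac:(lra)) as P2.
    rewrite Hax, Rplus_0_l in P1. rewrite Hanx, Rplus_0_l in P2.
    apply Rabs_le_between in P1. apply Rabs_le_between in P2. apply Rabs_le_between in H2.
    pose proof (Rabs_pos (Im (f x))). pose proof (Rabs_pos (Im (f (- x)))).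
    assert (Hre : - e <= Re (df 0) <= e) by (split; apply (Rmult_le_reg_r x); lra).
    split; [now apply Rabs_le|].
    assert (Him : Rabs (Im (f x)) <= 48 * (e * x)) by nra. apply Rabs_le_between in Him.
    apply Rabs_le. split; apply (Rmult_le_reg_r x); lra. }
  apply Hnz. apply C_ext; rewrite ?Re_RtoC, ?Im_RtoC.
  - destruct (Req_dec (Re (df 0)) 0) as [E|E]; [easy|exfalso]. apply Rabs_pos_lt in E.
    destruct (Hbound (Rabs (Re (df 0)) / 2)); lra.
  - destruct (Req_dec (Im (df 0)) 0) as [E|E]; [easy|exfalso]. apply Rabs_pos_lt in E.
    destruct (Hbound (Rabs (Im (df 0)) / 100)); lra.
Qed.

Theorem theorem1p2 :
  (forall (L : C) (c : R),
     U_infty L -> 0 <= c <= 1 -> U_infty (RtoC c * L)%C)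
  /\
  ((forall z : C,
      boundary U_infty z /\ boundary C_infty z <->
      z = RtoC (- exp (-1)) \/ z = RtoC (exp 1)) /\
   (forall z : C,
      boundary C_infty z -> Im z <> 0 -> locally z (fun w => ~ U_infty w)))
  /\
  ((exists theta_max : R,
      0 < theta_max < PI /\
      analytic_arc (Gamma theta_max) /\
      locally (RtoC (exp 1))
        (fun z => boundary U_infty z ->
           Gamma theta_max z \/ conj_set (Gamma theta_max) z)) /\
   piecewise_analytic_near (boundary U_infty) (RtoC (exp 1)) /\
   ~ smooth_near (boundary U_infty) (RtoC (exp 1))).
Proof.
  split; [|split; split].
  - apply U_infty_star.
  - intros z. split.
    + intros [HU HC]. now apply boundary_both_real.
    + intros [-> | ->]; split; auto using boundary_U_infty_inv_e, boundary_C_infty_inv_e,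
        boundary_U_e, boundary_C_infty_e.
  - apply boundary_C_infty_nonreal.
  - exists (theta (1 / 10)). split; [apply theta_bound; lra|]. split.
    + apply (analytic_arc_ext (image (fun x => (Re (arc x), 1 * Im (arc x))) (fun x => 0 <= x <= 1 / 10))).
      * intros z. rewrite Gamma_arc. split; intros (x & Hx & ->); exists x; (split; [easy|]); cext; ring.
      * apply arc_analytic. now left.
    + pose proof boundary_U_near_e as Hloc. revert Hloc. apply filter_imp. intros z Hz HB.
      apply Hz in HB. destruct HB as (x & Hx & ->). unfold conj_set. rewrite !Gamma_arc.
      destruct (Rle_dec 0 x) as [H0|H0].
      * left. exists x. split; [lra|]. now apply edge_nonneg.
      * right. exists (- x). split; [lra|]. rewrite edge_nonpos by lra. apply Cconj_conj.
  - split; [apply boundary_U_piecewise_analytic|apply boundary_U_not_smooth].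
Qed.
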